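(* For every $\varepsilon\in(0,1]$ let $(\eta_{\varepsilon,n},\kappa_{\varepsilon,n})_{n\ge 0}$ be a Markov renewal process on $\mathbb X\times[0,\infty)$, and let $v_{\varepsilon,i}\in[1,\infty)$, $i\in\overline{\mathbb D}$, be normalisation functions. Assume: (A) $F_{\varepsilon,i}(0)<1$ for all $i\in\mathbb X$, $\varepsilon\in(0,1]$. (B) For every $i\in\overline{\mathbb D}$, $j\in\mathbb X$, either $p_{\varepsilon,ij}>0$ for all $\varepsilon\in(0,1]$ or $p_{\varepsilon,ij}=0$ for all $\varepsilon\in(0,1]$; and for every $i\in\overline{\mathbb D}$ there is a chain $i=j_0,j_1,\dots,j_n$ with $j_1,\dots,j_{n-1}\in\overline{\mathbb D}$, $j_n\in\mathbb D$ and $\prod_{l=1}^n p_{1,j_{l-1}j_l}>0$. (C) $p_{\varepsilon,ij}\to p_{0,ij}$ as $\varepsilon\to0$, for $i\in\overline{\mathbb D}$, $j\in\mathbb X$. (D) For $i\in\overline{\mathbb D}$, $j\in\mathbb Y_{1,i}$: $F_{\varepsilon,ij}(\cdot\, v_{\varepsilon,i})\Rightarrow F_{0,ij}(\cdot)$ as $\varepsilon\to0$, where $F_{0,ij}$ is a proper distribution function with $F_{0,ij}(0)<1$; and $v_{\varepsilon,i}\to v_{0,i}\in[1,\infty]$. (E) For $i\in\overline{\mathbb D}$, $j\in\mathbb Y_{1,i}$: $e_{\varepsilon,ij}<\infty$ for all $\varepsilon\in(0,1]$ and $e_{\varepsilon,ij}/v_{\varepsilon,i}\to e_{0,ij}=\int_0^\infty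 t\,F_{0,ij}(dt)<\infty$ as $\varepsilon\to0$. Let $k_1,\dots,k_{\bar m}$ be an enumeration of $\overline{\mathbb D}$ and assume, with the level-$n$ quantities defined in the context, that as $\varepsilon\to0$: (i) $\tilde p^{(n)}_{\varepsilon,ij}\to\tilde p^{(n)}_{0,ij}\in[0,1]$ for $i\in\overline{\mathbb D}_n$, $j\in\mathbb X_n$, $n=0,\dots,\bar m-1$; (ii) $\hat q^{(n)}_{\varepsilon,ij}\to\hat q^{(n)}_{0,ij}\in[0,1]$ for $i\in\overline{\mathbb D}_n$, $j\in\mathbb Y^{(n)}_i$, $n=1,\dots,\bar m-1$; (iii) $\tilde v^{(n-1)}_{\varepsilon,j}/\tilde v^{(n-1)}_{\varepsilon,i}\to\tilde w^{(n-1)}_{0,ji}\in[0,\infty]$ for $i,j\in\overline{\mathbb D}_{n-1}$, $n=1,\dots,\bar m-1$; (iv) $\tilde w^{(n-1)}_{0,k_ni}<\infty$ for all $i\in\overline{\mathbb D}_{n-1}$, $n=1,\dots,\bar m-1$. Then, for every $j\in\mathbb D$, with $\check v_{\varepsilon,k_{\bar m}}=\tilde v^{(\bar m-1)}_{\varepsilon,k_{\bar m}}$, $$G_{\varepsilon,\mathbb D,k_{\bar m}j}(\cdot\;\check v_{\varepsilon,k_{\bar m}})\Rightarrow G_{0,\mathbb D,k_{\bar m}j}(\cdot)=\tilde F^{(\bar m-1)}_{0,k_{\bar m}j}(\cdot)\;\tilde p^{(\bar m-1)}_{0,k_{\bar m}j}\quad\text{as }\varepsilon\to0,$$ where $\tilde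 F^{(\bar m-1)}_{0,k_{\bar m}j}$ is the distribution function with Laplace transform $\tilde\phi^{(\bar m-1)}_{0,k_{\bar m}j}$ for $j\in\tilde{\mathbb Y}^{(\bar m-1)}_{k_{\bar m}}$ (and $G_{0,\mathbb D,k_{\bar m}j}\equiv0$ otherwise).
   Context: $\mathbb X=\{1,\dots,M\}$, $M\ge2$; $\mathbb D$ is a nonempty proper subset of $\mathbb X$, $\overline{\mathbb D}=\mathbb X\setminus\mathbb D$, $\bar m=|\overline{\mathbb D}|\ge1$. For each $\varepsilon\in(0,1]$, a Markov renewal process $(\eta_{\varepsilon,n},\kappa_{\varepsilon,n})_{n\ge0}$ is a homogeneous Markov chain on $\mathbb X\times[0,\infty)$ whose transition probabilities $Q_{\varepsilon,ij}(t)=\mathsf P\{\eta_{\varepsilon,1}=j,\kappa_{\varepsilon,1}\le t\mid\eta_{\varepsilon,0}=i,\kappa_{\varepsilon,0}=s\}$ do not depend on $s$. Notation: $p_{\varepsilon,ij}=Q_{\varepsilon,ij}(\infty)$; $F_{\varepsilon,i}(t)=\sum_jQ_{\varepsilon,ij}(t)$; $F_{\varepsilon,ij}=Q_{\varepsilon,ij}/p_{\varepsilon,ij}$ if $p_{\varepsilon,ij}>0$; $e_{\varepsilon,ij}=\int_0^\infty tF_{\varepsilon,ij}(dt)$; $\mathbb Y_{1,i}=\{j\in\mathbb X:p_{1,ij}>0\}$; $\phi_{0,ij}(s)=\int_0^\infty e^{-st}F_{0,ij}(dt)$. Hitting times: $\nu_{\varepsilon,\mathbb D}=\min(n\ge1:\eta_{\varepsilon,n}\in\mathbb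 D)$, $\tau_{\varepsilon,\mathbb D}=\sum_{n=1}^{\nu_{\varepsilon,\mathbb D}}\kappa_{\varepsilon,n}$, $G_{\varepsilon,\mathbb D,ij}(t)=\mathsf P\{\tau_{\varepsilon,\mathbb D}\le t,\ \eta_{\varepsilon,\nu_{\varepsilon,\mathbb D}}=j\mid\eta_{\varepsilon,0}=i\}$. Weak convergence $\Rightarrow$ of possibly improper distribution functions means convergence at continuity points of the limit together with convergence of total masses (equivalently, pointwise convergence of Laplace transforms for all $s\ge0$). Level-$n$ quantities (for a given enumeration $k_1,\dots,k_{\bar m}$ of $\overline{\mathbb D}$). $\mathbb X_n=\mathbb X\setminus\{k_1,\dots,k_n\}$, $\overline{\mathbb D}_n=\overline{\mathbb D}\setminus\{k_1,\dots,k_n\}$, $0\le n\le\bar m-1$. For $\varepsilon\in(0,1]$, $i\in\overline{\mathbb D}_n$, $j\in\mathbb X_n$: $p^{(0)}_{\varepsilon,ij}=p_{\varepsilon,ij}$, $v^{(0)}_{\varepsilon,i}=v_{\varepsilon,i}$, $$\tilde p^{(n)}_{\varepsilon,ij}=\mathrm I(j\ne i)\frac{p^{(n)}_{\varepsilon,ij}}{1-p^{(n)}_{\varepsilon,ii}},\quad \tilde v^{(n)}_{\varepsilon,i}=\frac{v^{(n)}_{\varepsilon,i}}{1-p^{(n)}_{\varepsilon,ii}},\quad p^{(n)}_{\varepsilon,ij}=\tilde p^{(n-1)}_{\varepsilon,ij}+\tilde p^{(n-1)}_{\varepsilon,ik_n}\tilde p^{(n-1)}_{\varepsilon,k_nj},\quad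 v^{(n)}_{\varepsilon,i}=\tilde v^{(n-1)}_{\varepsilon,i}\quad(n\ge1).$$ (Condition (B) implies $p^{(n)}_{\varepsilon,ii}<1$ for $\varepsilon\in(0,1]$.) $\mathbb Y^{(n)}_i=\{j\in\mathbb X_n:p^{(n)}_{1,ij}>0\}$, $\tilde{\mathbb Y}^{(n)}_i=\mathbb Y^{(n)}_i\setminus\{i\}$; for $n\ge1$ and $j\in\mathbb Y^{(n)}_i$, $\hat q^{(n)}_{\varepsilon,ij}=\tilde p^{(n-1)}_{\varepsilon,ij}/p^{(n)}_{\varepsilon,ij}$. $p^{(n)}_{0,ij}=\lim_{\varepsilon\to0}p^{(n)}_{\varepsilon,ij}$, i.e. $p^{(0)}_{0,ij}=p_{0,ij}$ and $p^{(n)}_{0,ij}=\tilde p^{(n-1)}_{0,ij}+\tilde p^{(n-1)}_{0,ik_n}\tilde p^{(n-1)}_{0,k_nj}$. Limiting Laplace transforms and expectations: $\phi^{(0)}_{0,ij}=\phi_{0,ij}$, $e^{(0)}_{0,ij}=e_{0,ij}$. For $i\in\overline{\mathbb D}_n$, $j\in\tilde{\mathbb Y}^{(n)}_i$, writing $p=p^{(n)}_{0,ii}$, $$\tilde\phi^{(n)}_{0,ij}(s)=\begin{cases}\phi^{(n)}_{0,ij}(s),& i\notin\mathbb Y^{(n)}_i,\\ \frac{(1-p)\phi^{(n)}_{0,ij}((1-p)s)}{1-p\,\phi^{(n)}_{0,ii}((1-p)s)},& i\in\mathbb Y^{(n)}_i,\ p<1,\\ (1+e^{(n)}_{0,ii}s)^{-1},&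 p=1,\end{cases}\qquad\tilde e^{(n)}_{0,ij}=\begin{cases}e^{(n)}_{0,ij},& i\notin\mathbb Y^{(n)}_i,\\(1-p)e^{(n)}_{0,ij}+p\,e^{(n)}_{0,ii},& i\in\mathbb Y^{(n)}_i.\end{cases}$$ For $n\ge1$, $i\in\overline{\mathbb D}_n$, $j\in\mathbb Y^{(n)}_i$, writing $k=k_n$, $w=\tilde w^{(n-1)}_{0,k_ni}$, $q=\hat q^{(n)}_{0,ij}$, and $\tilde\phi,\tilde e,\tilde{\mathbb Y}$ for the level $n-1$ objects $\tilde\phi^{(n-1)}_0,\tilde e^{(n-1)}_0,\tilde{\mathbb Y}^{(n-1)}$: (a) if $j,k\in\tilde{\mathbb Y}_i$ and $j\in\tilde{\mathbb Y}_k$: $\phi^{(n)}_{0,ij}(s)=q\tilde\phi_{ij}(s)+(1-q)\tilde\phi_{ik}(s)\tilde\phi_{kj}(ws)$, $e^{(n)}_{0,ij}=q\tilde e_{ij}+(1-q)(\tilde e_{ik}+w\tilde e_{kj})$; (b) if $j\in\tilde{\mathbb Y}_i$ and ($k\notin\tilde{\mathbb Y}_i$ or $j\notin\tilde{\mathbb Y}_k$): $\phi^{(n)}_{0,ij}=\tilde\phi_{ij}$, $e^{(n)}_{0,ij}=\tilde e_{ij}$; (c) if $j\notin\tilde{\mathbb Y}_i$ (in particular $j=i$): $\phi^{(n)}_{0,ij}(s)=\tilde\phi_{ik}(s)\tilde\phi_{kj}(ws)$, $e^{(n)}_{0,ij}=\tilde e_{ik}+w\tilde e_{kj}$. *)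

(* Defs.v *)
From HB Require Import structures.
From mathcomp Require Import all_boot all_order all_algebra.
From mathcomp Require Import all_classical all_reals all_analysis.

Set Implicit Arguments.
Unset Strict Implicit.
Unset Printing Implicit Defensive.

Import Order.TTheory GRing.Theory Num.Theory.
Import numFieldNormedType.Exports.

Local Open Scope classical_set_scope.
Local Open Scope ring_scope.

Section DistributionFunctions.
Context {R : realType}.
Implicit Types F : R -> R.

Definition is_cumulative F : Prop := nondecreasing F /\ right_continuous F.

Definition cumulative_pack F (h : is_cumulative F) : cumulative R R :=
  HB.pack F (isCumulative.Build R _ R F (proj1 h) (proj2 h)).

(* The Stieltjes integral of g with respect to F(dt) over [0, +oo[; an atom at
   0 is included, since distribution functions are functions on the whole line
   that vanish at negative arguments. The value for a function F that is not
   cumulative is a dummy. *)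
Definition stieltjes_int F (g : R -> R) : \bar R :=
  match pselect (is_cumulative F) with
  | left h =>
      (\int[lebesgue_stieltjes_measure (cumulative_pack h)]_(t in `[0%R, +oo[)
         (g t)%:E)%E
  | right _ => 0%E
  end.

Definition total_mass F : R := lim (F @ +oo).

Definition proper_df F : Prop :=
  [/\ is_cumulative F, (forall t, t < 0 -> F t = 0) & F @ +oo --> (1 : R)].

Definition laplace F (s : R) : R :=
  fine (stieltjes_int F (fun t => expR (- (s * t)))).

Definition expectation_df F : \bar R := stieltjes_int F id.

(* Weak convergence, as the parameter e decreases to 0, of possibly improper
   distribution functions. *)
Definition weak_cvg (F : R -> R -> R) (G : R -> R) : Prop :=
  (forall t, {for t, continuous G} -> F e t @[e --> 0^'+] --> G t) /\
  total_mass (F e) @[e --> 0^'+] --> total_mass G.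

End DistributionFunctions.

Section MarkovRenewal.
Context (R : realType) (M : nat).

(* [mrp_P i] is the law of the process given that the initial state is i; the
   initial sojourn component kappa_0 may have any law. The last field is the
   Markov property: given the past up to time n, the pair with index n.+1 has
   the law determined by the state at time n alone, through the transition
   probabilities Q_ij(t) = mrp_P i {eta_1 = j, kappa_1 <= t}. *)
Record markov_renewal := MarkovRenewal {
  mrp_display : measure_display;
  mrp_space : measurableType mrp_display;
  mrp_P : 'I_M -> probability mrp_space R;
  mrp_eta : nat -> mrp_space -> 'I_M;
  mrp_kappa : nat -> mrp_space -> R;
  mrp_eta_measurable : forall n j, measurable [set w | mrp_eta n w = j];
  mrp_kappa_measurable : forall n, measurable_fun setT (mrp_kappa n);
  mrp_kappa_ge0 : forall n w, 0 <= mrp_kappa n w;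
  mrp_init : forall i, mrp_P i [set w | mrp_eta 0%N w = i] = 1%E;
  mrp_markov : forall i n (x : nat -> 'I_M) (t : nat -> R) (j : 'I_M) (u : R),
    let past := [set w | forall l, (l <= n)%N ->
                           mrp_eta l w = x l /\ mrp_kappa l w <= t l] in
    (mrp_P i (past `&`
              [set w | mrp_eta n.+1 w = j /\ (mrp_kappa n.+1 w <= u)%R]) =
     mrp_P i past *
     mrp_P (x n) [set w | mrp_eta 1%N w = j /\ (mrp_kappa 1%N w <= u)%R])%E
}.

Section Transition.
Variable Z : markov_renewal.

Definition trQ (i j : 'I_M) (t : R) : R :=
  fine (mrp_P Z i [set w | mrp_eta 1 w = j /\ mrp_kappa 1 w <= t]).

Definition trp (i j : 'I_M) : R := total_mass (trQ i j).

(* F_i *)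
Definition sojourn_df (i : 'I_M) (t : R) : R := \sum_(j < M) trQ i j t.

(* F_ij, only meaningful when 0 < p_ij *)
Definition trF (i j : 'I_M) (t : R) : R := trQ i j t / trp i j.

(* e_ij *)
Definition tre (i j : 'I_M) : \bar R := expectation_df (trF i j).

(* n is the first hitting index nu_D along the trajectory w *)
Definition is_nu (D : {set 'I_M}) (w : mrp_space Z) (n : nat) : Prop :=
  [/\ (0 < n)%N, mrp_eta n w \in D &
      forall l, (0 < l < n)%N -> mrp_eta l w \notin D].

(* G_{D,ij}; trajectories that never hit D do not contribute. *)
Definition hittingG (D : {set 'I_M}) (i j : 'I_M) (t : R) : R :=
  fine (mrp_P Z i [set w | exists n, [/\ is_nu D w n,
    \sum_(1 <= l < n.+1) mrp_kappa l w <= t & mrp_eta n w = j]]).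

End Transition.
End MarkovRenewal.

(* The enumeration k_1, ..., k_mbar is a function [k] of which only the values
   at 1, ..., mbar are used. The level-n quantities below are total functions,
   meaningful only on the index ranges of the level. *)

Section Levels.
Context {R : realType} {M : nat}.
Implicit Types (p pt : 'I_M -> 'I_M -> R) (v : 'I_M -> R) (k : nat -> 'I_M).

Definition removed k (n : nat) : seq 'I_M := [seq k l | l <- iota 1 n].

Definition Xlev k (n : nat) : {set 'I_M} := [set i | i \notin removed k n].

Definition Dbarlev (D : {set 'I_M}) k (n : nat) : {set 'I_M} :=
  [set i in Xlev k n | i \notin D].

Definition ptilde p (i j : 'I_M) : R := (j != i)%:R * (p i j / (1 - p i i)).

Definition pstep pt (c i j : 'I_M) : R := pt i j + pt i c * pt c j.

Fixpoint plev p k (n : nat) : 'I_M -> 'I_M -> R :=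
  match n with
  | 0 => p
  | n'.+1 => pstep (ptilde (plev p k n')) (k n)
  end.

Definition ptlev p k (n : nat) : 'I_M -> 'I_M -> R := ptilde (plev p k n).

Fixpoint vlev p v k (n : nat) (i : 'I_M) : R :=
  match n with
  | 0 => v i
  | n'.+1 => vlev p v k n' i / (1 - plev p k n' i i)
  end.

Definition vtlev p v k (n : nat) (i : 'I_M) : R :=
  vlev p v k n i / (1 - plev p k n i i).

(* meaningful for n >= 1 *)
Definition qhat p k (n : nat) (i j : 'I_M) : R :=
  ptlev p k n.-1 i j / plev p k n i j.

(* In Ylev and Ytlev, p stands for the transition matrix at parameter 1. *)
Definition Ylev p k (n : nat) (i : 'I_M) : {set 'I_M} :=
  [set j in Xlev k n | 0 < plev p k n i j].

Definition Ytlev p k (n : nat) (i : 'I_M) : {set 'I_M} := Ylev p k n i :\ i.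

(* p^(n)_0 from p_0 and from the limits pt0 n of the matrices ptlev n *)
Definition p0lev (p0 : 'I_M -> 'I_M -> R) (pt0 : nat -> 'I_M -> 'I_M -> R) k
    (n : nat) : 'I_M -> 'I_M -> R :=
  match n with
  | 0 => p0
  | n'.+1 => pstep (pt0 n') (k n)
  end.

End Levels.

Section LimitTransforms.
Context {R : realType} {M : nat}.
Variables
  (p1 : 'I_M -> 'I_M -> R)           (* p_1 *)
  (p0 : 'I_M -> 'I_M -> R)           (* p_0 *)
  (pt0 : nat -> 'I_M -> 'I_M -> R)   (* limits of the matrices ptlev n *)
  (qh0 : nat -> 'I_M -> 'I_M -> R)   (* limits of the qhat n *)
  (w0 : nat -> 'I_M -> 'I_M -> \bar R) (* w0 n j i = lim of v~(n)_j / v~(n)_i *)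
  (F0 : 'I_M -> 'I_M -> R -> R)      (* F_0 *)
  (k : nat -> 'I_M).

Definition etilde0 (n : nat) (e : 'I_M -> 'I_M -> R) (i j : 'I_M) : R :=
  let p := p0lev p0 pt0 k n i i in
  if i \in Ylev p1 k n i then (1 - p) * e i j + p * e i i else e i j.

Definition phitilde0 (n : nat) (phi : 'I_M -> 'I_M -> R -> R)
    (e : 'I_M -> 'I_M -> R) (i j : 'I_M) (s : R) : R :=
  let p := p0lev p0 pt0 k n i i in
  if i \notin Ylev p1 k n i then phi i j s
  else if p == 1 then (1 + e i i * s)^-1
  else (1 - p) * phi i j ((1 - p) * s) / (1 - p * phi i i ((1 - p) * s)).

(* From the level-n quantities with a tilde to level n.+1. *)

Definition estep0 (n : nat) (et : 'I_M -> 'I_M -> R) (i j : 'I_M) : R :=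
  let c := k n.+1 in
  let Yt := Ytlev p1 k n in
  let w := fine (w0 n c i) in
  let q := qh0 n.+1 i j in
  if j \in Yt i then
    if (c \in Yt i) && (j \in Yt c)
    then q * et i j + (1 - q) * (et i c + w * et c j)
    else et i j
  else et i c + w * et c j.

Definition phistep0 (n : nat) (phit : 'I_M -> 'I_M -> R -> R) (i j : 'I_M)
    (s : R) : R :=
  let c := k n.+1 in
  let Yt := Ytlev p1 k n in
  let w := fine (w0 n c i) in
  let q := qh0 n.+1 i j in
  if j \in Yt i then
    if (c \in Yt i) && (j \in Yt c)
    then q * phit i j s + (1 - q) * (phit i c s * phit c j (w * s))
    else phit i j s
  else phit i c s * phit c j (w * s).

Fixpoint e0lev (n : nat) : 'I_M -> 'I_M -> R :=
  match n with
  | 0 => fun i j => fine (expectation_df (F0 i j))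
  | n'.+1 => estep0 n' (etilde0 n' (e0lev n'))
  end.

Fixpoint phi0lev (n : nat) : 'I_M -> 'I_M -> R -> R :=
  match n with
  | 0 => fun i j => laplace (F0 i j)
  | n'.+1 => phistep0 n' (phitilde0 n' (phi0lev n') (e0lev n'))
  end.

Definition phit0lev (n : nat) : 'I_M -> 'I_M -> R -> R :=
  phitilde0 n (phi0lev n) (e0lev n).

End LimitTransforms.

(* Main.v *)
(* The matrix q(s) of the transforms E_i[exp(-s kappa_1); eta_1 = j] and the
   vector g(s) of the transforms of the hitting distributions satisfy the linear
   system g_i = q_ij + sum_{r notin D} q_ir g_r, and removing the states k_1,
   ..., k_mbar one after another is Gaussian elimination for this system: the
   level-n formulas for p, applied to q(s) instead of p, end with g_{k_mbar}.
   Hence the level-n Laplace transforms are the quotients of the eliminated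
   matrices of q(s) and p, and no reduced process has to be constructed.

   The limit is taken in the class [decay] of functions f with f(0) = 1 for
   which f and (1 - f(s))/s are nonincreasing and (1 - f(s))/s tends to a mean
   m at 0. This class contains the Laplace transforms of distributions with
   finite mean, is stable under all operations of the elimination, and gives the
   Lipschitz bound m; convergent means therefore permit moving arguments, and in
   the case p_0,ii = 1 the monotonicity of (1 - f(s))/s yields (1 + e s)^-1.

   Passing between Laplace transforms and weak convergence relies on the
   functions 1 - (1 - exp(-a n x))^(2^n), finite combinations of exponentials
   that approximate indicators of intervals [0, t]. *)

Require Import Defs.
From mathcomp Require Import all_boot all_order all_algebra.
From mathcomp Require Import all_classical all_reals all_analysis.
From mathcomp Require Import measurable_realfun.
From mathcomp Require Import ring lra.

Set Implicit Arguments.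
Unset Strict Implicit.
Unset Printing Implicit Defensive.

Import Order.TTheory GRing.Theory Num.Theory.
Import numFieldNormedType.Exports.

Local Open Scope classical_set_scope.
Local Open Scope ring_scope.

(** * Elimination of states *)

(** Each state is observed on its own time scale, and the scales change with the level: removing the
    loops at i divides its scale by 1 - p_ii, and a passage through k_n, known on the scale of k_n,
    has to be read on the scale of i. Both changes multiply the argument of a transform by a factor
    that depends on epsilon, so pointwise convergence of transforms alone does not pass from one
    level to the next; this is why means are carried along. If p_0,ii = 1, numerator and denominator
    of the loop formula both tend to 0, and the limit retains only the slope at 0 of the loop
    transform. Transforms are divided by entries of p because an entry may tend to 0 while the
    conditional law keeps a proper limit. The positions of the positive entries do not depend on
    epsilon, so those at epsilon = 1 serve throughout. The limit formulas define functions, not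
    distributions. A distribution function with the final transform is constructed only at the end,
    from the normalised hitting distributions themselves. *)

Section Elimination.
Context {R : realType} {M : nat}.
Implicit Types (p q : 'I_M -> 'I_M -> R) (S X : {set 'I_M}).

(* The absence of closed subsets is what keeps the diagonal below 1 at every
   level of the elimination. *)
Definition escaping S X p : Prop :=
  [/\ forall i j, i \in S -> j \in X -> 0 <= p i j,
      forall i, i \in S -> \sum_(j in X) p i j <= 1 &
      forall A : {set 'I_M}, A != finset.set0 -> A \subset S ->
        exists i j, [/\ i \in A, j \in X, j \notin A & 0 < p i j]].

(** The singleton of i is not closed: some off-diagonal entry of row i is positive, and the row sum
    leaves less than 1 for the diagonal. *)
Lemma escaping_diag_lt1 S X p i : S \subset X -> escaping S X p ->
  i \in S -> p i i < 1.
Proof.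
move=> SX [p0 p1 pe] iS.
have [||i' [j [/finset.set1P -> jX jA pj]]] := pe [set i]%SET.
- by apply/finset.set0Pn; exists i; rewrite finset.in_set1.
- by rewrite finset.sub1set.
rewrite finset.in_set1 in jA.
have iX : i \in X by exact: (fintype.subsetP SX).
have := p1 _ iS; rewrite (bigD1 i)//= (bigD1 j) /=; last by rewrite jX jA.
apply: lt_le_trans; rewrite ltrDl ltr_wpDr//.
by apply: sumr_ge0 => l /andP[/andP[lX _] _]; exact: p0.
Qed.

Lemma ptilde_ge0 S X p i j : S \subset X -> escaping S X p ->
  i \in S -> j \in X -> 0 <= ptilde p i j.
Proof.
move=> SX pe iS jX; have [p0 _ _] := pe.
by rewrite /ptilde mulr_ge0// divr_ge0 ?p0// subr_ge0 ltW// (escaping_diag_lt1 SX pe).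
Qed.

Lemma ptilde_diag p i : ptilde p i i = 0.
Proof. by rewrite /ptilde eqxx mul0r. Qed.

Lemma ptilde_offdiag p i j : j != i -> ptilde p i j = p i j / (1 - p i i).
Proof. by move=> ji; rewrite /ptilde ji mul1r. Qed.

Lemma ptilde_gt0 S X p i j : S \subset X -> escaping S X p ->
  i \in S -> j \in X -> j != i -> (0 < ptilde p i j) = (0 < p i j).
Proof.
move=> SX pe iS jX ji; rewrite ptilde_offdiag// pmulr_lgt0//.
by rewrite invr_gt0 subr_gt0 (escaping_diag_lt1 SX pe).
Qed.

Lemma ptilde_sum_le1 S X p i : S \subset X -> escaping S X p ->
  i \in S -> \sum_(j in X) ptilde p i j <= 1.
Proof.
move=> SX pe iS; have [p0 p1 _] := pe.
have iX : i \in X by exact: (fintype.subsetP SX).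
have pii := escaping_diag_lt1 SX pe iS.
rewrite (bigD1 i)//= ptilde_diag add0r.
rewrite (eq_bigr (fun j => p i j / (1 - p i i))); last first.
  by move=> j /andP[_ ji]; rewrite ptilde_offdiag.
rewrite -mulr_suml ler_pdivrMr ?subr_gt0// mul1r lerBrDl.
by have := p1 _ iS; rewrite (bigD1 i).
Qed.

(** The quotient x / (1 - y) increases in x >= 0 and in y < 1. In the application q is the matrix of
    transforms, dominated entrywise by p. *)
Lemma ptilde_le S X p q : S \subset X -> escaping S X p ->
  (forall i j, i \in S -> j \in X -> 0 <= q i j <= p i j) ->
  forall i j, i \in S -> j \in X -> 0 <= ptilde q i j <= ptilde p i j.
Proof.
move=> SX pe qp a b aS bX; rewrite /ptilde.
case: (b != a); last by rewrite !mul0r lexx.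
rewrite !mul1r; have /andP[q0 qp'] := qp _ _ aS bX.
have /andP[qa qa'] := qp _ _ aS (fintype.subsetP SX _ aS).
have pa := escaping_diag_lt1 SX pe aS.
rewrite divr_ge0 ?q0 ?subr_ge0 ?(le_trans qa' (ltW pa))//=.
apply: ler_pM => //.
  by rewrite invr_ge0 subr_ge0 ?(le_trans qa' (ltW pa)).
rewrite lef_pV2 ?posrE ?subr_gt0 ?(le_lt_trans qa')//.
by rewrite lerD2l lerN2.
Qed.

(** Row sums: the mass going to c is spread along row c, whose sum is at most 1. Exits from A: if no
    state of A leads to c, an exit of A for p avoids c and survives. Otherwise take an exit j of A
    together with c; if it starts at c, some i in A reaches j through c. *)
Lemma escaping_step S X p c : S \subset X -> escaping S X p -> c \in S ->
  escaping (S :\ c) (X :\ c) (pstep (ptilde p) c).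
Proof.
move=> SX pe cS; have [p0 p1 pA] := pe.
have cX : c \in X by exact: (fintype.subsetP SX).
have t0 := ptilde_ge0 SX pe.
have m0 i j : i \in S -> j \in X -> 0 <= ptilde p i c * ptilde p c j.
  by move=> iS jX; apply: mulr_ge0; exact: t0.
split.
- move=> i j /finset.setD1P[_ iS] /finset.setD1P[_ jX].
  by apply: addr_ge0; [exact: t0|exact: m0].
- move=> i /finset.setD1P[ic iS]; rewrite big_split/= -mulr_sumr.
  have := ptilde_sum_le1 SX pe iS; rewrite (finset.big_setD1 c)//=.
  have := ptilde_sum_le1 SX pe cS; rewrite (finset.big_setD1 c)//= ptilde_diag add0r.
  set u := \sum_(j in _) ptilde p c j; set w := \sum_(j in _) _ => u1 w1.
  have tic : 0 <= ptilde p i c by exact: t0.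
  apply: le_trans w1; rewrite addrC lerD2r.
  by rewrite -[leRHS]mulr1; exact: ler_wpM2l.
move=> A A0 AS.
have AS' : A \subset S by apply: (fintype.subset_trans AS); exact: finset.subsetDl.
have cA : c \notin A.
  by apply/negP => /(fintype.subsetP AS); rewrite !inE eqxx.
have [[i [iA pic]]|npc] := pselect (exists i, i \in A /\ 0 < p i c); last first.
  have [i [j [iA jX jA pij]]] := pA _ A0 AS'.
  have jc : j != c.
    by apply/eqP => jc; apply: npc; exists i; rewrite -jc.
  have iS : i \in S by exact: (fintype.subsetP AS').
  exists i, j; split => //; first by rewrite !inE jc.
  rewrite /pstep ltr_pwDl ?m0// (ptilde_gt0 SX pe)//.
  by apply: contra jA => /eqP ->.
have cAS : c |: A \subset S.
  by apply/fintype.subsetP => x /finset.setU1P[->//|]; exact: (fintype.subsetP AS').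
have [|i' [j [iA' jX jA pij]]] := pA (c |: A) _ cAS.
  by apply/finset.set0Pn; exists c; rewrite !inE eqxx.
move: jA; rewrite !inE negb_or => /andP[jc jA].
have iS : i' \in S by exact: (fintype.subsetP cAS).
have ji' : j != i'.
  by apply/eqP => ji; move: iA'; rewrite -ji !inE (negbTE jc) (negbTE jA).
have tij : 0 < ptilde p i' j by rewrite (ptilde_gt0 SX pe).
have iS' : i \in S by exact: (fintype.subsetP AS').
have ic : c != i by apply: contraNN cA => /eqP ->.
move: iA'; rewrite !inE => /predU1P[ic'|iA'].
  exists i, j; split => //; first by rewrite !inE jc.
  rewrite /pstep -ic' ltr_wpDl ?t0// mulr_gt0// ic'.
  by rewrite (ptilde_gt0 SX pe).
exists i', j; split => //; first by rewrite !inE jc.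
by rewrite /pstep ltr_pwDl ?m0.
Qed.

Lemma Xlev0 k : Xlev (M := M) k 0 = [set: 'I_M]%SET.
Proof. by apply/finset.setP => i; rewrite !inE. Qed.

Lemma iota1S n : iota 1 n.+1 = rcons (iota 1 n) n.+1.
Proof. by rewrite -[in LHS](addn1 n) iotaD cats1. Qed.

Lemma XlevS k n : Xlev (M := M) k n.+1 = Xlev k n :\ k n.+1.
Proof.
apply/finset.setP => i; rewrite finset.in_setD1 ![_ \in Xlev _ _]finset.in_set /removed.
rewrite iota1S map_rcons mem_rcons in_cons.
by rewrite negb_or.
Qed.

Lemma Dbarlev0 D k : Dbarlev (M := M) D k 0 = ~: D.
Proof. by apply/finset.setP => i; rewrite !inE. Qed.

Lemma DbarlevS D k n : Dbarlev (M := M) D k n.+1 = Dbarlev D k n :\ k n.+1.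
Proof. by apply/finset.setP => i; rewrite /Dbarlev XlevS !inE andbA. Qed.

Lemma Dbarlev_sub_Xlev D k n : Dbarlev (M := M) D k n \subset Xlev k n.
Proof. by apply/fintype.subsetP => i; rewrite inE => /andP[]. Qed.

Section Enumeration.
Variables (D : {set 'I_M}) (k : nat -> 'I_M) (m : nat).
Hypothesis hk : perm_eq [seq k n | n <- iota 1 m] (enum (~: D)).

Lemma enum_notin n : (0 < n <= m)%N -> k n \notin D.
Proof.
move=> nm; have : k n \in enum (~: D).
  by rewrite -(perm_mem hk) map_f// mem_iota add1n ltnS.
by rewrite mem_enum inE.
Qed.

Lemma enum_in_Dbarlev n : (n < m)%N -> k n.+1 \in Dbarlev D k n.
Proof.
move=> nm; rewrite !inE enum_notin ?nm// andbT /removed.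
have : uniq [seq k n | n <- iota 1 m] by rewrite (perm_uniq hk) enum_uniq.
rewrite -(subnKC nm) iotaD map_cat cat_uniq => /and3P[+ _ _].
by rewrite iota1S map_rcons rcons_uniq => /andP[].
Qed.

Lemma mem_D_Xlev n j : (n <= m)%N -> j \in D -> j \in Xlev k n.
Proof.
move=> nm jD; rewrite inE; apply/negP => /mapP[l]; rewrite mem_iota => /andP[l0 l1] jk.
have := @enum_notin l; rewrite -jk jD; move/implyP; rewrite implybF l0/=.
by rewrite (leq_trans _ nm)//; rewrite add1n in l1.
Qed.

Lemma Dbarlev_last i : (0 < m)%N -> i \in Dbarlev D k m.-1 -> i = k m.
Proof.
case: m hk => // m' hk' _ /=; rewrite !inE => /andP[ir iD].
have : i \in enum (~: D) by rewrite mem_enum inE.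
rewrite -(perm_mem hk') iota1S map_rcons mem_rcons in_cons (negbTE ir) orbF.
by move/eqP.
Qed.

Lemma escaping_lev p n : escaping (~: D) [set: 'I_M]%SET p -> (n < m)%N ->
  escaping (Dbarlev D k n) (Xlev k n) (plev p k n).
Proof.
move=> pe; elim: n => [|n IH] nm; first by rewrite Dbarlev0 Xlev0.
rewrite DbarlevS XlevS; apply: escaping_step; first exact: Dbarlev_sub_Xlev.
  by apply: IH; exact: ltnW.
by apply: enum_in_Dbarlev; exact: ltnW.
Qed.

Lemma plev_le p q n : escaping (~: D) [set: 'I_M]%SET p ->
  (forall i j, i \notin D -> 0 <= q i j <= p i j) -> (n < m)%N ->
  forall i j, i \in Dbarlev D k n -> j \in Xlev k n ->
    0 <= plev q k n i j <= plev p k n i j.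
Proof.
move=> pe qp; elim: n => [|n IH] nm i j.
  by rewrite Dbarlev0 !inE => iD _; exact: qp.
have {}IH := IH (ltnW nm); have cS := enum_in_Dbarlev (ltnW nm).
have SX := Dbarlev_sub_Xlev D k n.
have pen := escaping_lev pe (ltnW nm).
rewrite DbarlevS XlevS => /finset.setD1P[ic iS] /finset.setD1P[jc jX].
have t := ptilde_le SX pen IH.
have cX := fintype.subsetP SX _ cS.
have /andP[t1 t1'] := t _ _ iS jX; have /andP[t2 t2'] := t _ _ iS cX.
have /andP[t3 t3'] := t _ _ cS jX.
apply/andP; split; first by apply: addr_ge0 => //; exact: mulr_ge0.
by apply: lerD => //; exact: ler_pM.
Qed.

Lemma ptlev_le p q n : escaping (~: D) [set: 'I_M]%SET p ->
  (forall i j, i \notin D -> 0 <= q i j <= p i j) -> (n < m)%N ->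
  forall i j, i \in Dbarlev D k n -> j \in Xlev k n ->
    0 <= ptlev q k n i j <= ptlev p k n i j.
Proof.
move=> pe qp nm; apply: ptilde_le; first exact: Dbarlev_sub_Xlev.
- exact: escaping_lev.
- exact: plev_le.
Qed.

Lemma plev_diag_lt1 p n i : escaping (~: D) [set: 'I_M]%SET p -> (n < m)%N ->
  i \in Dbarlev D k n -> plev p k n i i < 1.
Proof.
move=> pe nm; apply: (escaping_diag_lt1 (X := Xlev k n)).
  exact: Dbarlev_sub_Xlev.
exact: escaping_lev.
Qed.

Lemma plev_gt0 p n i j : escaping (~: D) [set: 'I_M]%SET p -> (n.+1 < m)%N ->
  i \in Dbarlev D k n.+1 -> j \in Xlev k n.+1 ->
  (0 < plev p k n.+1 i j) = (0 < ptlev p k n i j) ||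
    (0 < ptlev p k n i (k n.+1)) && (0 < ptlev p k n (k n.+1) j).
Proof.
move=> pe nm; rewrite DbarlevS XlevS.
move=> /finset.setD1P[ic iS] /finset.setD1P[jc jX].
have cS := enum_in_Dbarlev (ltnW nm).
have SX := Dbarlev_sub_Xlev D k n; have cX := fintype.subsetP SX _ cS.
have t0 := ptilde_ge0 SX (escaping_lev pe (ltnW nm)).
have := t0 _ _ iS jX; have := t0 _ _ iS cX; have := t0 _ _ cS jX.
rewrite /= /pstep -![ptilde (plev p k n)]/(ptlev p k n).
move: (ptlev p k n i j) (ptlev p k n i _) (ptlev p k n _ j) => x y z z0 y0 x0.
rewrite [in RHS]lt0r x0 [0 < y]lt0r y0 [0 < z]lt0r z0 !andbT.
rewrite lt0r paddr_eq0 ?mulr_ge0// mulf_eq0 addr_ge0 ?mulr_ge0// andbT.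
by rewrite negb_and negb_or.
Qed.

(** By [plev_gt0], positivity at a level is decided by positivity one level below, so matrices with
    the same positive entries keep the same positive entries. This lets the sets Y at parameter 1
    serve for all parameters. *)
Lemma plev_gt0_eq p1 p2 n : escaping (~: D) [set: 'I_M]%SET p1 ->
  escaping (~: D) [set: 'I_M]%SET p2 ->
  (forall i j, i \notin D -> (0 < p1 i j) = (0 < p2 i j)) -> (n < m)%N ->
  forall i j, i \in Dbarlev D k n -> j \in Xlev k n ->
    (0 < plev p1 k n i j) = (0 < plev p2 k n i j).
Proof.
move=> e1 e2 E; elim: n => [|n IH] nm i j.
  by rewrite Dbarlev0 !inE => iD _; exact: E.
move=> iS jX; rewrite !plev_gt0//; move: iS jX; rewrite DbarlevS XlevS.
move=> /finset.setD1P[ic iS] /finset.setD1P[jc jX].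
have cS := enum_in_Dbarlev (ltnW nm).
have SX := Dbarlev_sub_Xlev D k n; have cX := fintype.subsetP SX _ cS.
have H a b : a \in Dbarlev D k n -> b \in Xlev k n ->
    (0 < ptlev p1 k n a b) = (0 < ptlev p2 k n a b).
  move=> aS bX; have [->|ba] := eqVneq b a; first by rewrite /ptlev !ptilde_diag.
  rewrite /ptlev (ptilde_gt0 SX (escaping_lev e1 (ltnW nm)))//.
  by rewrite (ptilde_gt0 SX (escaping_lev e2 (ltnW nm)))// IH// ltnW.
by rewrite !H.
Qed.

(** One step of Gaussian elimination: the equation of the removed state gives its unknown, which is
    substituted into the other equations. Column j plays the part of the right-hand side; it is
    never removed because j is in D. *)
Lemma elimination_lev q (g : 'I_M -> R) j n : j \in D ->
  (forall n i, (n < m)%N -> i \in Dbarlev D k n -> plev q k n i i != 1) ->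
  (forall i, i \notin D -> g i = q i j + \sum_(r in ~: D) q i r * g r) ->
  (n < m)%N -> forall i, i \in Dbarlev D k n ->
  g i = plev q k n i j + \sum_(r in Dbarlev D k n) plev q k n i r * g r.
Proof.
move=> jD q1 gE; elim: n => [|n IH] nm i.
  by rewrite Dbarlev0 inE => /gE.
have cS := enum_in_Dbarlev (ltnW nm).
(* Passing to [ptilde] solves equation a for its own unknown g a. *)
have tE a : a \in Dbarlev D k n ->
    g a = ptilde (plev q k n) a j +
          \sum_(r in Dbarlev D k n) ptilde (plev q k n) a r * g r.
  move=> aS; have ja : j != a.
    by apply: contraTneq jD => ->; move: aS; rewrite !inE => /andP[].
  have qa : 1 - plev q k n a a != 0 by rewrite subr_eq0 eq_sym q1// ltnW.
  have := IH (ltnW nm) _ aS; rewrite (bigD1 a)//= => gaE.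
  rewrite (bigD1 a)//= ptilde_diag mul0r add0r ptilde_offdiag//.
  rewrite (eq_bigr (fun r => plev q k n a r * g r / (1 - plev q k n a a))).
    rewrite -mulr_suml -mulrDl; apply: (mulIf qa); rewrite mulfVK//.
    by rewrite mulrBr mulr1 {1}gaE [g a * _]mulrC; ring.
  by move=> r /andP[_ ra]; rewrite ptilde_offdiag// mulrAC.
rewrite DbarlevS => /finset.setD1P[ic iS].
rewrite {1}(tE _ iS) (finset.big_setD1 _ cS)/= (tE _ cS) (finset.big_setD1 _ cS)/=.
rewrite ptilde_diag mul0r add0r /pstep mulrDr -!addrA; congr +%R.
rewrite mulr_sumr; congr +%R; rewrite -big_split; apply: eq_bigr => r _ /=.
by rewrite mulrDl addrC mulrA.
Qed.

(** At the last level k m is the only state outside D that is left, so one scalar equation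
    remains. *)
Lemma elimination q (g : 'I_M -> R) j : j \in D -> (0 < m)%N ->
  (forall n i, (n < m)%N -> i \in Dbarlev D k n -> plev q k n i i != 1) ->
  (forall i, i \notin D -> g i = q i j + \sum_(r in ~: D) q i r * g r) ->
  g (k m) = ptlev q k m.-1 (k m) j.
Proof.
move=> jD m0 q1 gE; have mm : (m.-1 < m)%N by rewrite prednK.
have kS : k m \in Dbarlev D k m.-1 by rewrite -{1}(prednK m0) enum_in_Dbarlev.
have := elimination_lev jD q1 gE mm kS.
rewrite (big_pred1 (k m)); last first.
  move=> i /=; apply/idP/eqP => [iD|->//]; exact: Dbarlev_last.
have ja : j != k m by apply: contraTneq jD => ->; rewrite enum_notin// m0 leqnn.
move=> ge; rewrite /ptlev ptilde_offdiag//.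
have qa : 1 - plev q k m.-1 (k m) (k m) != 0 by rewrite subr_eq0 eq_sym q1.
by apply: (mulIf qa); rewrite mulfVK// mulrBr mulr1 {1}ge mulrC addrK.
Qed.

End Enumeration.
End Elimination.

(** * Functions with decreasing difference quotient at 0 *)

Section Decay.
Context {R : realType}.
Implicit Types (f g : R -> R) (m p q s t : R).

(* The properties of the Laplace transform of a proper distribution function
   with mean m that survive all the operations of the elimination. *)
Definition decay f m : Prop :=
  [/\ f 0 = 1,
      forall s, 0 <= s -> 0 <= f s <= 1,
      forall s t, 0 <= s -> s <= t -> f t <= f s,
      forall s t, 0 < s -> s <= t -> (1 - f t) / t <= (1 - f s) / s &
      (1 - f s) / s @[s --> 0^'+] --> m].

Lemma decay_ratio_le f m s : decay f m -> 0 < s -> (1 - f s) / s <= m.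
Proof.
move=> [f0 f01 fn fr fm] s0.
apply: (cvgr_to_ge fm) => //; near=> t; apply: fr.
- by near: t; exact: nbhs_right_gt.
- by near: t; exact: nbhs_right_le.
Unshelve. all: by end_near. Qed.

Lemma decay_bound f m s : decay f m -> 0 <= s -> 1 - f s <= m * s.
Proof.
move=> df; rewrite le_eqVlt => /predU1P[<-|s0].
  by have [-> _ _ _ _] := df; rewrite subrr mulr0.
by rewrite -ler_pdivrMr//; exact: decay_ratio_le.
Qed.

Lemma decay_mean_ge0 f m : decay f m -> 0 <= m.
Proof.
move=> df; have [_ f01 _ _ _] := df; apply: le_trans (decay_ratio_le df ltr01).
by rewrite divr1 subr_ge0; have /andP[] := f01 _ ler01.
Qed.

(** Monotonicity of the quotient gives 1 - f t <= t (1 - f s) / s, hence f s - f t <= (t - s) (1 - f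
    s) / s. Convexity of f does not enter. *)
Lemma decay_lip f m s t : decay f m -> 0 <= s -> s <= t ->
  f s - f t <= m * (t - s).
Proof.
move=> df; rewrite le_eqVlt => /predU1P[<-|s0] st.
  by have [-> _ _ _ _] := df; rewrite subr0 decay_bound.
have [_ f01 fn fr fm] := df.
have t0 : 0 < t by exact: lt_le_trans st.
have := fr _ _ s0 st; rewrite ler_pdivrMr// => h1.
have h2 : (1 - f s) / s * (t - s) <= m * (t - s).
  by rewrite ler_wpM2r ?subr_ge0// decay_ratio_le.
apply: le_trans h2; rewrite mulrBr divfK ?gt_eqF//.
by rewrite lerBrDr; apply: le_trans h1; lra.
Qed.

Lemma decay_dist f m s t : decay f m -> 0 <= s -> 0 <= t ->
  `|f s - f t| <= m * `|s - t|.
Proof.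
move=> df s0 t0; have [_ _ fn _ _] := df.
wlog st : s t s0 t0 / s <= t.
  by move=> H; case: (leP s t) => [|/ltW] ?; [exact: H|rewrite distrC (distrC s) H].
rewrite (distrC s) [X in _ * X]ger0_norm ?subr_ge0// ger0_norm ?subr_ge0 ?fn//.
exact: decay_lip.
Qed.

Lemma decay_cvg1 f m : decay f m -> f s @[s --> 0^'+] --> (1 : R).
Proof.
move=> df; have [_ f01 _ _ _] := df.
have m0 := decay_mean_ge0 df; have m1 : 0 < m + 1 by rewrite ltr_wpDl.
apply/cvgrPdist_le => e e0; near=> s.
have s0 : 0 < s by near: s; exact: nbhs_right_gt.
have /andP[_ fs1] := f01 _ (ltW s0).
rewrite ger0_norm ?subr_ge0//; apply: (le_trans (decay_bound df (ltW s0))).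
(* The mean m may be 0, so m + 1 is used as divisor. *)
apply: (@le_trans _ _ ((m + 1) * s)); first by rewrite ler_wpM2r ?(ltW s0)// lerDl.
rewrite mulrC -ler_pdivlMr//; near: s; apply: nbhs_right_le.
by rewrite divr_gt0.
Unshelve. all: by end_near. Qed.

Lemma scale_at_right0 (a : R) : 0 < a -> a * s @[s --> 0^'+] --> 0^'+.
Proof.
move=> a0 P [e /= e0 H]; exists (e / a) => /=; first by rewrite divr_gt0.
move=> s /= + s0; rewrite sub0r normrN gtr0_norm// ltr_pdivlMr// => sa.
apply: H => /=; last by rewrite mulr_gt0.
by rewrite sub0r normrN gtr0_norm ?mulr_gt0// mulrC.
Qed.

(** The factor a = 0 is included because a limit ratio of time scales may vanish; the result is then
    the constant 1 with mean 0. *)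
Lemma decay_scale f m (a : R) : 0 <= a -> decay f m ->
  decay (fun s => f (a * s)) (a * m).
Proof.
rewrite le_eqVlt => /predU1P[<-|a0] df; have [f0 f01 fn fr fm] := df.
  split => [|s _|s t _ _|s t _ _|]; rewrite ?mul0r ?f0 ?ler01 ?lexx ?subrr ?mul0r//.
  by under eq_fun do rewrite mul0r f0 subrr mul0r; exact: cvg_cst.
have aE s : (1 - f (a * s)) / s = a * ((1 - f (a * s)) / (a * s)).
  have [->|s0] := eqVneq s 0; first by rewrite mulr0 !invr0 !mulr0.
  by have /lt0r_neq0 an := a0; field; rewrite s0 an.
split; rewrite ?mulr0//.
- by move=> s s0; apply: f01; rewrite mulr_ge0// ltW.
- by move=> s t s0 st; apply: fn; rewrite ?mulr_ge0 ?(ltW a0)// ler_pM2l.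
- by move=> s t s0 st; rewrite !aE ler_pM2l// fr ?mulr_gt0// ler_pM2l.
under eq_fun do rewrite aE; apply: cvgM; first exact: cvg_cst.
apply: (@cvg_comp _ _ _ (fun s => a * s) (fun s => (1 - f s) / s) _ 0^'+ _ _ fm).
exact: scale_at_right0.
Qed.

Lemma decay_mul f g m1 m2 : decay f m1 -> decay g m2 ->
  decay (fun s => f s * g s) (m1 + m2).
Proof.
move=> df dg; have [f0 f01 fn fr fm] := df; have [g0 g01 gn gr gm] := dg.
(* Both summands are built from nonnegative nonincreasing factors, which yields the monotonicity of
   the quotient; at 0 they tend to m1 and m2. *)
have E s : (1 - f s * g s) / s = (1 - f s) / s + f s * ((1 - g s) / s) by ring.
split; rewrite ?f0 ?g0 ?mulr1//.
- move=> s s0; have /andP[h1 h2] := f01 _ s0; have /andP[h3 h4] := g01 _ s0.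
  by rewrite mulr_ge0//= mulr_ile1.
- move=> s t s0 st; have t0 := le_trans s0 st.
  have /andP[h1 h2] := f01 _ t0; have /andP[h3 h4] := g01 _ t0.
  by rewrite ler_pM ?fn ?gn.
- move=> s t s0 st; rewrite !E lerD ?fr//.
  have t0 := lt_le_trans s0 st.
  have /andP[h1 h2] := f01 _ (ltW t0); have /andP[h3 h4] := g01 _ (ltW t0).
  by rewrite ler_pM ?fn ?gr ?divr_ge0 ?subr_ge0 ?(ltW s0) ?(ltW t0).
under eq_fun do rewrite E; apply: cvgD => //; rewrite -[X in _ --> X]mul1r.
by apply: cvgM => //; exact: decay_cvg1 df.
Qed.

Lemma decay_mix f g m1 m2 q : 0 <= q <= 1 -> decay f m1 -> decay g m2 ->
  decay (fun s => q * f s + (1 - q) * g s) (q * m1 + (1 - q) * m2).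
Proof.
move=> /andP[q0 q1] df dg; have [f0 f01 fn fr fm] := df.
have [g0 g01 gn gr gm] := dg; have q1' : 0 <= 1 - q by rewrite subr_ge0.
have E s : (1 - (q * f s + (1 - q) * g s)) / s =
  q * ((1 - f s) / s) + (1 - q) * ((1 - g s) / s) by ring.
split.
- by rewrite f0 g0; ring.
- move=> s s0; have /andP[h1 h2] := f01 _ s0; have /andP[h3 h4] := g01 _ s0.
  by apply/andP; split; nra.
- by move=> s t s0 st; rewrite lerD// ler_wpM2l ?fn ?gn.
- by move=> s t s0 st; rewrite !E lerD// ler_wpM2l ?fr ?gr.
under eq_fun do rewrite E; apply: cvgD; apply: cvgM => //; exact: cvg_cst.
Qed.

(** For transforms f and g, the quotient (1 - p) f / (1 - p g) belongs to a geometric number of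
    loops with law g followed by one step with law f. The mean number of loops is p / (1 - p), which
    the scale factor 1 - p compensates. *)
Lemma decay_geom f g m1 m2 p : 0 <= p < 1 -> decay f m1 -> decay g m2 ->
  decay (fun s => (1 - p) * f ((1 - p) * s) / (1 - p * g ((1 - p) * s)))
    ((1 - p) * m1 + p * m2).
Proof.
move=> /andP[p0 p1] df dg; have p1' : 0 < 1 - p by rewrite subr_gt0.
suff : decay (fun s => (1 - p) * f s / (1 - p * g s)) (m1 + p * m2 / (1 - p)).
  move=> /(decay_scale (ltW p1')); rewrite mulrDr [(1 - p) * (_ / _)]mulrC.
  by rewrite divfK// gt_eqF.
have [f0 f01 fn fr fm] := df; have [g0 g01 gn gr gm] := dg.
have den s : 0 <= s -> 1 - p <= 1 - p * g s.
  by move=> /g01/andP[h1 h2]; nra.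
have den0 s : 0 <= s -> 0 < 1 - p * g s.
  by move=> s0; exact: lt_le_trans (den _ s0).
(* The difference quotient becomes a product of two nonnegative nonincreasing factors. *)
have E s : 0 <= s -> (1 - (1 - p) * f s / (1 - p * g s)) / s =
    (p * ((1 - g s) / s) + (1 - p) * ((1 - f s) / s)) / (1 - p * g s).
  move=> s0; have d := den0 _ s0.
  have -> : 1 - (1 - p) * f s / (1 - p * g s) =
     (1 - p * g s - (1 - p) * f s) / (1 - p * g s).
    by rewrite [RHS]mulrBl divff ?gt_eqF.
  by rewrite mulrAC; congr (_ / _); ring.
split.
- by rewrite f0 g0 !mulr1 divff// gt_eqF.
- move=> s s0; have d := den0 _ s0; have := den _ s0.
  have /andP[h1 h2] := f01 _ s0 => dd.
  rewrite divr_ge0 ?mulr_ge0 ?(ltW p1') ?(ltW d)//= ler_pdivrMr// mul1r.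
  by apply: le_trans dd; rewrite -[leRHS]mulr1 ler_pM2l.
- move=> s t s0 st; have t0 := le_trans s0 st.
  have /andP[h1 h2] := f01 _ t0; have /andP[h3 h4] := g01 _ t0.
  apply: ler_pM; rewrite ?mulr_ge0 ?invr_ge0 ?(ltW p1') ?(ltW (den0 _ t0))//.
    by rewrite ler_pM2l// fn.
  by rewrite lef_pV2 ?posrE ?den0// lerD2l lerN2 ler_wpM2l// gn.
- move=> s t s0 st; have t0 := lt_le_trans s0 st.
  have /andP[h1 h2] := f01 _ (ltW t0); have /andP[h3 h4] := g01 _ (ltW t0).
  rewrite !E ?(ltW s0) ?(ltW t0)//; apply: ler_pM.
  + by rewrite addr_ge0// mulr_ge0 ?(ltW p1')// divr_ge0 ?subr_ge0 ?(ltW t0).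
  + by rewrite invr_ge0 ltW// den0// ltW.
  + by rewrite lerD// ler_wpM2l ?fr ?gr ?(ltW p1').
  + rewrite lef_pV2 ?posrE ?den0 ?(ltW s0) ?(ltW t0)//.
    by rewrite lerD2l lerN2 ler_wpM2l// gn// ltW.
have : (p * ((1 - g s) / s) + (1 - p) * ((1 - f s) / s)) / (1 - p * g s)
    @[s --> 0^'+] --> (p * m2 + (1 - p) * m1) / (1 - p * 1).
  apply: cvgM.
    by apply: cvgD; apply: cvgM => //; exact: cvg_cst.
  apply: cvgV; first by rewrite mulr1 gt_eqF.
  apply: cvgB; first exact: cvg_cst.
  by apply: cvgM; [exact: cvg_cst|exact: decay_cvg1 dg].
have -> : (p * m2 + (1 - p) * m1) / (1 - p * 1) = m1 + p * m2 / (1 - p).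
  by rewrite mulr1 mulrDl addrC [(1 - p) * m1]mulrC mulfK// gt_eqF.
apply: cvg_trans; apply: near_eq_cvg; near=> s; rewrite -E//.
Unshelve. all: by end_near. Qed.

Lemma decay_inv m : 0 <= m -> decay (fun s => (1 + m * s)^-1) m.
Proof.
move=> m0.
have d0 s : 0 <= s -> 0 < 1 + m * s.
  by move=> s0; rewrite ltr_pwDl// mulr_ge0.
have E s : 0 < s -> (1 - (1 + m * s)^-1) / s = m / (1 + m * s).
  move=> s0; have d := d0 _ (ltW s0); have /lt0r_neq0 sn := s0.
  by have /lt0r_neq0 dn := d; field; rewrite sn dn.
split.
- by rewrite mulr0 addr0 invr1.
- move=> s s0; rewrite invr_ge0 ltW ?d0//= invf_le1 ?d0//.
  by rewrite lerDl mulr_ge0.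
- move=> s t s0 st; have t0 := le_trans s0 st.
  by rewrite lef_pV2 ?posrE ?d0// lerD2l ler_wpM2l.
- move=> s t s0 st; have t0 := lt_le_trans s0 st.
  rewrite !E// ler_wpM2l// lef_pV2 ?posrE ?d0 ?(ltW s0) ?(ltW t0)//.
  by rewrite lerD2l ler_wpM2l.
have : m / (1 + m * s) @[s --> 0^'+] --> m / (1 + m * 0).
  apply: cvgM; first exact: cvg_cst.
  apply: cvgV; first by rewrite mulr0 addr0 oner_neq0.
  apply: cvgD; first exact: cvg_cst.
  apply: cvgM; first exact: cvg_cst.
  exact: cvg_at_right_filter.
rewrite mulr0 addr0 divr1.
apply: cvg_trans; apply: near_eq_cvg; near=> s; rewrite -E//.
Unshelve. all: by end_near. Qed.

End Decay.

(** * Convergence of families in the class [decay] *)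

Section DecayConvergence.
Context {R : realType}.
Implicit Types (f g : R -> R -> R) (m p q : R -> R).

Lemma near0_itv01 : \forall e \near (0 : R)^'+, 0 < e <= 1.
Proof.
near=> e; apply/andP; split; near: e; first exact: nbhs_right_gt.
exact: nbhs_right_le.
Unshelve. all: by end_near. Qed.

Lemma cvg_eq_itv01 (h1 h2 : R -> R) (l : R) :
  (forall e, 0 < e <= 1 -> h1 e = h2 e) ->
  h2 e @[e --> 0^'+] --> l -> h1 e @[e --> 0^'+] --> l.
Proof.
move=> E; apply: cvg_trans; apply: near_eq_cvg.
by near do apply/esym/E; exact: near0_itv01.
Unshelve. all: by end_near. Qed.

(* The equi-Lipschitz bound provided by the convergent means is what allows
   arguments that move with e. *)
Definition decay_cvg f m (f0 : R -> R) (m0 : R) : Prop :=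
  [/\ forall e, 0 < e <= 1 -> decay (f e) (m e),
      forall s, 0 <= s -> f e s @[e --> 0^'+] --> f0 s,
      m e @[e --> 0^'+] --> m0 &
      decay f0 m0].

Lemma decay_eq (f1 f2 : R -> R) (m : R) : (forall s, 0 <= s -> f1 s = f2 s) ->
  decay f1 m -> decay f2 m.
Proof.
move=> E [f0 f01 fn fr fm]; split.
- by rewrite -E.
- by move=> s s0; rewrite -E// f01.
- by move=> s t s0 st; rewrite -!E// ?fn// (le_trans s0).
- by move=> s t s0 st; rewrite -!E ?fr ?(ltW s0)// ltW// (lt_le_trans s0).
apply: cvg_trans fm; apply: near_eq_cvg; near=> s.
by rewrite E.
Unshelve. all: by end_near. Qed.

Lemma decay_cvg_eq f1 f2 m1 m2 (g1 g2 : R -> R) n1 n2 :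
  (forall e s, 0 < e <= 1 -> 0 <= s -> f1 e s = f2 e s) ->
  (forall e, 0 < e <= 1 -> m1 e = m2 e) ->
  (forall s, 0 <= s -> g1 s = g2 s) -> n1 = n2 ->
  decay_cvg f1 m1 g1 n1 -> decay_cvg f2 m2 g2 n2.
Proof.
move=> E1 E2 E3 <- [d c1 c2 d0]; split.
- move=> e e01; rewrite -E2//; apply: decay_eq (d _ e01) => s; exact: E1.
- move=> s s0; rewrite -E3//; apply: cvg_eq_itv01 (c1 _ s0) => e e01.
  by rewrite E1.
- by apply: cvg_eq_itv01 c2 => e e01; rewrite E2.
- exact: decay_eq d0.
Qed.

Lemma cvg_moving f m (f0 : R -> R) (m0 : R) (t : R -> R) (t0 : R) :
  decay_cvg f m f0 m0 -> (forall e, 0 < e <= 1 -> 0 <= t e) -> 0 <= t0 ->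
  t e @[e --> 0^'+] --> t0 -> f e (t e) @[e --> 0^'+] --> f0 t0.
Proof.
move=> [d c1 c2 d0] te t00 tt.
have -> : (fun e => f e (t e)) = (fun e => f e t0 + (f e (t e) - f e t0)).
  by apply/funext => e; rewrite addrC subrK.
rewrite -[X in _ --> X]addr0; apply: cvgD; first exact: c1.
apply/cvgr0Pnorm_le.
have h : m e * `|t e - t0| @[e --> 0^'+] --> (0 : R).
  rewrite -[X in _ --> X](mulr0 m0); apply: cvgM => //.
  have : `|t e - t0| @[e --> 0^'+] --> `|t0 - t0|.
    by apply: cvg_norm; exact: (cvgB tt (cvg_cst _)).
  by rewrite subrr normr0.
move=> eps eps0; near=> e.
apply: (@le_trans _ _ (m e * `|t e - t0|)).
  apply: decay_dist => //; first by apply: d; near: e; exact: near0_itv01.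
  by apply: te; near: e; exact: near0_itv01.
near: e; exact: (cvgr_le _ h).
Unshelve. all: by end_near. Qed.

Lemma decay_cvg_scale f m (f0 : R -> R) (m0 : R) (a : R -> R) (a0 : R) :
  (forall e, 0 < e <= 1 -> 0 <= a e) -> 0 <= a0 ->
  a e @[e --> 0^'+] --> a0 -> decay_cvg f m f0 m0 ->
  decay_cvg (fun e s => f e (a e * s)) (fun e => a e * m e)
    (fun s => f0 (a0 * s)) (a0 * m0).
Proof.
move=> ae a00 ca dc; have [d c1 c2 d0] := dc; split.
- by move=> e e01; apply: decay_scale; [exact: ae|exact: d].
- move=> s s0; apply: (cvg_moving (t := fun e => a e * s) dc).
  + by move=> e e01; rewrite mulr_ge0// ae.
  + by rewrite mulr_ge0.
  + by apply: cvgM => //; exact: cvg_cst.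
- exact: cvgM.
- exact: decay_scale.
Qed.

Lemma decay_cvg_mul f g m1 m2 (f0 g0 : R -> R) (n1 n2 : R) :
  decay_cvg f m1 f0 n1 -> decay_cvg g m2 g0 n2 ->
  decay_cvg (fun e s => f e s * g e s) (fun e => m1 e + m2 e)
    (fun s => f0 s * g0 s) (n1 + n2).
Proof.
move=> [d c1 c2 d0] [d' c1' c2' d0']; split.
- by move=> e e01; apply: decay_mul; [exact: d|exact: d'].
- by move=> s s0; apply: cvgM; [exact: c1|exact: c1'].
- exact: cvgD.
- exact: decay_mul.
Qed.

Lemma decay_cvg_mix f g m1 m2 (f0 g0 : R -> R) (n1 n2 : R) q (q0 : R) :
  (forall e, 0 < e <= 1 -> 0 <= q e <= 1) -> 0 <= q0 <= 1 ->
  q e @[e --> 0^'+] --> q0 ->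
  decay_cvg f m1 f0 n1 -> decay_cvg g m2 g0 n2 ->
  decay_cvg (fun e s => q e * f e s + (1 - q e) * g e s)
    (fun e => q e * m1 e + (1 - q e) * m2 e)
    (fun s => q0 * f0 s + (1 - q0) * g0 s) (q0 * n1 + (1 - q0) * n2).
Proof.
move=> qe q01 cq [d c1 c2 d0] [d' c1' c2' d0'].
have cq' : 1 - q e @[e --> 0^'+] --> 1 - q0 by apply: cvgB => //; exact: cvg_cst.
split.
- by move=> e e01; apply: decay_mix; [exact: qe|exact: d|exact: d'].
- by move=> s s0; apply: cvgD; apply: cvgM => //; [exact: c1|exact: c1'].
- by apply: cvgD; exact: cvgM.
- exact: decay_mix.
Qed.

(** From above the quotient at u e * s is bounded by m e, which tends to m0. From below, fix U at
    which the quotient of f0 is close to m0; once u e * s <= U, monotonicity bounds the quotient by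
    its value at U, where the argument no longer moves. *)
Lemma cvg_moving_ratio f m (f0 : R -> R) (m0 : R) (u : R -> R) (s : R) :
  decay_cvg f m f0 m0 -> (forall e, 0 < e <= 1 -> 0 < u e) ->
  u e @[e --> 0^'+] --> (0 : R) -> 0 <= s ->
  (1 - f e (u e * s)) / u e @[e --> 0^'+] --> m0 * s.
Proof.
move=> dc ue cu; have [d c1 c2 d0] := dc; rewrite le_eqVlt => /predU1P[<-|s0].
  rewrite mulr0; apply: (@cvg_eq_itv01 _ (fun=> 0)); last exact: cvg_cst.
  by move=> e /d[+ _ _ _ _]; rewrite mulr0 => ->; rewrite subrr mul0r.
suff h : (1 - f e (u e * s)) / (u e * s) @[e --> 0^'+] --> m0.
  apply: (@cvg_eq_itv01 _ (fun e => (1 - f e (u e * s)) / (u e * s) * s)).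
    by move=> e e01; rewrite invfM mulrA divfK// gt_eqF.
  by apply: cvgM => //; exact: cvg_cst.
apply/cvgrPdist_le => eps eps0; have [_ _ _ _ rm] := d0.
have e2 : 0 < eps / 2 by rewrite divr_gt0.
have [U [U0 hU]] : exists U, 0 < U /\ m0 - eps / 2 <= (1 - f0 U) / U.
  have : \forall U \near 0^'+, 0 < U /\ m0 - eps / 2 <= (1 - f0 U) / U.
    near=> U; split; first by near: U; exact: nbhs_right_gt.
    near: U; apply: (cvgr_ge _ rm); lra.
  by move=> /filter_ex[U ?]; exists U.
have hc : (1 - f e U) / U @[e --> 0^'+] --> (1 - f0 U) / U.
  apply: cvgM; last exact: cvg_cst.
  by apply: cvgB; [exact: cvg_cst|apply: c1; exact: ltW].
near=> e.
have e01 : 0 < e <= 1 by near: e; exact: near0_itv01.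
have ue0 := ue _ e01; have us0 : 0 < u e * s by rewrite mulr_gt0.
have [_ _ _ rn _] := d _ e01.
have h1 := decay_ratio_le (d _ e01) us0.
have h2 : m e <= m0 + eps.
  near: e; apply: (cvgr_le _ c2); lra.
have h3 : u e * s <= U.
  rewrite -ler_pdivlMr//; near: e.
  by apply: (cvgr_le _ cu); rewrite divr_gt0.
have h4 := rn _ _ us0 h3.
have h5 : m0 - eps <= (1 - f e U) / U.
  by near: e; apply: (cvgr_ge _ hc); apply: lt_le_trans hU; lra.
rewrite ler_norml; apply/andP; split; lra.
Unshelve. all: by end_near. Qed.

Lemma decay_cvg_geom f g m1 m2 (f0 g0 : R -> R) (n1 n2 : R) p (p0 : R) :
  (forall e, 0 < e <= 1 -> 0 <= p e < 1) -> p e @[e --> 0^'+] --> p0 ->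
  decay_cvg f m1 f0 n1 -> decay_cvg g m2 g0 n2 ->
  decay_cvg
    (fun e s => (1 - p e) * f e ((1 - p e) * s) /
                (1 - p e * g e ((1 - p e) * s)))
    (fun e => (1 - p e) * m1 e + p e * m2 e)
    (fun s => if p0 == 1 then (1 + n2 * s)^-1
              else (1 - p0) * f0 ((1 - p0) * s) / (1 - p0 * g0 ((1 - p0) * s)))
    ((1 - p0) * n1 + p0 * n2).
Proof.
move=> pe cp df dg; have [d c1 c2 d0] := df; have [d' c1' c2' d0'] := dg.
have p00 : 0 <= p0.
  apply: (cvgr_to_ge cp); near=> e.
  by have /andP[] : 0 <= p e < 1 by apply: pe; near: e; exact: near0_itv01.
have p01 : p0 <= 1.
  apply: (cvgr_to_le cp); near=> e.
  by have /andP[_ /ltW] : 0 <= p e < 1 by apply: pe; near: e; exact: near0_itv01.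
have cp' : 1 - p e @[e --> 0^'+] --> 1 - p0 by apply: cvgB => //; exact: cvg_cst.
have pe' e : 0 < e <= 1 -> 0 < 1 - p e by move=> /pe/andP[_]; rewrite subr_gt0.
have pe'' e : 0 < e <= 1 -> 0 <= 1 - p e by move=> /pe' /ltW.
have p0' : 0 <= 1 - p0 by rewrite subr_ge0.
have [_ sf _ _] := decay_cvg_scale pe'' p0' cp' df.
have [_ sg _ _] := decay_cvg_scale pe'' p0' cp' dg.
split.
- by move=> e e01; apply: decay_geom; [exact: pe|exact: d|exact: d'].
- move=> s s0; case: eqP => [p1|/eqP p1]; last first.
    have p1' : 0 < 1 - p0 by rewrite subr_gt0 lt_neqAle p1.
    apply: cvgM; first by apply: cvgM => //; exact: sf.
    apply: cvgV; last first.
      by apply: cvgB; [exact: cvg_cst|apply: cvgM => //; exact: sg].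
    have [_ g01 _ _ _] := d0'.
    have /andP[h1 h2] := g01 ((1 - p0) * s) (mulr_ge0 p0' s0).
    by rewrite gt_eqF//; nra.
  apply: (@cvg_eq_itv01 _ (fun e => f e ((1 - p e) * s) /
      (g e ((1 - p e) * s) + (1 - g e ((1 - p e) * s)) / (1 - p e)))).
    move=> e e01; have := pe' _ e01 => /lt0r_neq0 pn.
    have [_ g01 _ _ _] := d' _ e01.
    have /andP[h1 h2] := g01 ((1 - p e) * s) (mulr_ge0 (pe'' _ e01) s0).
    have hh : 0 < 1 - p e * g e ((1 - p e) * s).
      by have := pe _ e01; have := pe' _ e01 => + /andP[]; nra.
    set x := f e _; set y := g e _; have /lt0r_neq0 hn : 0 < 1 - p e * y by [].
    have -> : y + (1 - y) / (1 - p e) = (1 - p e * y) / (1 - p e) by field.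
    by rewrite invfM invrK; ring.
  have := sf _ s0; have := sg _ s0; rewrite p1 subrr mul0r.
  have [-> _ _ _ _] := d0; have [-> _ _ _ _] := d0' => sg1 sf1.
  rewrite -[X in _ --> X]mul1r; apply: cvgM => //.
  have m20 := decay_mean_ge0 d0'.
  apply: cvgV; first by rewrite gt_eqF// ltr_pwDl// mulr_ge0.
  apply: cvgD => //; apply: (cvg_moving_ratio dg) => //.
  by move: cp'; rewrite p1 subrr.
- by apply: cvgD; apply: cvgM.
- case: eqP => [p1|/eqP p1].
    rewrite p1 subrr mul0r add0r mul1r.
    exact/decay_inv/(decay_mean_ge0 d0').
  by apply: decay_geom => //; rewrite p00 lt_neqAle p1.
Unshelve. all: by end_near. Qed.

End DecayConvergence.

(** * Laplace transforms of distribution functions *)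

Section LaplaceByParts.
Context {R : realType}.
Local Notation mu := (@lebesgue_measure R).

Lemma continuous_expRM (s : R) : continuous (fun u : R => expR (- (s * u))).
Proof.
move=> u; apply: continuous_comp; last exact: continuous_expR.
by apply: cvgN; apply: cvgM; [exact: cvg_cst|exact: cvg_id].
Qed.

Lemma measurable_expRM d (T : measurableType d) (X : T -> R) (s : R) :
  measurable_fun setT X -> measurable_fun setT (fun w => expR (- (s * X w))).
Proof.
move=> mX; apply: (measurableT_comp (f := fun u : R => expR (- (s * u)))) => //.
by apply: continuous_measurable_fun; exact: continuous_expRM.
Qed.

(** Representing exp(-s x) as an integral over u >= x is what turns a Laplace transform into an
    integral of a distribution function. *)
Lemma integral_exp_tail (s x : R) : 0 < s ->
  (\int[mu]_(u in `[x, +oo[) (s * expR (- (s * u)))%:E = (expR (- (s * x)))%:E)%E.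
Proof.
move=> s0.
have dF (u : R) : is_derive u 1 (fun u => - expR (- (s * u))) (s * expR (- (s * u))).
  by apply: is_derive_eq; rewrite /GRing.scale/= mulr1 mulrN opprK mulrC.
rewrite (@ge0_continuous_FTC2y R _ (fun u => - expR (- (s * u))) x 0).
- by rewrite sub0e -EFinN opprK.
- by move=> u _; rewrite mulr_ge0 ?expR_ge0 ?ltW.
- apply: continuous_subspaceT => u.
  by apply: cvgM; [exact: cvg_cst|exact: continuous_expRM].
- rewrite -[X in _ --> X]oppr0; apply: cvgN.
  have /= := @cvg_comp _ _ _ (fun u : R => s * u) (fun u => expR (- u)) _ _ _ _ (@cvgr_expR R).
  by apply; apply: gt0_cvgMry => //; exact: cvg_id.
- by move=> u _; exact: (@ex_derive _ _ _ _ _ _ _ (dF u)).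
- by apply: cvg_at_right_filter; apply: cvgN; exact: continuous_expRM.
- by move=> u _; rewrite derive1E; exact: (@derive_val _ _ _ _ _ _ _ (dF u)).
Qed.

Section Tonelli.
Context d (T : measurableType d) (P : {sigma_finite_measure set T -> \bar R}).
Variables (A : set T) (f X : T -> R).
Hypotheses (mA : measurable A) (mf : measurable_fun setT f).
Hypotheses (f0 : forall w, 0 <= f w) (mX : measurable_fun setT X).

Lemma measurable_le_set (u : R) : measurable [set w | X w <= u].
Proof.
rewrite -[X in measurable X]setTI.
have -> : [set w | X w <= u] = X @^-1` `]-oo, u].
  by apply/seteqP; split => w; rewrite /= in_itv.
exact: mX.
Qed.

(** Integration by parts in the form of Tonelli's theorem on the region X w <= u. The weight f is
    there to carry exponential factors of earlier sojourn times in [latebox_integral]. *)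
Lemma tonelli_laplace (s : R) : 0 < s ->
  (\int[P]_(w in A) (f w * expR (- (s * X w)))%:E =
   \int[mu]_u ((s * expR (- (s * u)))%:E *
                 \int[P]_(w in A `&` [set w | (X w <= u)%R]) (f w)%:E))%E.
Proof.
move=> s0.
pose B := [set z : T * measurableTypeR R | X z.1 <= z.2].
have mB : measurable B.
  have mg : measurable_fun setT (fun z : T * measurableTypeR R => (z.2 : R) - X z.1).
    apply: measurable_funB; first exact: measurable_snd.
    exact: (measurableT_comp mX (@measurable_fst _ _ _ _)).
  have := mg measurableT `[0, +oo[%classic (measurable_itv _).
  rewrite setTI; congr (measurable _); apply/seteqP; split => z /=;
    by rewrite in_itv/= andbT subr_ge0.
pose h (z : T * measurableTypeR R) : \bar R :=
  ((s * expR (- (s * (z.2 : R)))) * (\1_A z.1 * f z.1 * \1_B z))%:E.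
have mh : measurable_fun setT h.
  apply/measurable_EFinP; apply: measurable_funM.
    apply: measurable_funM => //.
    exact: (measurable_expRM (X := fun z : T * measurableTypeR R => z.2 : R) s (@measurable_snd _ _ _ _)).
  apply: measurable_funM; last exact: measurable_indic.
  apply: measurable_funM; last exact: (measurableT_comp mf (@measurable_fst _ _ _ _)).
  apply: (measurableT_comp _ (@measurable_fst _ _ _ _)).
  exact: measurable_indic.
have h0 z : (0 <= h z)%E.
  by rewrite lee_fin !mulr_ge0 ?expR_ge0 ?(ltW s0).
have := @fubini_tonelli _ _ _ _ _ P mu h mh h0.
have -> : (\int[P]_x \int[mu]_y h (x, y) =
    \int[P]_(w in A) (f w * expR (- (s * X w)))%:E)%E.
  rewrite [RHS]integral_mkcond; apply: eq_integral => w _ /=.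
  rewrite patchE /h /=; have [wA|wA] := boolP (w \in A); last first.
    rewrite indicE (negbTE wA); apply: integral0_eq => u _.
    by rewrite !mul0r mulr0.
  rewrite indicE wA.
  rewrite EFinM -(integral_exp_tail (X w) s0) -ge0_integralZl_EFin//; last 2 first.
  - by move=> u _; rewrite lee_fin mulr_ge0 ?expR_ge0 ?(ltW s0).
  - apply/measurable_EFinP/measurable_funM => //.
    exact/measurable_funTS/measurable_expRM.
  rewrite [RHS]integral_mkcond; apply: eq_integral => u _; rewrite patchE.
  have -> : (u \in `[X w, +oo[%classic) = (X w <= u).
    by apply/idP/idP; rewrite inE /= in_itv/= andbT.
  rewrite indicE; have -> : ((w, u) \in B) = (X w <= u).
    by apply/idP/idP; rewrite inE.
  case: ifP => _; last by rewrite !mulr0.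
  by rewrite mul1r mulr1 -EFinM mulrC.
move=> ->; apply: eq_integral => u _ /=.
rewrite [in RHS]integral_mkcond -ge0_integralZl_EFin//; last 3 first.
- by move=> w _; rewrite patchE; case: ifP => // _; rewrite lee_fin.
- apply/(measurable_restrictT _ _).1 => //.
    by apply: measurableI => //; exact: measurable_le_set.
  exact/measurable_funTS/measurable_EFinP.
- by rewrite mulr_ge0 ?expR_ge0 ?(ltW s0).
apply: eq_integral => w _; rewrite /h /= patchE !indicE.
have -> : ((w, u) \in B) = (X w <= u) by apply/idP/idP; rewrite inE.
have -> : (w \in A `&` [set w | X w <= u]) = (w \in A) && (X w <= u).
  by rewrite in_setI; congr andb; apply/idP/idP; rewrite inE.
case: (w \in A) => /=; case: (X w <= u) => /=;
  by rewrite ?mul0r ?mulr0 ?mul1r ?mulr1 ?mule0// EFinM.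
Qed.

Lemma cvg_integral_le_set :
  (\int[P]_(w in A `&` [set w | (X w <= n%:R)%R]) (f w)%:E @[n --> \oo] -->
   \int[P]_(w in A) (f w)%:E)%E.
Proof.
have AE : A = \bigcup_n (A `&` [set w | X w <= n%:R]).
  rewrite -setI_bigcupr -[LHS]setIT; congr (_ `&` _); apply/esym; rewrite -subTset => w _ /=.
  by exists (Num.truncn (X w)).+1 => //=; rewrite ltW// truncnS_gt.
rewrite [X in _ --> X](_ : _ =
    \int[P]_(w in \bigcup_n (A `&` [set w | (X w <= n%:R)%R])) (f w)%:E)%E; last first.
  by rewrite -AE.
apply: ge0_nondecreasing_set_cvg_integral.
- move=> m n mn; apply/subsetPset => w [Aw /= Xw]; split => //=.
  by rewrite (le_trans Xw)// ler_nat.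
- by move=> n; apply: measurableI => //; exact: measurable_le_set.
- by move=> n; exact/measurable_funTS/measurable_EFinP.
- by move=> n w _; rewrite lee_fin.
Qed.

End Tonelli.

(** For s > 0 both sides are the same integral over u by [tonelli_laplace]; for s = 0 they are
    limits of the same sequence of truncated integrals. *)
Lemma laplace_transfer d1 (T1 : measurableType d1) d2 (T2 : measurableType d2)
    (P1 : {sigma_finite_measure set T1 -> \bar R})
    (P2 : {sigma_finite_measure set T2 -> \bar R})
    (A1 : set T1) (f1 X1 : T1 -> R) (A2 : set T2) (f2 X2 : T2 -> R) :
  measurable A1 -> measurable_fun setT f1 -> (forall w, 0 <= f1 w) ->
  measurable_fun setT X1 ->
  measurable A2 -> measurable_fun setT f2 -> (forall w, 0 <= f2 w) ->
  measurable_fun setT X2 ->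
  (forall u, \int[P1]_(w in A1 `&` [set w | (X1 w <= u)%R]) (f1 w)%:E =
             \int[P2]_(w in A2 `&` [set w | (X2 w <= u)%R]) (f2 w)%:E)%E ->
  forall s, 0 <= s -> (\int[P1]_(w in A1) (f1 w * expR (- (s * X1 w)))%:E =
                       \int[P2]_(w in A2) (f2 w * expR (- (s * X2 w)))%:E)%E.
Proof.
move=> mA1 mf1 f10 mX1 mA2 mf2 f20 mX2 E s; rewrite le_eqVlt => /predU1P[<-|s0].
  under eq_integral do rewrite mul0r oppr0 expR0 mulr1.
  under [RHS]eq_integral do rewrite mul0r oppr0 expR0 mulr1.
  have h1 := cvg_integral_le_set (P := P1) mA1 mf1 f10 mX1.
  have h2 := cvg_integral_le_set (P := P2) mA2 mf2 f20 mX2.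
  apply: (cvg_unique _ h1); first exact: ereal_hausdorff.
  by apply: cvg_trans h2; apply: near_eq_cvg; near=> n; rewrite E.
rewrite !tonelli_laplace//; apply: eq_integral => u _; congr (_ * _)%E.
exact: E.
Unshelve. all: by end_near. Qed.

Definition subdf (F : R -> R) : Prop :=
  [/\ is_cumulative F, forall t, t < 0 -> F t = 0 & forall t, F t <= 1].

Lemma subdf_ge0 (F : R -> R) t : subdf F -> 0 <= F t.
Proof.
move=> [[nd _] F0 _]; have [t0|t0] := ltP t 0; first by rewrite F0.
by rewrite -(F0 (-1)) ?ltrN10//; apply: nd; rewrite (le_trans _ t0)// lerN10.
Qed.

Local Notation ls h := (lebesgue_stieltjes_measure (cumulative_pack h)).

Lemma ls_oc (F : R -> R) (h : is_cumulative F) (a b : R) : a <= b ->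
  ls h `]a, b]%classic = (F b - F a)%:E.
Proof.
move=> ab; rewrite /lebesgue_stieltjes_measure /measure_extension.
rewrite measurable_mu_extE; last exact: is_ocitv.
exact: wlength_itv_bnd.
Qed.

(** The Stieltjes measure is computed on intervals ]a, b], whereas the atom at 0 has to be counted.
    So F u is read off from ]-1, u], and the part left of 0, a union of intervals on which F
    vanishes, is shown to be null. *)
Lemma ls_lt0 (F : R -> R) (h : is_cumulative F) : (forall t, t < 0 -> F t = 0) ->
  ls h `]-1, 0[%classic = 0%E.
Proof.
move=> F0.
have -> : `]-1, 0[%classic = \bigcup_n `]-1, (- n.+1%:R^-1)]%classic :> set R.
  apply/seteqP; split => x /=.
    rewrite in_itv/= => /andP[x1 x0].
    exists (Num.truncn (- x)^-1) => //=; rewrite in_itv/= x1/=.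
    rewrite lerNr -[leRHS]invrK lef_pV2 ?posrE ?invr_gt0 ?oppr_gt0//.
    by rewrite ltW// truncnS_gt.
  move=> [n _] /=; rewrite !in_itv/= => /andP[-> xn]/=.
  by rewrite (le_lt_trans xn)// oppr_lt0 invr_gt0.
apply/negligibleP; first by apply: bigcup_measurable => n _; exact: measurable_itv.
apply: negligible_bigcup => n; apply/negligibleP; first exact: measurable_itv.
have n1 : (n.+1%:R^-1 : R) <= 1 by rewrite invf_le1// ler1n.
rewrite [LHS]ls_oc; last by rewrite lerN2.
by rewrite !F0 ?subrr ?ltrN10// oppr_lt0 invr_gt0.
Qed.

Lemma ls_le_set (F : R -> R) (h : is_cumulative F) (u : R) : (forall t, t < 0 -> F t = 0) ->
  ls h (`[0, +oo[%classic `&` [set x | x <= u]) = (F u)%:E.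
Proof.
move=> F0; have [u0|u0] := ltP u 0.
  rewrite (_ : _ `&` _ = set0) ?measure0 ?F0// -subset0 => x [/=].
  rewrite in_itv/= andbT => x0 xu.
  by have := le_lt_trans (le_trans x0 xu) u0; rewrite ltxx.
have u1 : -1 <= u by rewrite (le_trans _ u0)// lerN10.
have m2 : measurable (`[0, +oo[%classic `&` [set x : R | x <= u]).
  apply: measurableI; first exact: measurable_itv.
  rewrite (_ : [set _ | _] = `]-oo, u]%classic); first exact: measurable_itv.
  by apply/seteqP; split => x; rewrite /= in_itv.
have E : `]-1, u]%classic =
    `]-1, 0[%classic `|` (`[0, +oo[%classic `&` [set x | x <= u]) :> set R.
  apply/seteqP; split => x /=; rewrite !in_itv/= ?andbT.
    move=> /andP[x1 xu]; have [x0|x0] := ltP x 0; first by left; rewrite x1.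
    by right.
  move=> [/andP[-> /ltW x0]|[x0 ->]]; first by rewrite (le_trans x0).
  by rewrite andbT (lt_le_trans _ x0)// ltrN10.
have := ls_oc h u1; rewrite E measureU; [|exact: measurable_itv|exact: m2|]; last first.
  rewrite -subset0 => x [/=]; rewrite !in_itv/= andbT => /andP[_ x0] [x0' _].
  by have := lt_le_trans x0 x0'; rewrite ltxx.
move=> /esym; rewrite [F (-1)]F0 ?ltrN10// subr0 => ->.
by rewrite [X in (X + _)%E](ls_lt0 h F0) add0e.
Qed.

Lemma stieltjes_intE (F : R -> R) (h : is_cumulative F) g :
  stieltjes_int F g = (\int[ls h]_(t in `[0%R, +oo[) (g t)%:E)%E.
Proof.
rewrite /stieltjes_int; case: pselect => [h'|//].
by rewrite (Prop_irrelevance h' h).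
Qed.

Lemma ls_integral1 (F : R -> R) (h : is_cumulative F) (u : R) : (forall t, t < 0 -> F t = 0) ->
  (\int[ls h]_(w in `[0%R, +oo[%classic `&` [set w | (w <= u)%R]) 1%:E = (F u)%:E)%E.
Proof.
move=> F0; rewrite integral_cst//; first by rewrite mul1e; exact: ls_le_set.
apply: measurableI; first exact: measurable_itv.
exact: (@measurable_le_set _ (measurableTypeR R) id (@measurable_id _ _ _)).
Qed.

(** Moves the transform of F to any space on which F is the weighted distribution function of a
    variable X. *)
Lemma stieltjes_laplace_repr (F : R -> R) d (T : measurableType d)
    (P : {sigma_finite_measure set T -> \bar R}) (A : set T) (f X : T -> R) :
  is_cumulative F -> (forall t, t < 0 -> F t = 0) ->
  measurable A -> measurable_fun setT f -> (forall w, 0 <= f w) ->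
  measurable_fun setT X ->
  (forall u, \int[P]_(w in A `&` [set w | (X w <= u)%R]) (f w)%:E = (F u)%:E)%E ->
  forall s, 0 <= s -> (stieltjes_int F (fun t => expR (- (s * t))) =
    \int[P]_(w in A) (f w * expR (- (s * X w)))%:E)%E.
Proof.
move=> h F0 mA mf f0 mX E s s0; rewrite (stieltjes_intE h).
have := @laplace_transfer _ (measurableTypeR R) _ T (ls h) P `[0, +oo[%classic
  (fun=> 1) id A f X (measurable_itv _) (measurable_cst _) (fun=> ler01)
  (@measurable_id _ _ _) mA mf f0 mX.
move=> <- //; first by apply: eq_integral => t _; rewrite mul1r.
by move=> u; rewrite E; exact: ls_integral1.
Qed.

Lemma stieltjes_laplace_parts (F : R -> R) (s : R) :
  is_cumulative F -> (forall t, t < 0 -> F t = 0) -> 0 < s ->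
  (stieltjes_int F (fun t => expR (- (s * t))) =
   \int[mu]_u (s * expR (- (s * u)) * F u)%:E)%E.
Proof.
move=> h F0 s0; rewrite (stieltjes_intE h).
have := @tonelli_laplace _ (measurableTypeR R) (ls h) `[0, +oo[%classic
  (fun=> 1) id (measurable_itv _) (measurable_cst _) (fun=> ler01)
  (@measurable_id _ _ _) _ s0.
under eq_integral do rewrite mul1r; move=> ->.
apply: eq_integral => u _; rewrite [RHS]EFinM; congr (_ * _)%E.
exact: ls_integral1.
Qed.

End LaplaceByParts.

(** * Distribution functions and transforms of a variable on an event *)

Section DistributionOfVariable.
Context {R : realType} d (T : measurableType d) (P : probability T R).
Variables (A : set T) (X : T -> R) (c : R).
Hypotheses (mA : measurable A) (mX : measurable_fun setT X) (c0 : 0 <= c).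

Let E (t : R) : set T := A `&` [set w | X w <= t].
Let G (t : R) : R := fine (P (E t)).

Let mE t : measurable (E t).
Proof. by apply: measurableI => //; exact: measurable_le_set. Qed.

Let fE t : P (E t) \is a fin_num.
Proof. exact: fin_num_measure. Qed.

Let ndG : nondecreasing G.
Proof.
move=> t u tu; rewrite /G fine_le//; apply: le_measure; rewrite ?inE//.
by move=> w [Aw /= Xw]; split => //=; exact: le_trans Xw tu.
Qed.

Let rcG : right_continuous G.
Proof.
move=> a; apply/cvgrPdist_le => eps eps0.
(* Continuity from above along a + 1/(n+1); monotonicity then covers all x slightly above a. *)
have h : P (E (a + n.+1%:R^-1)) @[n --> \oo] --> P (E a).
  have -> : E a = \bigcap_n E (a + n.+1%:R^-1).
    apply/seteqP; split => [w [Aw /= Xw] n _|w H].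
      by split => //=; rewrite (le_trans Xw)// lerDl invr_ge0.
    split; first by have [] := H 0%N I.
    rewrite /= leNgt; apply/negP => aX.
    have [_ /=] := H (Num.truncn (X w - a)^-1) I.
    rewrite leNgt => /negP; apply; rewrite -ltrBrDl.
    rewrite -[ltRHS]invrK ltf_pV2 ?posrE ?invr_gt0 ?subr_gt0//.
    exact: truncnS_gt.
  apply: nonincreasing_cvg_mu => //.
  - by rewrite -ge0_fin_numE// fin_num_measure.
  - exact: bigcap_measurable.
  - move=> m n mn; apply/subsetPset => w [Aw /= Xw]; split => //=.
    by rewrite (le_trans Xw)// lerD2l lef_pV2 ?posrE// ler_nat.
have {}h : G (a + n.+1%:R^-1) @[n --> \oo] --> G a.
  by apply: fine_cvg; rewrite fineK.
have [n hn] : exists n, G (a + n.+1%:R^-1) <= G a + eps.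
  have : \forall n \near \oo, G (a + n.+1%:R^-1) <= G a + eps.
    by apply: (cvgr_le _ h); rewrite ltrDl.
  by move=> /filter_ex[n ?]; exists n.
near=> x.
have ax : a <= x by near: x; exact: nbhs_right_ge.
have xa : x <= a + n.+1%:R^-1.
  by near: x; apply: nbhs_right_le; rewrite ltrDl invr_gt0.
have h1 := ndG ax; have h2 := ndG xa.
by rewrite ler_norml; apply/andP; split; lra.
Unshelve. all: by end_near. Qed.

Lemma variable_cumulative : is_cumulative (fun t => c * fine (P (E t))).
Proof.
split; first by move=> t u tu; rewrite ler_wpM2l//; exact: ndG.
by move=> a; apply: cvgM; [exact: cvg_cst|exact: rcG].
Qed.

Lemma variable_subdf : (forall w, A w -> 0 <= X w) -> c * fine (P A) <= 1 ->
  subdf (fun t => c * fine (P (E t))).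
Proof.
move=> X0 c1; split; first exact: variable_cumulative.
  move=> t t0; rewrite (_ : E t = set0) ?measure0 ?mulr0//.
  rewrite -subset0 => w [Aw /= Xw].
  by have := le_lt_trans (le_trans (X0 _ Aw) Xw) t0; rewrite ltxx.
move=> t; apply: le_trans c1; rewrite ler_wpM2l// fine_le ?fin_num_measure//.
by apply: le_measure; rewrite ?inE// => w [].
Qed.

Lemma variable_stieltjes_laplace (s : R) : 0 <= s -> (forall w, A w -> 0 <= X w) ->
  (stieltjes_int (fun t => c * fine (P (E t)))%R (fun t => expR (- (s * t)))%R =
  c%:E * \int[P]_(w in A) (expR (- (s * X w)))%:E)%E.
Proof.
move=> s0 X0; have mc := variable_cumulative.
rewrite (stieltjes_laplace_repr (P := P) (A := A) (f := fun=> c) (X := X) mc)//.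
- under eq_integral do rewrite EFinM.
  rewrite ge0_integralZl_EFin//.
  apply/measurable_funTS/measurable_EFinP; exact: measurable_expRM.
- move=> t t0; rewrite (_ : E t = set0) ?measure0 ?mulr0//.
  rewrite -subset0 => w [Aw /= Xw].
  by have := le_lt_trans (le_trans (X0 _ Aw) Xw) t0; rewrite ltxx.
- by move=> u; rewrite (integral_cst P (mE u)) EFinM fineK.
Qed.

Lemma variable_laplace_fin (s : R) : 0 <= s -> (forall w, A w -> 0 <= X w) ->
  (\int[P]_(w in A) (expR (- (s * X w)))%:E)%E \is a fin_num.
Proof.
move=> s0 X0; rewrite ge0_fin_numE; last by apply: integral_ge0 => w _; rewrite lee_fin expR_ge0.
apply: (@le_lt_trans _ _ (\int[P]_(w in A) (cst 1%:E) w)%E).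
  apply: ge0_le_integral => //.
  - apply/measurable_funTS/measurable_EFinP; exact: measurable_expRM.
  - by move=> w Aw; rewrite lee_fin -expR0 ler_expR oppr_le0 mulr_ge0// X0.
by rewrite integral_cst// mul1e -ge0_fin_numE// fin_num_measure.
Qed.

Lemma variable_laplace (s : R) : 0 <= s -> (forall w, A w -> 0 <= X w) ->
  laplace (fun t => c * fine (P (E t))) s =
  c * fine (\int[P]_(w in A) (expR (- (s * X w)))%:E)%E.
Proof.
move=> s0 X0; rewrite /laplace variable_stieltjes_laplace// fineM//.
exact: variable_laplace_fin.
Qed.

End DistributionOfVariable.

Section LaplaceOfDf.
Context {R : realType}.
Implicit Types F : R -> R.
Local Notation ls h := (lebesgue_stieltjes_measure (cumulative_pack h)).
Local Notation half_line := (`[0%R, +oo[%classic : set (measurableTypeR R)).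

Lemma measurable_half_line : measurable half_line.
Proof. exact: measurable_itv. Qed.

Lemma subdf_cvg F : subdf F -> F t @[t --> +oo] --> total_mass F.
Proof.
move=> [[nd _] _ F1]; apply/cvg_ex; eexists; apply: nondecreasing_cvgr => //.
by exists 1 => _ [t _ <-].
Qed.

Lemma subdf_mass_le1 F : subdf F -> total_mass F <= 1.
Proof.
move=> sF; apply: (cvgr_to_le (subdf_cvg sF)).
by apply: nearW => t; have [_ _] := sF.
Qed.

Lemma subdf_le_mass F t : subdf F -> F t <= total_mass F.
Proof.
move=> sF; apply: (cvgr_to_ge (subdf_cvg sF)); near=> u.
by have [[nd _] _ _] := sF; apply: nd; near: u; apply: nbhs_pinfty_ge; exact: num_real.
Unshelve. all: by end_near. Qed.

Lemma ls_half_line F (h : is_cumulative F) : subdf F ->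
  ls h half_line = (total_mass F)%:E.
Proof.
move=> sF; have [_ F0 _] := sF.
have := @cvg_integral_le_set _ _ (measurableTypeR R) (ls h) half_line (fun=> 1) id
  measurable_half_line (measurable_cst _) (fun=> ler01) (@measurable_id _ _ _).
rewrite [X in _ --> X -> _](_ : _ = ls h half_line); last first.
  by rewrite integral_cst ?mul1e//; exact: measurable_half_line.
move=> h1; apply: (cvg_unique _ h1); first exact: ereal_hausdorff.
have h2 : (F n%:R)%:E @[n --> \oo] --> (total_mass F)%:E.
  apply: cvg_EFin; first exact: nearW.
  move/cvg_pinftyP: (subdf_cvg sF); apply.
  exact/cvgryPge/nbhs_infty_ger.
apply: cvg_trans h2; apply: near_eq_cvg; near=> n.
by apply/esym; exact: ls_integral1.
Unshelve. all: by end_near. Qed.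

Lemma subdf_bounded_integrable F (h : is_cumulative F) (g : R -> R) (b : R) :
  subdf F -> measurable_fun setT g -> (forall x, 0 <= x -> `|g x| <= b) ->
  (ls h).-integrable half_line (EFin \o g).
Proof.
move=> sF mg gb; apply: measurable_bounded_integrable.
- exact: measurable_half_line.
- by rewrite [ltLHS](ls_half_line h sF) ltry.
- exact: measurable_funTS.
- exists b; split; first exact: num_real.
  move=> x bx y /=; rewrite in_itv/= andbT => y0.
  exact: le_trans (gb _ y0) (ltW bx).
Qed.

Lemma laplaceE F (h : is_cumulative F) s :
  laplace F s = \int[ls h]_(x in half_line) expR (- (s * x)).
Proof. by rewrite /laplace (stieltjes_intE h). Qed.

Lemma laplace_integrable F (h : is_cumulative F) s : subdf F -> 0 <= s ->
  (ls h).-integrable half_line (EFin \o (fun x => expR (- (s * x)))).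
Proof.
move=> sF s0; apply: (@subdf_bounded_integrable _ _ _ 1) => //.
  by apply: (@measurable_expRM _ _ _ id); exact: measurable_id.
move=> x x0; rewrite ger0_norm ?expR_ge0// -expR0 ler_expR oppr_le0.
by rewrite mulr_ge0.
Qed.

Lemma Rintegral_half_line_cst F (h : is_cumulative F) (b : R) : subdf F ->
  \int[ls h]_(x in half_line) b = b * total_mass F.
Proof.
move=> sF; rewrite Rintegral_cst; last exact: measurable_half_line.
by rewrite [X in fine X](ls_half_line h sF).
Qed.

Lemma laplace0 F : subdf F -> laplace F 0 = total_mass F.
Proof.
move=> sF; have [h _ _] := sF; rewrite (laplaceE h).
under eq_Rintegral do rewrite mul0r oppr0 expR0.
by rewrite Rintegral_half_line_cst// mul1r.
Qed.

Lemma Rintegral_le_set F (h : is_cumulative F) u : subdf F ->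
  \int[ls h]_(x in half_line) \1_[set x : R | x <= u] x = F u.
Proof.
move=> [_ F0 _]; rewrite /Rintegral integral_indic; last 2 first.
- exact: measurable_half_line.
- exact: (@measurable_le_set _ _ (measurableTypeR R) id (@measurable_id _ _ _)).
by rewrite setIC [X in fine X](ls_le_set h u F0).
Qed.

End LaplaceOfDf.

(** * Transforms of proper distributions with finite mean belong to [decay] *)

Section LaplaceDecay.
Context {R : realType}.
Implicit Types F : R -> R.
Local Notation ls h := (lebesgue_stieltjes_measure (cumulative_pack h)).
Local Notation half_line := (`[0%R, +oo[%classic : set (measurableTypeR R)).

Lemma proper_subdf F : proper_df F -> subdf F.
Proof.
move=> [h F0 F1]; split=> // t; have [nd _] := h.
apply: (cvgr_to_ge F1); near=> u.
by apply: nd; near: u; apply: nbhs_pinfty_ge; exact: num_real.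
Unshelve. all: by end_near. Qed.

Lemma proper_mass F : proper_df F -> total_mass F = 1.
Proof. by move=> [_ _ F1]; exact: cvg_lim. Qed.

Lemma laplace_ge0 F s : 0 <= laplace F s.
Proof.
rewrite /laplace /stieltjes_int; case: pselect => // h.
by apply/fine_ge0/integral_ge0 => x _; rewrite lee_fin expR_ge0.
Qed.

Lemma laplace_nonincreasing F s t : subdf F -> 0 <= s -> s <= t ->
  laplace F t <= laplace F s.
Proof.
move=> sF s0 st; have [h _ _] := sF; have t0 := le_trans s0 st.
rewrite !(laplaceE h); apply: le_Rintegral.
- exact: measurable_half_line.
- exact: laplace_integrable.
- exact: laplace_integrable.
move=> x /=; rewrite in_itv/= andbT => x0.
by rewrite ler_expR lerN2 ler_wpM2r.
Qed.

(** The convex function r |-> exp(-r x) lies above its tangent at s. Evaluating the tangent at 0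
    gives [h1], at t gives [h2]; after multiplication by t - s and s the two bounds add up to the
    claim. *)
Lemma exp_chord (s t x : R) : 0 < s -> s <= t -> 0 <= x ->
  (1 - expR (- (t * x))) / t <= (1 - expR (- (s * x))) / s.
Proof.
move=> s0 st x0; have t0 := lt_le_trans s0 st.
rewrite ler_pdivrMr// mulrAC ler_pdivlMr//.
set y := expR (- (s * x)); have y0 : 0 < y := expR_gt0 _.
have h1 : y * (1 + s * x) <= 1.
  rewrite -[leRHS]expR0 -(addNr (s * x)) expRD ler_pM2l//.
  exact: expR_ge1Dx.
have h2 : y * (1 + (s - t) * x) <= expR (- (t * x)).
  rewrite (_ : - (t * x) = - (s * x) + (s - t) * x); last by ring.
  by rewrite expRD ler_pM2l//; exact: expR_ge1Dx.
have h3 : 0 <= (t - s) * (1 - y * (1 + s * x)).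
  by rewrite mulr_ge0// subr_ge0.
have h4 : 0 <= s * (expR (- (t * x)) - y * (1 + (s - t) * x)).
  by rewrite mulr_ge0// ?(ltW s0)// subr_ge0.
nra.
Qed.

(** The upper bound is the dominating function, and both bounds together the pointwise limit, in the
    proof that the quotient tends to the mean. *)
Lemma exp_chord_bounds (s x : R) : 0 < s -> 0 <= x ->
  x - s * x ^+ 2 <= (1 - expR (- (s * x))) / s <= x.
Proof.
move=> s0 x0; rewrite ler_pdivlMr// ler_pdivrMr//.
have h1 := expR_ge1Dx (- (s * x)); apply/andP; split; last by nra.
have y0 : 0 <= s * x by rewrite mulr_ge0// ltW.
have h2 := expR_ge1Dx (s * x).
have h3 : expR (- (s * x)) * expR (s * x) = 1 by rewrite -expRD addNr expR0.
have h4 : 0 < expR (- (s * x)) := expR_gt0 _.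
have h5 : expR (- (s * x)) * (1 + s * x) <= 1 by rewrite -[leRHS]h3 ler_pM2l.
set y := s * x in y0 h1 h2 h5 *; set z := expR (- y) in h1 h4 h5 *.
rewrite (_ : (x - s * x ^+ 2) * s = y - y ^+ 2); last by rewrite /y; ring.
have h6 : 0 <= y * (z - 1 + y) by apply: mulr_ge0 => //; lra.
nra.
Qed.

Lemma one_sub_laplace F (h : is_cumulative F) s : proper_df F -> 0 < s ->
  (1 - laplace F s) / s =
  \int[ls h]_(x in half_line) ((1 - expR (- (s * x))) / s).
Proof.
move=> pF s0; have sF := proper_subdf pF.
have i1 : (ls h).-integrable half_line (EFin \o (fun=> 1)).
  by apply: (@subdf_bounded_integrable _ _ _ _ 1) => // x _; rewrite normr1.
have i2 := laplace_integrable h sF (ltW s0).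
under eq_Rintegral do rewrite mulrC.
rewrite RintegralZl; last 2 first.
- exact: measurable_half_line.
- apply: (@subdf_bounded_integrable _ _ _ _ 1) => //.
    apply: measurable_funB => //.
    by apply: (@measurable_expRM _ _ _ id); exact: measurable_id.
  move=> x x0; have e1 : expR (- (s * x)) <= 1.
    by rewrite -expR0 ler_expR oppr_le0 mulr_ge0// ltW.
  by rewrite ger0_norm ?subr_ge0// gerBl expR_ge0.
rewrite (RintegralB (@measurable_half_line R) i1 i2).
by rewrite Rintegral_half_line_cst// proper_mass// mulr1 -laplaceE mulrC.
Qed.

Lemma chord_integrable F (h : is_cumulative F) s : proper_df F -> 0 < s ->
  (ls h).-integrable half_line (EFin \o (fun x => (1 - expR (- (s * x))) / s)).
Proof.
move=> pF s0; apply: (@subdf_bounded_integrable _ _ _ _ s^-1).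
- exact: proper_subdf.
- apply: measurable_funM => //; apply: measurable_funB => //.
  by apply: (@measurable_expRM _ _ _ id); exact: measurable_id.
move=> x x0; have e1 : expR (- (s * x)) <= 1.
  by rewrite -expR0 ler_expR oppr_le0 mulr_ge0// ltW.
rewrite ger0_norm; last by rewrite divr_ge0 ?subr_ge0// ltW.
by rewrite ler_pdivrMr// mulVf ?gt_eqF// gerBl expR_ge0.
Qed.

(** The monotonicity properties hold for exp(-s x) at each x and are integrated. The limit of the
    quotient is dominated convergence along sequences with dominating function x, where finiteness
    of the mean enters. *)
Lemma laplace_decay F : proper_df F -> (expectation_df F < +oo)%E ->
  decay (laplace F) (fine (expectation_df F)).
Proof.
move=> pF eF; have sF := proper_subdf pF; have [h F0 F1] := pF.
have l0 : laplace F 0 = 1 by rewrite laplace0// proper_mass.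
split => //.
- move=> s s0; rewrite laplace_ge0/= -l0.
  exact: laplace_nonincreasing.
- by move=> s t s0 st; exact: laplace_nonincreasing.
- move=> s t s0 st; have t0 := lt_le_trans s0 st.
  rewrite !(one_sub_laplace h)//; apply: le_Rintegral.
  + exact: measurable_half_line.
  + exact: chord_integrable.
  + exact: chord_integrable.
  + by move=> x /=; rewrite in_itv/= andbT => x0; exact: exp_chord.
apply/cvg_at_rightP => u [u0 cu].
have eE : expectation_df F = (\int[ls h]_(x in half_line) x%:E)%E.
  by rewrite /expectation_df (stieltjes_intE h).
have ii : (ls h).-integrable half_line EFin.
  apply/integrableP; split.
    exact/measurable_funTS/measurable_EFinP/measurable_id.
  rewrite (_ : integral _ _ _ = expectation_df F)//.
  rewrite eE; apply: eq_integral => x; rewrite inE/= in_itv/= andbT => x0.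
  by rewrite /= ger0_norm.
have h1 : forall n, (1 - laplace F (u n)) / u n =
    fine (\int[ls h]_(x in half_line) ((1 - expR (- (u n * x))) / u n)%:E)%E.
  by move=> n; rewrite (one_sub_laplace h).
under eq_fun do rewrite h1.
apply: fine_cvg; rewrite fineK; last first.
  by rewrite eE; apply: integrable_fin_num => //; exact: measurable_half_line.
rewrite eE.
have [] := @dominated_convergence _ (measurableTypeR R) R (ls h) half_line
  measurable_half_line (fun n x => ((1 - expR (- (u n * x))) / u n)%:E)
  (fun x => x%:E) (fun x => x%:E) => //.
- move=> n; apply/measurable_funTS/measurable_EFinP/measurable_funM => //.
  apply: measurable_funB => //.
  by apply: (@measurable_expRM _ _ _ id); exact: measurable_id.
- exact/measurable_funTS/measurable_EFinP/measurable_id.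
- apply: aeW => x /=; rewrite in_itv/= andbT => x0.
  apply: cvg_EFin; first exact: nearW.
  apply: (@squeeze_cvgr _ _ _ _ (fun n => x - u n * x ^+ 2) (fun=> x)).
  + by near=> n; exact: exp_chord_bounds.
  + rewrite -[X in _ --> X]subr0; apply: cvgB; first exact: cvg_cst.
    rewrite -[X in _ --> X](mul0r (x ^+ 2)); apply: cvgM => //; exact: cvg_cst.
  + exact: cvg_cst.
- apply: aeW => x n /=; rewrite in_itv/= andbT => x0.
  have /andP[_ h2] := exp_chord_bounds (u0 n) x0.
  rewrite ger0_norm ?lee_fin// divr_ge0 ?(ltW (u0 n))// subr_ge0.
  by rewrite -expR0 ler_expR oppr_le0 mulr_ge0// ltW.
Unshelve. all: by end_near. Qed.

End LaplaceDecay.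

(** * The continuity theorem for Laplace transforms *)

Section LaplaceSandwich.
Context {R : realType}.
Implicit Types F : R -> R.
Local Notation ls h := (lebesgue_stieltjes_measure (cumulative_pack h)).
Local Notation half_line := (`[0%R, +oo[%classic : set (measurableTypeR R)).

(** A list of pairs (coefficient, exponent) is evaluated both at exponentials and at transforms, so
    that a single list can be compared across different distributions. *)
Definition lincomb (l : seq (R * R)) (psi : R -> R) : R :=
  \sum_(z <- l) z.1 * psi z.2.

Local Notation expcomb l x := (lincomb l (fun s => expR (- (s * x)))).

Lemma lincomb_laplace F (h : is_cumulative F) (l : seq (R * R)) : subdf F ->
  (forall z, z \in l -> 0 <= z.2) ->
  (ls h).-integrable half_line (EFin \o (fun x => expcomb l x)) /\
  lincomb l (laplace F) = \int[ls h]_(x in half_line) expcomb l x.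
Proof.
move=> sF; elim: l => [|z l IH] l0.
  split.
    apply: (@subdf_bounded_integrable _ _ _ _ 0) => //.
      rewrite (_ : (fun x => expcomb [::] x) = (fun=> 0))//.
      by apply/funext => x; rewrite /lincomb big_nil.
    by move=> x _; rewrite /lincomb big_nil normr0.
  rewrite {1}/lincomb big_nil; under eq_Rintegral do rewrite /lincomb big_nil.
  by rewrite Rintegral_half_line_cst// mul0r.
have [|i1 e1] := IH; first by move=> y yl; apply: l0; rewrite in_cons yl orbT.
have z0 : 0 <= z.2 by apply: l0; rewrite mem_head.
have i2 := laplace_integrable h sF z0.
have i3 : (ls h).-integrable half_line (EFin \o (fun x => z.1 * expR (- (z.2 * x)))).
  exact: (integrableZl (@measurable_half_line R) z.1 i2).
have E : (fun x => expcomb (z :: l) x) =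
    (fun x => z.1 * expR (- (z.2 * x)) + expcomb l x).
  by apply/funext => x; rewrite /lincomb big_cons.
rewrite E; split.
  exact: (integrableD (@measurable_half_line R) i3 i1).
rewrite (RintegralD (@measurable_half_line R) i3 i1) -e1.
rewrite (RintegralZl _ (@measurable_half_line R) i2) -laplaceE.
by rewrite {1}/lincomb big_cons.
Qed.

Lemma bernoulli_ge (z : R) N : 0 <= z <= 1 -> 1 - N%:R * z <= (1 - z) ^+ N.
Proof.
move=> /andP[z0 z1]; elim: N => [|N IH]; first by rewrite mul0r subr0 expr0.
rewrite exprS -natr1; have N0 : 0 <= N%:R * z ^+ 2 :> R.
  by rewrite mulr_ge0// exprn_ge0.
apply: (@le_trans _ _ ((1 - z) * (1 - N%:R * z))); first by nra.
by rewrite ler_wpM2l// subr_ge0.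
Qed.

(** The induction rests on (1 - z) (1 + (N+1) z) = 1 + N z - (N+1) z^2. The product form avoids a
    division. *)
Lemma bernoulli_le (z : R) N : 0 <= z <= 1 ->
  (1 - z) ^+ N * (1 + N%:R * z) <= 1.
Proof.
move=> /andP[z0 z1]; elim: N => [|N IH]; first by rewrite mul0r addr0 expr0 mulr1.
apply: le_trans IH; rewrite exprSr -mulrA ler_wpM2l ?exprn_ge0 ?subr_ge0//.
have N0 : 0 <= N%:R * z ^+ 2 :> R by rewrite mulr_ge0// exprn_ge0.
by rewrite -natr1; nra.
Qed.

Lemma exp_step_expand (a : R) n N : 0 <= a -> exists l : seq (R * R),
  (forall z, z \in l -> 0 <= z.2) /\
  forall x, expcomb l x = 1 - (1 - expR (- (a * x)) ^+ n) ^+ N.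
Proof.
(* The pair (1, 0) is the constant 1; the others are the terms of the binomial expansion, with
   exponents a n i. *)
move=> a0; exists ((1, 0) ::
  [seq (- ((-1) ^+ i *+ 'C(N, i)), a * (n * i)%:R) | i <- iota 0 N.+1]); split.
  move=> z; rewrite in_cons => /predU1P[->//|/mapP[i _ ->]] /=.
  by rewrite mulr_ge0.
move=> x; rewrite /lincomb big_cons big_map -[iota 0 N.+1]/(index_iota 0 N.+1).
rewrite big_mkord /= mul0r oppr0 expR0 mulr1; congr (_ + _).
rewrite exprBn -sumrN.
apply: eq_bigr => i _ /=; rewrite expr1n mulr1 mulNr; congr (- _).
rewrite -exprM -expRM_natl [LHS]mulrnAl; congr (_ *+ _); congr (_ * expR _).
by rewrite mulrN mulrA [(n * i)%:R * a]mulrC.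
Qed.

(* With exp(-a t0) = 1/2 for t < t0 < t + d, the function
   1 - (1 - exp(-a n x))^(2^n) tends to 1 on [0, t] and to 0 beyond t + d,
   uniformly, by Bernoulli's inequality. *)
Lemma exp_step (t d eta : R) : 0 <= t -> 0 < d -> 0 < eta ->
  exists l : seq (R * R),
  [/\ forall z, z \in l -> 0 <= z.2,
      forall x, 0 <= x -> 0 <= expcomb l x <= 1,
      forall x, 0 <= x -> x <= t -> 1 - eta <= expcomb l x &
      forall x, t + d <= x -> expcomb l x <= eta].
Proof.
move=> t0 d0 eta0.
pose c := t + d / 2; have c0 : 0 < c by rewrite /c; lra.
have ln20 : 0 < ln 2 :> R by rewrite ln_gt0// ltr1n.
pose a := ln 2 / c; have a0 : 0 < a by rewrite divr_gt0.
have ac : expR (- (a * c)) = 2^-1.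
  by rewrite /a divfK ?gt_eqF// expRN lnK// posrE.
(* Since 2^n exp(-a n x) = (2 exp(-a x))^n, this quantity is at least r^n on [0, t] and at most r'^n
   beyond t + d; the choice of c gives r > 1 > r'. *)
pose r := 2 * expR (- (a * t)); pose r' := 2 * expR (- (a * (t + d))).
have r1 : 1 < r.
  rewrite /r -ltr_pdivrMl// mulr1 -ac ltr_expR ltrN2 ltr_pM2l// /c.
  lra.
have r1' : r' < 1.
  rewrite /r' -ltr_pdivlMl// mulr1 -ac ltr_expR ltrN2 ltr_pM2l// /c.
  lra.
have r0' : 0 < r' by rewrite mulr_gt0// expR_gt0.
have rV : 0 < r^-1 < 1 by rewrite invr_gt0 (lt_trans ltr01)//= invf_lt1// (lt_trans ltr01).
have [n [hn hn']] : exists n, r^-1 ^+ n <= eta /\ r' ^+ n <= eta.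
  have c1 : r^-1 ^+ n @[n --> \oo] --> (0 : R).
    by apply: cvg_expr; have /andP[? ?] := rV; rewrite gtr0_norm.
  have c2 : r' ^+ n @[n --> \oo] --> (0 : R).
    by apply: cvg_expr; rewrite gtr0_norm.
  have : \forall n \near \oo, r^-1 ^+ n <= eta /\ r' ^+ n <= eta.
    near=> n; split; near: n; [exact: (cvgr_le _ c1)|exact: (cvgr_le _ c2)].
  by move=> /filter_ex[n ?]; exists n.
have [l [l0 lE]] := exp_step_expand n (2 ^ n) (ltW a0).
have z01 x : 0 <= x -> 0 <= expR (- (a * x)) ^+ n <= 1.
  move=> x0; rewrite exprn_ge0 ?expR_ge0//= exprn_ile1 ?expR_ge0//.
  by rewrite -expR0 ler_expR oppr_le0 mulr_ge0// ltW.
have Nz x : (2 ^ n)%:R * expR (- (a * x)) ^+ n = (2 * expR (- (a * x))) ^+ n.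
  by rewrite exprMn natrX.
exists l; split => //.
- move=> x x0; have /andP[h1 h2] := z01 _ x0; rewrite lE subr_ge0 gerBl.
  by rewrite exprn_ile1 ?exprn_ge0 ?subr_ge0// gerBl.
- move=> x x0 xt; rewrite lE lerD2l lerN2; apply: le_trans hn.
  have := bernoulli_le (2 ^ n) (z01 _ x0); rewrite Nz => hb.
  have rx : r ^+ n <= (2 * expR (- (a * x))) ^+ n.
    rewrite lerXn2r ?nnegrE ?mulr_ge0 ?expR_ge0// ler_pM2l//.
    by rewrite ler_expR lerN2 ler_pM2l.
  have rn : 0 < r ^+ n by rewrite exprn_gt0// (lt_trans ltr01).
  rewrite exprVn -[leRHS]mul1r ler_pdivlMr//; apply: le_trans hb.
  rewrite ler_wpM2l//; last by rewrite (le_trans rx)// lerDr.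
  by have /andP[_ ?] := z01 _ x0; rewrite exprn_ge0// subr_ge0.
- move=> x tx; have x0 : 0 <= x by lra.
  rewrite lE lerBlDr -lerBlDl; apply: le_trans (bernoulli_ge (2 ^ n) (z01 _ x0)).
  rewrite lerD2l lerN2 Nz; apply: le_trans hn'.
  rewrite lerXn2r ?nnegrE ?mulr_ge0 ?expR_ge0// ler_pM2l//.
  by rewrite ler_expR lerN2 ler_pM2l.
Unshelve. all: by end_near. Qed.

(** The list depends on t, d and eta but not on F. This uniformity allows one list to be used for a
    whole family and its limit. *)
Lemma laplace_sandwich (t d eta : R) : 0 <= t -> 0 < d -> 0 < eta ->
  exists l : seq (R * R), (forall z, z \in l -> 0 <= z.2) /\
  forall F, subdf F ->
    F t - eta <= lincomb l (laplace F) <= F (t + d) + eta.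
Proof.
move=> t0 d0 eta0; have [l [l0 l01 lt lg]] := exp_step t0 d0 eta0.
exists l; split => // F sF; have [h F0 F1] := sF.
have [il ->] := lincomb_laplace h sF l0.
have mi u : measurable_fun [set: measurableTypeR R] (\1_[set x : R | x <= u] : R -> R).
  apply: measurable_indic.
  exact: (@measurable_le_set _ _ (measurableTypeR R) id (@measurable_id _ _ _)).
have ii u : (ls h).-integrable half_line (EFin \o (\1_[set x : R | x <= u] : R -> R)).
  apply: (@subdf_bounded_integrable _ _ _ _ 1) => //; first exact: mi.
  by move=> x _; rewrite indicE; case: (_ \in _); rewrite ?normr1 ?normr0.
have mH := @measurable_half_line R.
have ic b : (ls h).-integrable half_line (EFin \o (fun=> b : R)).
  by apply: (@subdf_bounded_integrable _ _ _ _ `|b|).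
have cm u : 0 <= F u <= 1 by rewrite subdf_ge0//= F1.
apply/andP; split.
  have /andP[Ft0 Ft1] := cm t.
  (* The combination dominates (1 - eta) times the indicator of [0, t]; F t <= 1 makes the relative
     loss an absolute one. *)
  apply: (@le_trans _ _ (F t - eta * F t)); first by nra.
  rewrite -[X in X - _]mul1r -mulrBl -(Rintegral_le_set h t sF).
  rewrite -(RintegralZl (1 - eta) mH (ii t)); apply: le_Rintegral => //.
    exact: (integrableZl mH (1 - eta) (ii t)).
  move=> x /=; rewrite in_itv/= andbT => x0; rewrite indicE.
  have [xt|xt] := boolP (x \in _).
    by rewrite mulr1; apply: lt => //; move: xt; rewrite inE.
  by rewrite mulr0; have /andP[] := l01 _ x0.
apply: (@le_trans _ _ (F (t + d) + eta * total_mass F)); last first.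
  by rewrite lerD2l -[leRHS]mulr1 ler_pM2l// subdf_mass_le1.
rewrite -(Rintegral_le_set h (t + d) sF) -(Rintegral_half_line_cst h eta sF).
rewrite -(RintegralD mH (ii (t + d)) (ic eta)); apply: le_Rintegral => //.
  exact: (integrableD mH (ii (t + d)) (ic eta)).
move=> x /=; rewrite in_itv/= andbT => x0; rewrite indicE.
have [xt|xt] := boolP (x \in _).
  by apply: ler_wpDr; [exact: ltW|have /andP[] := l01 _ x0].
rewrite add0r; apply: lg; apply: ltW; rewrite ltNge; apply/negP => h'.
by move/negP: xt; apply; rewrite inE.
Qed.

End LaplaceSandwich.

(** * Weak convergence and pointwise convergence of transforms *)

Section ContinuityTheorem.
Context {R : realType}.
Local Notation mu := (@lebesgue_measure R).
Local Notation ls h := (lebesgue_stieltjes_measure (cumulative_pack h)).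
Local Notation half_line := (`[0%R, +oo[%classic : set (measurableTypeR R)).

(** Countability of the jumps of a monotone function is applied on each bounded interval ]-n, n[. *)
Lemma cumulative_discontinuity_countable (G : R -> R) : is_cumulative G ->
  countable [set t | ~ {for t, continuous G}].
Proof.
move=> [nd rc].
suff H : [set t | ~ {for t, continuous G}] `<=`
    \bigcup_n [set x | x \in (`](- n%:R), n%:R[) /\ discontinuity G x].
  apply: (sub_countable (subset_card_le H)).
  apply: bigcup_countable; first exact: countableP.
  move=> n _; apply: discontinuity_countable => x y _ _; exact: nd.
move=> t /= nc.
exists (Num.truncn `|t|).+1 => //=; split.
  by rewrite in_itv/= -ltr_norml; exact: truncnS_gt.
have cl : cvg (G x @[x --> t^'-]).
  apply: nondecreasing_at_left_is_cvgr.
    by near=> x; move=> a aI b bI; exact: nd.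
  near=> x; exists (G t) => _ [y /= + <-]; rewrite in_itv/= => /andP[_ yt].
  by apply: nd; exact: ltW.
have cr : cvg (G x @[x --> t^'+]) by apply/cvg_ex; exists (G t); exact: rc.
split => //; apply/eqP => E; apply: nc.
apply/left_right_continuousP; split; last exact: rc.
have -> : G t = lim (G x @[x --> t^'+]) by apply/esym/cvg_lim => //; exact: rc.
by rewrite -E.
Unshelve. all: by end_near. Qed.

(** For s = 0 this is the convergence of masses. For s > 0, after integration by parts, the
    integrands converge off the countable set of jumps of G and are dominated by s exp(-s u) on [0,
    +oo[. *)
Lemma weak_cvg_laplace (F : R -> R -> R) (G : R -> R) :
  (forall e, 0 < e <= 1 -> subdf (F e)) -> subdf G -> weak_cvg F G ->
  forall s, 0 <= s -> laplace (F e) s @[e --> 0^'+] --> laplace G s.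
Proof.
move=> sF sG [cF cm] s; rewrite le_eqVlt => /predU1P[<-|s0].
  rewrite laplace0//; apply: cvg_eq_itv01 cm => e e01.
  by rewrite laplace0//; exact: sF.
(* The sequences that test the limit at 0 may take values above 1, where nothing is known of F;
   capping the parameter makes every term a subdistribution. *)
pose F' e := F (Num.min e 1).
have F'E e : 0 < e <= 1 -> F' e = F e by move=> /andP[_ e1]; rewrite /F' min_l.
have sF' e : 0 < e -> subdf (F' e).
  by move=> e0; apply: sF; rewrite lt_min e0 ltr01/= ge_min lexx orbT.
apply: (@cvg_eq_itv01 _ _ (fun e => laplace (F' e) s)).
  by move=> e e01; rewrite F'E.
apply/cvg_at_rightP => u [u0 cu].
have lE (H : R -> R) : subdf H ->
    laplace H s = fine (\int[mu]_x (s * expR (- (s * x)) * H x)%:E)%E.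
  by move=> [h H0 _]; rewrite /laplace stieltjes_laplace_parts.
under eq_fun do rewrite (lE _ (sF' _ (u0 _))).
rewrite lE//.
have mk : measurable_fun setT (fun x : R => s * expR (- (s * x))).
  by apply: measurable_funM => //; apply: (@measurable_expRM _ _ _ id); exact: measurable_id.
have mH (H : R -> R) : subdf H ->
    measurable_fun setT (fun x : R => (s * expR (- (s * x)) * H x)%:E).
  move=> [[nd _] _ _]; apply/measurable_EFinP/measurable_funM => //.
  exact: nondecreasing_measurable.
pose g : R -> \bar R := (fun x => (s * expR (- (s * x)))%:E) \_ `[0, +oo[.
have ig : mu.-integrable setT g.
  apply: (integrable_mkcond (T := measurableTypeR R) _ _).1.
    exact: measurable_itv.
  apply/integrableP; split.
    exact/measurable_funTS/measurable_EFinP.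
  under eq_integral do rewrite gee0_abs ?lee_fin ?mulr_ge0 ?expR_ge0 ?(ltW s0)//.
  by rewrite integral_exp_tail// ltry.
have bd (H : R -> R) x : subdf H -> (`|(s * expR (- (s * x)) * H x)%:E| <= g x)%E.
  move=> sH; have H0 := subdf_ge0 x sH; have [_ Hn H1] := sH.
  have k0 : 0 <= s * expR (- (s * x)) by rewrite mulr_ge0 ?expR_ge0 ?(ltW s0).
  rewrite gee0_abs; last by rewrite lee_fin mulr_ge0.
  rewrite /g /patch; case: ifPn => [_|].
    by rewrite lee_fin -[leRHS]mulr1 ler_wpM2l.
  rewrite notin_setE/= in_itv/= andbT => /negP; rewrite -ltNge => x0.
  by rewrite Hn// mulr0.
have H1 : {ae mu, forall x : measurableTypeR R, setT x ->
    (fun n => (s * expR (- (s * x)) * F' (u n) x)%:E) @ \oo -->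
      (s * expR (- (s * x)) * G x)%:E}.
  exists [set t | ~ {for t, continuous G}].
  have [hG _ _] := sG; have cd := cumulative_discontinuity_countable hG.
  split.
  + exact: countable_measurable.
  + exact: countable_lebesgue_measure0.
  move=> t /=; apply: contra_not => /= ct _.
  apply: cvg_EFin; first exact: nearW.
  apply: cvgM; first exact: cvg_cst.
  have : F' e t @[e --> 0^'+] --> G t.
    by apply: cvg_eq_itv01 (cF t ct) => e e01; rewrite F'E.
  by move/cvg_at_rightP; apply.
have H2 : {ae mu, forall (x : measurableTypeR R) n, setT x ->
    (`|(s * expR (- (s * x)) * F' (u n) x)%:E| <= g x)%E}.
  by apply: aeW => x n _; apply: bd; exact: sF'.
have [i1 _ c1] := @dominated_convergence _ (measurableTypeR R) R mu setT measurableT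
  (fun n x => (s * expR (- (s * x)) * F' (u n) x)%:E)
  (fun x => (s * expR (- (s * x)) * G x)%:E) g (fun n => mH _ (sF' _ (u0 n)))
  (mH _ sG) H1 ig H2.
by apply: fine_cvg; rewrite fineK//; exact: integrable_fin_num.
Qed.

(** Beyond T the exponential is at most exp(-s T). Read as a lower bound for F T, this is the
    tightness estimate. *)
Lemma laplace_tail (F : R -> R) (s T : R) : subdf F -> 0 <= s -> 0 <= T ->
  laplace F s <= F T + expR (- (s * T)).
Proof.
move=> sF s0 T0; have [h F0 F1] := sF.
have mH := @measurable_half_line R.
have ii : (ls h).-integrable half_line (EFin \o (\1_[set x : R | x <= T] : R -> R)).
  apply: (@subdf_bounded_integrable _ _ _ _ 1) => //.
    apply: measurable_indic.
    exact: (@measurable_le_set _ _ (measurableTypeR R) id (@measurable_id _ _ _)).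
  by move=> x _; rewrite indicE; case: (_ \in _); rewrite ?normr1 ?normr0.
have ic b : (ls h).-integrable half_line (EFin \o (fun=> b : R)).
  by apply: (@subdf_bounded_integrable _ _ _ _ `|b|).
apply: (@le_trans _ _ (F T + expR (- (s * T)) * total_mass F)); last first.
  by rewrite lerD2l -[leRHS]mulr1 ler_pM2l ?expR_gt0// subdf_mass_le1.
rewrite -(Rintegral_le_set h T sF) -(Rintegral_half_line_cst h _ sF) (laplaceE h).
rewrite -(RintegralD mH ii (ic _)); apply: le_Rintegral => //.
- exact: laplace_integrable.
- exact: (integrableD mH ii (ic _)).
move=> x /=; rewrite in_itv/= andbT => x0; rewrite indicE.
have [xt|xt] := boolP (x \in _).
  rewrite ler_wpDr ?expR_ge0// -expR0 ler_expR oppr_le0 mulr_ge0//.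
rewrite add0r ler_expR lerN2 ler_wpM2l//.
apply: ltW; rewrite ltNge; apply/negP => h'.
by move/negP: xt; apply; rewrite inE.
Qed.

Section Family.
Variable F : R -> R -> R.
Hypothesis sF : forall e, 0 < e <= 1 -> subdf (F e).

Lemma near_subdf : \forall e \near (0 : R)^'+, subdf (F e).
Proof. by near=> e; apply: sF; near: e; exact: near0_itv01. Unshelve. all: by end_near. Qed.

(** The shift d is absorbed by continuity of G at t: the upper bound is used at t, the lower bound
    at a point slightly left of t. *)
Lemma cvg_of_sandwich (G : R -> R) : subdf G ->
  (forall t d eta, 0 <= t -> 0 < d -> 0 < eta ->
    \forall e \near 0^'+, F e t <= G (t + d) + eta) ->
  (forall t d eta, 0 <= t -> 0 < d -> 0 < eta ->
    \forall e \near 0^'+, G t <= F e (t + d) + eta) ->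
  forall t, {for t, continuous G} -> F e t @[e --> 0^'+] --> G t.
Proof.
move=> sG up low t ct; have [[nd _] G0 _] := sG.
have [t0|t0] := ltP t 0.
  rewrite G0//; apply: (@cvg_eq_itv01 _ _ (fun=> 0)); last exact: cvg_cst.
  by move=> e /sF[_ -> ].
apply/cvgrPdist_le => eta eta0.
have e2 : 0 < eta / 2 by rewrite divr_gt0.
have /cvgrPdist_le/(_ _ e2)[r /= r0 hr] := ct.
have r2 : 0 < r / 2 by rewrite divr_gt0.
have near_t x : `|t - x| <= r / 2 -> `|G t - G x| <= eta / 2.
  by move=> h; apply: hr => /=; apply: (le_lt_trans h); lra.
have h1 : G (t + r / 2) <= G t + eta / 2.
  have := near_t (t + r / 2); rewrite opprD addrA subrr add0r normrN gtr0_norm// lexx.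
  by move=> /(_ isT); rewrite ler_norml => /andP[]; lra.
(* For t = 0 the hypothesis [low] gives nothing left of t; there t1 is negative and G t1 = 0. For t
   > 0 the minimum q keeps t - q nonnegative and within the radius of continuity. *)
have [t1 [h2 lowt]] : exists t1, G t - eta / 2 <= G t1 /\
    (\forall e \near 0^'+, G t1 <= F e t + eta / 2).
  have [t00|tn0] := eqVneq t 0.
    exists (- (r / 2)); split.
      have := near_t (- (r / 2)); rewrite t00 add0r opprK gtr0_norm// lexx.
      by move=> /(_ isT); rewrite ler_norml => /andP[]; lra.
    near=> e; rewrite G0; last by lra.
    by apply: addr_ge0; [apply: subdf_ge0; near: e; exact: near_subdf|exact: ltW].
  have tp : 0 < t by rewrite lt_neqAle eq_sym tn0.
  pose q := Num.min (t / 2) (r / 2).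
  have q0 : 0 < q by rewrite lt_min !divr_gt0.
  have qt : q <= t / 2 by rewrite ge_min lexx.
  have qr : q <= r / 2 by rewrite ge_min lexx orbT.
  exists (t - q); split.
    have := near_t (t - q); rewrite opprB addrC subrK gtr0_norm// qr.
    by move=> /(_ isT); rewrite ler_norml => /andP[]; lra.
  have : 0 <= t - q by lra.
  by move=> /low /(_ q0 e2); rewrite subrK.
near=> e.
have h3 : F e t <= G (t + r / 2) + eta / 2 by near: e; exact: up.
have h4 : G t1 <= F e t + eta / 2 by near: e.
by rewrite ler_norml; apply/andP; split; lra.
Unshelve. all: by end_near. Qed.

Lemma cvg_lincomb (l : seq (R * R)) (psi : R -> R) :
  (forall z, z \in l -> 0 <= z.2) ->
  (forall s, 0 <= s -> laplace (F e) s @[e --> 0^'+] --> psi s) ->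
  lincomb l (laplace (F e)) @[e --> 0^'+] --> lincomb l psi.
Proof.
move=> l0 cF; elim: l l0 => [|z l IH] l0.
  rewrite /lincomb big_nil; under eq_fun do rewrite big_nil; exact: cvg_cst.
rewrite /lincomb big_cons; under eq_fun do rewrite big_cons.
apply: cvgD.
  by apply: cvgM; [exact: cvg_cst|apply: cF; apply: l0; rewrite mem_head].
by apply: IH => y yl; apply: l0; rewrite in_cons yl orbT.
Qed.

(** The combination of the sandwich has the same list for F e and for G, and its values converge
    because it is finite; this compares F e at t with G at t + d, and conversely. *)
Lemma laplace_cvg_weak (G : R -> R) : subdf G ->
  (forall s, 0 <= s -> laplace (F e) s @[e --> 0^'+] --> laplace G s) ->
  weak_cvg F G.
Proof.
move=> sG cF; split; last first.
  rewrite -laplace0//; apply: cvg_eq_itv01 (cF 0 (lexx 0)) => e e01.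
  by rewrite laplace0//; exact: sF.
apply: cvg_of_sandwich => // t d eta t0 d0 eta0.
  have e4 : 0 < eta / 4 by rewrite divr_gt0.
  have [l [l0 hl]] := laplace_sandwich t0 d0 e4.
  have cl := cvg_lincomb l0 cF; have /andP[_ h2] := hl _ sG.
  near=> e.
  have /andP[h1 _] : F e t - eta / 4 <= lincomb l (laplace (F e)) <= F e (t + d) + eta / 4.
    by apply: hl; near: e; exact: near_subdf.
  have h3 : lincomb l (laplace (F e)) <= lincomb l (laplace G) + eta / 4.
    by near: e; apply: (cvgr_le _ cl); rewrite ltrDl.
  lra.
have e4 : 0 < eta / 4 by rewrite divr_gt0.
have [l [l0 hl]] := laplace_sandwich t0 d0 e4.
have cl := cvg_lincomb l0 cF; have /andP[h2 _] := hl _ sG.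
near=> e.
have /andP[_ h1] : F e t - eta / 4 <= lincomb l (laplace (F e)) <= F e (t + d) + eta / 4.
  by apply: hl; near: e; exact: near_subdf.
have h3 : lincomb l (laplace G) - eta / 4 <= lincomb l (laplace (F e)).
  by near: e; apply: (cvgr_ge _ cl); rewrite ltrBlDr ltrDl.
lra.
Unshelve. all: by end_near. Qed.

Variables (psi : R -> R) (m : R).
Hypothesis dpsi : decay psi m.
Hypothesis cpsi : forall s, 0 <= s -> laplace (F e) s @[e --> 0^'+] --> psi s.

(* U is the pointwise upper limit of the F e, and G its right-continuous
   version: the sandwich makes Helly's selection theorem unnecessary. *)
Let B t : set R := [set x | \forall e \near 0^'+, F e t <= x].
Let U t : R := inf (B t).
Let G t : R := inf [set U u | u in [set u | t < u]].

Let B_lb t : lbound (B t) 0.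
Proof.
move=> x /= Bx; have : \forall e \near (0 : R)^'+, 0 <= x.
  near=> e; have h : F e t <= x by near: e.
  by apply: le_trans h; apply: subdf_ge0; near: e; exact: near_subdf.
by move=> /filter_ex[].
Unshelve. all: by end_near. Qed.

Let B_inf t : has_inf (B t).
Proof.
split; last by exists 0; exact: B_lb.
exists 1 => /=; near=> e.
by have [_ _] : subdf (F e) by near: e; exact: near_subdf.
Unshelve. all: by end_near. Qed.

Let U_le t x : B t x -> U t <= x.
Proof. by move=> Bx; apply: ge_inf => //; have [] := B_inf t. Qed.

Let U_near t eta : 0 < eta -> \forall e \near 0^'+, F e t <= U t + eta.
Proof.
move=> eta0; have [x /= Bx xU] := inf_adherent eta0 (B_inf t).
near=> e; have h : F e t <= x by near: e.
exact: le_trans h (ltW xU).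
Unshelve. all: by end_near. Qed.

Let U_ge0 t : 0 <= U t.
Proof. by apply: lb_le_inf; [have [] := B_inf t|exact: B_lb]. Qed.

Let G_inf t : has_inf [set U u | u in [set u | t < u]].
Proof.
split; first by exists (U (t + 1)), (t + 1) => //=; rewrite ltrDl.
by exists 0 => _ [u _ <-].
Qed.

Let G_le t u : t < u -> G t <= U u.
Proof.
by move=> tu; apply: ge_inf; [have [] := G_inf t|exists u].
Qed.

Let U_nd t u : t <= u -> U t <= U u.
Proof.
move=> tu; apply: lb_le_inf; first by have [] := B_inf u.
move=> x /= Bx; apply: U_le => /=; near=> e.
have h : F e u <= x by near: e.
have [[nd _] _ _] : subdf (F e) by near: e; exact: near_subdf.
exact: le_trans (nd _ _ tu) h.
Unshelve. all: by end_near. Qed.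

Let U_le_G t : U t <= G t.
Proof.
apply: lb_le_inf; first by have [] := G_inf t.
by move=> _ [u /= tu <-]; apply: U_nd; exact: ltW.
Qed.

Let G_subdf : subdf G.
Proof.
have nd : nondecreasing G.
  move=> t u tu; apply: lb_le_inf; first by have [] := G_inf u.
  by move=> _ [x /= ux <-]; apply: G_le; exact: le_lt_trans ux.
split.
- split => // t; apply/cvgrPdist_le => eta eta0.
  have [_ [u /= tu <-] hu] := inf_adherent eta0 (G_inf t).
  near=> x.
  have tx : t <= x by near: x; exact: nbhs_right_ge.
  have xu : x < u by near: x; exact: nbhs_right_lt.
  have h1 := nd _ _ tx; have h2 := G_le xu; have h3 : U u < G t + eta by [].
  by rewrite ler_norml; apply/andP; split; lra.
- move=> t t0; apply/eqP; rewrite eq_le (le_trans (U_ge0 t) (U_le_G t)) andbT.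
  apply: (@le_trans _ _ (U (t / 2))); first by apply: G_le; lra.
  apply: U_le => /=; near=> e.
  have [_ -> //] : subdf (F e) by near: e; exact: near_subdf.
  by rewrite pmulr_llt0// invr_gt0.
- move=> t; apply: (@le_trans _ _ (U (t + 1))); first by apply: G_le; rewrite ltrDl.
  apply: U_le => /=; near=> e.
  by have [_ _] : subdf (F e) by near: e; exact: near_subdf.
Unshelve. all: by end_near. Qed.

(** Both the upper limit at t and the values at t + d are compared with the number [lincomb l psi].
    Thus convergence of transforms bounds the upper limit at t by the lower limit at t + d. *)
Let U_low t d eta : 0 <= t -> 0 < d -> 0 < eta ->
  \forall e \near 0^'+, U t <= F e (t + d) + eta.
Proof.
move=> t0 d0 eta0; have e4 : 0 < eta / 4 by rewrite divr_gt0.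
have [l [l0 hl]] := laplace_sandwich t0 d0 e4.
have cl := cvg_lincomb l0 cpsi.
have h : U t <= lincomb l psi + eta / 2.
  apply: U_le => /=; near=> e.
  have /andP[h1 _] : F e t - eta / 4 <= lincomb l (laplace (F e)) <= F e (t + d) + eta / 4.
    by apply: hl; near: e; exact: near_subdf.
  have h3 : lincomb l (laplace (F e)) <= lincomb l psi + eta / 4.
    by near: e; apply: (cvgr_le _ cl); rewrite ltrDl.
  lra.
near=> e.
have /andP[_ h1] : F e t - eta / 4 <= lincomb l (laplace (F e)) <= F e (t + d) + eta / 4.
  by apply: hl; near: e; exact: near_subdf.
have h3 : lincomb l psi - eta / 4 <= lincomb l (laplace (F e)).
  by near: e; apply: (cvgr_ge _ cl); rewrite ltrBlDr ltrDl.
lra.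
Unshelve. all: by end_near. Qed.

(** No mass escapes to infinity because psi tends to 1 at 0: s is chosen first so that psi s is near
    1, then T so that exp(-s T) is small. *)
Let G_cvg1 : G t @[t --> +oo] --> (1 : R).
Proof.
have [_ _ G1] := G_subdf.
have tight s T : 0 <= s -> 0 <= T -> psi s - expR (- (s * T)) <= G T.
  move=> s0 T0; apply/ler_addgt0Pr => eta eta0.
  have e2 : 0 < eta / 2 by rewrite divr_gt0.
  have h : \forall e \near (0 : R)^'+, psi s - expR (- (s * T)) <= G T + eta.
    near=> e.
    have h1 : F e T <= U T + eta / 2 by near: e; exact: U_near.
    have h2 : laplace (F e) s <= F e T + expR (- (s * T)).
      by apply: laplace_tail => //; near: e; exact: near_subdf.
    have h3 : psi s - eta / 2 <= laplace (F e) s.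
      by near: e; apply: (cvgr_ge _ (cpsi s0)); rewrite ltrBlDr ltrDl.
    have h4 := U_le_G T; lra.
  by have [] := filter_ex h.
apply/cvgrPdist_le => eta eta0.
have e2 : 0 < eta / 2 by rewrite divr_gt0.
have [s [s0 hs]] : exists s, 0 < s /\ 1 - eta / 2 <= psi s.
  have : \forall s \near 0^'+, 0 < s /\ 1 - eta / 2 <= psi s.
    near=> s; split; first by near: s; exact: nbhs_right_gt.
    near: s; apply: (cvgr_ge _ (decay_cvg1 dpsi)); rewrite ltrBlDr ltrDl//.
  by move=> /filter_ex[s ?]; exists s.
have ce : expR (- (s * T)) @[T --> +oo] --> (0 : R).
  have /= := @cvg_comp _ _ _ (fun T : R => s * T) (fun T => expR (- T)) _ _ _ _ (@cvgr_expR R).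
  by apply; apply: gt0_cvgMry => //; exact: cvg_id.
near=> T.
have T0 : 0 <= T by near: T; apply: nbhs_pinfty_ge; exact: num_real.
have h1 : expR (- (s * T)) <= eta / 2.
  by near: T; apply: (cvgr_le _ ce).
have h2 := tight _ _ (ltW s0) T0; have h3 := G1 T.
by rewrite ler_norml; apply/andP; split; lra.
Unshelve. all: by end_near. Qed.

(** The family converges weakly to G, so its transforms converge to that of G as well as to psi. *)
Lemma laplace_limit_df :
  (forall e, 0 < e <= 1 -> proper_df (F e)) ->
  exists H, proper_df H /\ forall s, 0 <= s -> laplace H s = psi s.
Proof.
move=> pF; have [hG G0 _] := G_subdf.
have pG : proper_df G by split.
exists G; split => // s s0.
have w : weak_cvg F G.
  split; last first.
    rewrite proper_mass//; apply: (@cvg_eq_itv01 _ _ (fun=> 1)); last exact: cvg_cst.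
    by move=> e e01; rewrite proper_mass//; exact: pF.
  apply: cvg_of_sandwich => // t d eta t0 d0 eta0.
    near=> e.
    have h : F e t <= U t + eta by near: e; exact: U_near.
    apply: (le_trans h); rewrite lerD2r; apply: (le_trans (U_le_G t)).
    by have [nd _] := hG; apply: nd; rewrite lerDl ltW.
  have d2 : 0 < d / 2 by rewrite divr_gt0.
  near=> e; apply: (@le_trans _ _ (U (t + d / 2))); first by apply: G_le; rewrite ltrDl.
  (* Half of the shift passes from G to U, the other half is consumed by [U_low]. *)
  have -> : t + d = t + d / 2 + d / 2 by rewrite -addrA -splitr.
  by near: e; apply: U_low => //; rewrite addr_ge0// ltW.
have := weak_cvg_laplace sF G_subdf w s0.
by move/(@cvg_unique _ (@Rhausdorff R)); apply; exact: cpsi.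
Unshelve. all: by end_near. Qed.

End Family.
End ContinuityTheorem.

(** * The transform of the hitting distribution *)

Section HittingTransform.
Context {R : realType} {M : nat} (Z : markov_renewal R M).
Local Notation P := (mrp_P Z).
Local Notation eta := (@mrp_eta _ _ Z).
Local Notation kappa := (@mrp_kappa _ _ Z).
Implicit Types (i j : 'I_M) (x : nat -> 'I_M) (t : nat -> R) (s : R).

Definition trL s i j : R :=
  fine (\int[P i]_(w in [set w | eta 1 w = j]) (expR (- (s * kappa 1 w)))%:E)%E.

Let m_eta n j := @mrp_eta_measurable _ _ Z n j.
Let m_kappa n := @mrp_kappa_measurable _ _ Z n.
Let kappa0 n w := @mrp_kappa_ge0 _ _ Z n w.

Lemma trL_ge0 s i j : 0 <= trL s i j.
Proof. by apply/fine_ge0/integral_ge0 => w _; rewrite lee_fin expR_ge0. Qed.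

Lemma trL_fin s i j : 0 <= s ->
  (\int[P i]_(w in [set w | eta 1 w = j]) (expR (- (s * kappa 1 w)))%:E)%E
    \is a fin_num.
Proof. by move=> s0; apply: variable_laplace_fin. Qed.

Lemma trQ_subdf i j : subdf (trQ Z i j).
Proof.
have -> : trQ Z i j = fun u : R => 1 * fine (P i ([set w | eta 1 w = j] `&`
    [set w | kappa 1 w <= u])) by apply/funext => u; rewrite mul1r.
apply: variable_subdf => //; rewrite mul1r -[leRHS]/(fine 1%E).
by rewrite fine_le ?fin_num_measure//; exact: probability_le1.
Qed.

Lemma trQ_laplace s i j : 0 <= s -> laplace (trQ Z i j) s = trL s i j.
Proof.
have -> : trQ Z i j = fun u : R => 1 * fine (P i ([set w | eta 1 w = j] `&`
    [set w | kappa 1 w <= u])) by apply/funext => u; rewrite mul1r.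
by move=> s0; rewrite variable_laplace// mul1r.
Qed.

Lemma trpE i j : trp Z i j = trL 0 i j.
Proof. by rewrite -trQ_laplace// laplace0//; exact: trQ_subdf. Qed.

Lemma trL_le s i j : 0 <= s -> trL s i j <= trp Z i j.
Proof.
move=> s0; rewrite trpE -!trQ_laplace//.
by apply: laplace_nonincreasing => //; exact: trQ_subdf.
Qed.

Lemma trp_prob i j : trp Z i j = fine (P i [set w | eta 1 w = j]).
Proof.
rewrite trpE /trL; under eq_integral do rewrite mul0r oppr0 expR0.
by rewrite integral_cst// mul1e.
Qed.

Lemma trp_sum1 i : \sum_j trp Z i j = 1.
Proof.
have E : [set: mrp_space Z] = \big[setU/set0]_(j <- enum 'I_M) [set w | eta 1 w = j].
  rewrite -bigcup_seq; apply/esym; rewrite -subTset => w _.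
  by exists (eta 1 w) => //=; rewrite mem_enum.
have tv : trivIset [set` enum 'I_M] (fun j => [set w | eta 1 w = j]).
  apply/trivIsetP => a b _ _ ab; rewrite -subset0 => w [/= wa wb].
  by move: ab; rewrite -wa -wb eqxx.
have := @ge0_integral_bigsetU _ _ R (P i) _ (fun j => [set w | eta 1 w = j])
  (cst 1%E) (enum 'I_M) (m_eta 1) (enum_uniq _) tv (measurable_cst _) (fun _ _ => lee01).
rewrite -E integral_cst//. 
rewrite mul1e [X in X = _ -> _](probability_setT (P i)) => H.
apply/EFin_inj; rewrite -sumEFin [RHS]H big_enum /=; apply: eq_bigr => j _.
by rewrite integral_cst// mul1e trp_prob fineK// fin_num_measure.
Qed.

Definition box x t n : set (mrp_space Z) :=
  [set w | forall l, (l <= n)%N -> eta l w = x l /\ kappa l w <= t l].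

Lemma boxS x t n : box x t n.+1 =
  box x t n `&` [set w | eta n.+1 w = x n.+1 /\ kappa n.+1 w <= t n.+1].
Proof.
apply/seteqP; split => [w H|w [H1 H2] l].
  by split; [move=> l ln; apply: H; exact: leqW|exact: H].
by rewrite leq_eqVlt => /predU1P[->//|]; rewrite ltnS; exact: H1.
Qed.

(** Iterated Markov property. The factor at time 0 stays because the law of kappa_0 is arbitrary. *)
Lemma box_prob i x t n : (P i (box x t n) = P i (box x t 0) *
  (\prod_(1 <= l < n.+1) trQ Z (x l.-1) (x l) (t l))%:E)%E.
Proof.
elim: n => [|n IH]; first by rewrite big_geq// mule1.
rewrite boxS.
have := @mrp_markov _ _ Z i n x t (x n.+1) (t n.+1); rewrite /= -/(box x t n) => ->.
rewrite IH [in RHS]big_nat_recr//= EFinM muleA; congr (_ * _)%E.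
rewrite /trQ fineK//; apply: fin_num_measure.
exact: measurableI (m_eta _ _) (measurable_le_set (m_kappa _) _).
Qed.

Definition pathset x n : set (mrp_space Z) :=
  [set w | forall l, (l <= n)%N -> eta l w = x l].

(* kappa is bounded at time 0 and after time m; the factors exp(-s kappa_l) are
   introduced one by one at the times 1, ..., m. *)
Definition latebox x t m n : set (mrp_space Z) :=
  pathset x n `&` [set w | forall l, (l <= n)%N -> (l == 0)%N || (m < l)%N ->
    kappa l w <= t l].

Definition clock n w : R := \sum_(1 <= l < n.+1) kappa l w.

Lemma clockS n w : clock n.+1 w = clock n w + kappa n.+1 w.
Proof. by rewrite /clock big_nat_recr. Qed.

Lemma measurable_clock n : measurable_fun setT (clock n).
Proof. by apply: measurable_sum => l; exact: m_kappa. Qed.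

Lemma measurable_forall_le (Q : nat -> set (mrp_space Z)) n :
  (forall l, (l <= n)%N -> measurable (Q l)) ->
  measurable [set w | forall l, (l <= n)%N -> Q l w].
Proof.
move=> mQ; have -> : [set w | forall l, (l <= n)%N -> Q l w] =
    \bigcap_l (if (l <= n)%N then Q l else setT).
  apply/seteqP; split => w H l /=; first by case: ifPn => // + _; exact: H.
  by have := H l I; case: ifP.
by apply: bigcapT_measurable => l; case: ifPn => // ?; exact: mQ.
Qed.

Lemma measurable_pathset x n : measurable (pathset x n).
Proof. by apply: (measurable_forall_le (Q := fun l => [set w | eta l w = x l])). Qed.

Lemma measurable_latebox x t m n : measurable (latebox x t m n).
Proof.
apply: measurableI; first exact: measurable_pathset.
apply: (measurable_forall_le (Q := fun l => [set w | (l == 0)%N || (m < l)%N ->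
  kappa l w <= t l])) => l _.
case: (_ || _); last by rewrite (_ : [set _ | _] = setT)//; apply/seteqP; split.
rewrite (_ : [set _ | _] = [set w | kappa l w <= t l]).
  exact: measurable_le_set.
by apply/seteqP; split => w /= H //; exact: H.
Qed.

(** The Markov property is available only for sets with thresholds on the sojourn times. Each
    induction step frees kappa_{m+1} from its threshold by [laplace_transfer], with exp(-s clock m)
    as weight, comparing it with kappa_1 under the law started at x m. *)
Lemma latebox_integral s i x t m n : 0 <= s -> (m <= n)%N ->
  (\int[P i]_(w in latebox x t m n) (expR (- (s * clock m w)))%:E =
   P i (box x t 0) *
   (\prod_(1 <= l < m.+1) trL s (x l.-1) (x l) *
    \prod_(m.+1 <= l < n.+1) trQ Z (x l.-1) (x l) (t l))%:E)%E.
Proof.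
move=> s0; elim: m t => [|m IH] t mn.
  rewrite [X in (_ * (X * _)%:E)%E]big_geq// mul1r -box_prob.
  have -> : latebox x t 0 n = box x t n.
    apply/seteqP; split => [w [H1 H2] l ln|w H].
      by split; [exact: H1|apply: H2 => //; case: l ln].
    by split => l ln; [have [] := H l ln|move=> _; have [] := H l ln].
  under eq_integral do rewrite /clock big_geq// mulr0 oppr0 expR0.
  rewrite integral_cst ?mul1e//.
  apply: (measurable_forall_le (Q := fun l => [set w | eta l w = x l /\ kappa l w <= t l])).
  by move=> l _; exact: measurableI (m_eta _ _) (measurable_le_set (m_kappa _) _).
have b0f : P i (box x t 0) \is a fin_num.
  apply: fin_num_measure.
  apply: (measurable_forall_le (Q := fun l => [set w | eta l w = x l /\ kappa l w <= t l])).
  by move=> l _; exact: measurableI (m_eta _ _) (measurable_le_set (m_kappa _) _).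
(* The part of the product that does not involve the threshold at time m+1. *)
pose c := fine (P i (box x t 0)) * (\prod_(1 <= l < m.+1) trL s (x l.-1) (x l) *
    \prod_(m.+2 <= l < n.+1) trQ Z (x l.-1) (x l) (t l)).
have c0 : 0 <= c.
  apply: mulr_ge0; first exact: fine_ge0.
  apply: mulr_ge0; apply: prodr_ge0 => l _; first exact: trL_ge0.
  by apply: subdf_ge0; exact: trQ_subdf.
have := @laplace_transfer R _ _ _ _ (P i) (P (x m)) (latebox x t m.+1 n)
  (fun w => expR (- (s * clock m w))) (kappa m.+1) [set w | eta 1 w = x m.+1]
  (fun=> c) (kappa 1) (measurable_latebox _ _ _ _)
  (measurable_expRM s (measurable_clock m)) (fun=> expR_ge0 _) (m_kappa _)
  (m_eta _ _) (measurable_cst _) (fun=> c0) (m_kappa _).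
move=> /(_ _ s s0) H.
under eq_integral do rewrite clockS mulrDr opprD expRD.
rewrite H.
  under eq_integral do rewrite EFinM.
  rewrite ge0_integralZl_EFin//; last first.
    exact/measurable_funTS/measurable_EFinP/measurable_expRM.
  rewrite -(fineK (trL_fin (x m) (x m.+1) s0)) -/(trL s (x m) (x m.+1)) -EFinM.
  rewrite -(fineK b0f) -EFinM; congr (_%:E).
  rewrite [\prod_(1 <= l < m.+2) _]big_nat_recr//= /c; ring.
move=> u.
(* Cutting kappa_{m+1} at u restores the situation of the induction hypothesis, with u as the
   threshold at time m+1. *)
pose t' l := if l == m.+1 then u else t l.
have E : latebox x t m.+1 n `&` [set w | kappa m.+1 w <= u] = latebox x t' m n.
  apply/seteqP; split => [w [[H1 H2] H3]|w [H1 H2]].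
    split => // l ln; rewrite /t'; have [->//|lm] := eqVneq l m.+1.
    move=> /orP[l0|ml]; apply: H2 => //; rewrite ?l0//.
    by rewrite (ltn_neqAle m.+1) [m.+1 == l]eq_sym lm ml orbT.
  split.
    split => // l ln /orP[/eqP l0|ml].
      by move: ln; rewrite l0 => ln; exact: (H2 0%N ln isT).
    have lm : (l == m.+1) = false by rewrite gtn_eqF.
    have := H2 l ln; rewrite /t' lm; apply.
    by rewrite (ltnW ml) orbT.
  by have := H2 m.+1 mn; rewrite /t' eqxx /= leqnn; apply.
rewrite E IH; last exact: ltnW.
rewrite integral_cst; last first.
  exact: measurableI (m_eta _ _) (measurable_le_set (m_kappa _) _).
have -> : box x t' 0 = box x t 0.
  by apply/seteqP; split => w Hb l; rewrite leqn0 => /eqP ->; have := Hb 0%N isT.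
rewrite (@big_ltn _ _ _ m.+1)//.
rewrite -(fineK b0f).
have Y : P (x m) ([set w | eta 1 w = x m.+1] `&` [set w | kappa 1 w <= u]) =
    (trQ Z (x m) (x m.+1) u)%:E.
  rewrite /trQ fineK//; apply: fin_num_measure.
  exact: measurableI (m_eta _ _) (measurable_le_set (m_kappa _) _).
rewrite [X in _ = (_ * X)%E]Y.
rewrite -!EFinM; congr (_%:E); rewrite /= /t' eqxx.
have -> : \prod_(m.+2 <= i0 < n.+1) trQ Z (x i0.-1) (x i0) (if i0 == m.+1 then u else t i0) =
   \prod_(m.+2 <= l < n.+1) trQ Z (x l.-1) (x l) (t l).
  by apply: eq_big_nat => l /andP[l1 _]; rewrite gtn_eqF.
by rewrite /c; ring.
Qed.

Lemma path_integral s i x n : 0 <= s -> x 0%N = i ->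
  (\int[P i]_(w in pathset x n) (expR (- (s * clock n w)))%:E =
   (\prod_(1 <= l < n.+1) trL s (x l.-1) (x l))%:E)%E.
Proof.
move=> s0 x0; set c := \prod_(1 <= l < n.+1) _.
have c0 : 0 <= c by apply: prodr_ge0 => l _; exact: trL_ge0.
have := @laplace_transfer R _ _ _ _ (P i) (P i) (pathset x n)
  (fun w => expR (- (s * clock n w))) (kappa 0) [set w | eta 0 w = i]
  (fun=> c) (kappa 0) (measurable_pathset _ _)
  (measurable_expRM s (measurable_clock n)) (fun=> expR_ge0 _) (m_kappa _)
  (m_eta _ _) (measurable_cst _) (fun=> c0) (m_kappa _).
(* The transfer at exponent 0 removes the threshold on kappa_0, whose law then no longer matters. *)
move=> /(_ _ 0 (lexx 0)) H.
transitivity (\int[P i]_(w in pathset x n)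
    (expR (- (s * clock n w)) * expR (- (0 * kappa 0 w)))%:E)%E.
  by apply: eq_integral => w _; rewrite mul0r oppr0 expR0 mulr1.
rewrite H.
  under eq_integral do rewrite mul0r oppr0 expR0 mulr1.
  by rewrite integral_cst// [X in (_ * X)%E](mrp_init Z i) mule1.
move=> u.
pose t (l : nat) : R := u.
have -> : pathset x n `&` [set w | kappa 0 w <= u] = latebox x t n n.
  apply/seteqP; split => [w [H1 H2]|w [H1 H2]].
    split => // l ln /orP[/eqP ->//|]; by rewrite ltnNge ln.
  by split => //; exact: (H2 0%N (leq0n _) isT).
rewrite latebox_integral// [X in (_ * (_ * X)%:E)%E]big_geq// mulr1 -/c.
rewrite integral_cst; last by exact: measurableI (m_eta _ _) (measurable_le_set (m_kappa _) _).
rewrite muleC; congr (_ * _)%E; congr (P i _).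
apply/seteqP; split => [w Hb|w [Hb Hb'] l]; last by rewrite leqn0 => /eqP ->; rewrite x0.
by have := Hb 0%N isT; rewrite x0.
Qed.

Variable D : {set 'I_M}.
Variable j : 'I_M.

(** The transform of the total time of the first d+1 steps from i, on the event that the first d of
    them end outside D and the last one in j. *)
Fixpoint escape s d i : R :=
  if d is d'.+1 then \sum_(r in ~: D) trL s i r * escape s d' r else trL s i j.

(** The prescribed initial path of length m serves the induction: fixing one more state raises m and
    lowers d, with m + d unchanged. *)
Definition exitset x m d : set (mrp_space Z) :=
  pathset x m `&` [set w | (forall l, (m < l < m + d.+1)%N -> eta l w \notin D) /\
    eta (m + d.+1) w = j].

Lemma measurable_notinD l : measurable [set w | eta l w \notin D].
Proof.
have -> : [set w | eta l w \notin D] =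
    \big[setU/set0]_(r <- enum (~: D)) [set w | eta l w = r].
  rewrite -bigcup_seq; apply/seteqP; split => [w /= wD|w [r /=]].
    by exists (eta l w) => //=; rewrite mem_enum inE.
  by rewrite mem_enum inE => rD ->.
by apply: bigsetU_measurable => r _; exact: m_eta.
Qed.

Lemma measurable_exitset x m d : measurable (exitset x m d).
Proof.
apply: measurableI; first exact: measurable_pathset.
apply: (@measurableI _ _ [set w | forall l, (m < l < m + d.+1)%N -> eta l w \notin D]);
  last exact: m_eta.
have -> : [set w | forall l, (m < l < m + d.+1)%N -> eta l w \notin D] =
  [set w | forall l, (l <= m + d)%N -> (m < l)%N -> eta l w \notin D].
  apply/seteqP; split => w H l; first by move=> l1 l2; apply: H; rewrite l2 addnS ltnS.
  by rewrite addnS ltnS => /andP[l1 l2]; exact: H.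
apply: (measurable_forall_le (Q := fun l => [set w | (m < l)%N -> eta l w \notin D])) => l _.
case: (m < l)%N; last by rewrite (_ : [set _ | _] = setT)//; apply/seteqP; split.
rewrite (_ : [set _ | _] = [set w | eta l w \notin D]); first exact: measurable_notinD.
by apply/seteqP; split => w /= H //; exact: H.
Qed.

(** Split according to the state r at time m+1, which lengthens the prescribed path by r; for d = 0
    it is lengthened by j and becomes a full path. *)
Lemma exit_integral s i x m d : 0 <= s -> x 0%N = i ->
  (\int[P i]_(w in exitset x m d) (expR (- (s * clock (m + d.+1) w)))%:E =
   (\prod_(1 <= l < m.+1) trL s (x l.-1) (x l) * escape s d (x m))%:E)%E.
Proof.
move=> s0; pose upd x m r l : 'I_M := if l == m.+1 then r else x l.
have updE y n r l : (l <= n)%N -> upd y n r l = y l.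
  by move=> ln; rewrite /upd ltn_eqF// ltnS.
have updS y n r : upd y n r n.+1 = r by rewrite /upd eqxx.
have prodE y n r : \prod_(1 <= l < n.+2) trL s (upd y n r l.-1) (upd y n r l) =
    \prod_(1 <= l < n.+1) trL s (y l.-1) (y l) * trL s (y n) r.
  rewrite big_nat_recr//= updS updE//; congr (_ * _).
  apply: eq_big_nat => l /andP[l1 l2]; rewrite !updE//.
  by rewrite (leq_trans (leq_pred _)).
elim: d x m => [|d IH] x m x0.
  rewrite addn1.
  have -> : exitset x m 0 = pathset (upd x m j) m.+1.
    apply/seteqP; split => [w [H1 [_ H2]] l|w H].
      rewrite leq_eqVlt => /predU1P[->|]; first by rewrite updS -H2 addn1.
      by rewrite ltnS => lm; rewrite updE// H1.
    split; first by move=> l lm; rewrite (H l (leqW lm)) updE.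
    split; last by rewrite addn1 (H m.+1 (leqnn _)) updS.
    by move=> l /andP[l1]; rewrite addn1 ltnS leqNgt l1.
  by rewrite path_integral ?prodE// updE.
have E : exitset x m d.+1 =
    \big[setU/set0]_(r <- enum (~: D)) exitset (upd x m r) m.+1 d.
  rewrite -bigcup_seq; apply/seteqP; split => [w [H1 [H2 H3]]|w [r /= rD [H1 [H2 H3]]]].
    have eD : eta m.+1 w \notin D.
      by apply: H2; rewrite ltnSn !addnS !ltnS leq_addr.
    exists (eta m.+1 w); first by rewrite /= mem_enum inE.
    split.
      move=> l; rewrite leq_eqVlt => /predU1P[->|]; first by rewrite updS.
      by rewrite ltnS => lm; rewrite updE// H1.
    rewrite addSnnS; split => // l /andP[l1 l2]; apply: H2.
    by rewrite l2 (ltnW l1).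
  rewrite mem_enum inE in rD.
  split; first by move=> l lm; rewrite (H1 l (leqW lm)) updE.
  rewrite -addSnnS; split => // l /andP[l1 l2].
  move: l1; rewrite leq_eqVlt => /predU1P[<-|l1]; last by apply: H2; rewrite l1.
  by rewrite (H1 m.+1 (leqnn _)) updS.
rewrite E ge0_integral_bigsetU//=; last 4 first.
- by move=> r; exact: measurable_exitset.
- exact: enum_uniq.
- apply/trivIsetP => a b _ _ ab; rewrite -subset0 => w [[H1 _] [H2 _]].
  move: (H1 m.+1 (leqnn _)) (H2 m.+1 (leqnn _)); rewrite !updS => -> ba.
  by rewrite ba eqxx in ab.
- exact/measurable_funTS/measurable_EFinP/measurable_expRM/measurable_clock.
rewrite big_enum /= mulr_sumr -sumEFin; apply: eq_bigr => r _.
rewrite -addSnnS IH; last by rewrite updE.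
by rewrite prodE updS mulrA.
Qed.

End HittingTransform.

(** * The hitting time and its linear system *)

Section HittingSystem.
Context {R : realType} {M : nat} (Z : markov_renewal R M) (D : {set 'I_M}).
Local Notation P := (mrp_P Z).
Local Notation eta := (@mrp_eta _ _ Z).
Local Notation kappa := (@mrp_kappa _ _ Z).
Implicit Types (i j : 'I_M) (s : R) (w : mrp_space Z).

Lemma is_nu_unique w n m : is_nu D w n -> is_nu D w m -> n = m.
Proof.
move=> [n0 nD nl] [m0 mD ml]; apply/eqP; rewrite eqn_leq; apply/andP; split.
  by rewrite leqNgt; apply/negP => mn; have := nl m; rewrite m0 mn mD => /(_ isT).
by rewrite leqNgt; apply/negP => nm; have := ml n; rewrite n0 nm nD => /(_ isT).
Qed.

(* The value is 0 on the trajectories that never hit D. *)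
Definition tau w : R := clock (xget 0%N [set n | is_nu D w n]) w.

Lemma tauE w n : is_nu D w n -> tau w = clock n w.
Proof.
move=> nu; rewrite /tau; case: xgetP => [m -> /= nm|/(_ n)//].
by rewrite (is_nu_unique nm nu).
Qed.

Lemma tau_ge0 w : 0 <= tau w.
Proof. by apply: sumr_ge0 => l _; exact: mrp_kappa_ge0. Qed.

Lemma measurable_nu n : measurable [set w : mrp_space Z | is_nu D w n].
Proof.
case: n => [|n].
  by rewrite (_ : [set _ | _] = set0)// -subset0 => w [].
have -> : [set w : mrp_space Z | is_nu D w n.+1] = ~` [set w | eta n.+1 w \notin D] `&`
    [set w | forall l, (l <= n)%N -> (0 < l)%N -> eta l w \notin D].
  apply/seteqP; split => [w [_ h1 h2]|w [/= h1 h2]].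
    by split => /=; [apply/negP; rewrite negbK|move=> l l1 l0; apply: h2; rewrite l0].
  split => //; first by move/negP: h1; rewrite negbK.
  by move=> l /andP[l0]; rewrite ltnS => ln; exact: h2.
apply: measurableI; first by apply: measurableC; exact: measurable_notinD.
apply: (measurable_forall_le (Q := fun l => [set w | (0 < l)%N -> eta l w \notin D])) => l _.
case: (0 < l)%N; last by rewrite (_ : [set _ | _] = setT)//; apply/seteqP; split.
rewrite (_ : [set _ | _] = [set w | eta l w \notin D]); first exact: measurable_notinD.
by apply/seteqP; split => w /= H //; exact: H.
Qed.

Lemma measurable_tau : measurable_fun setT tau.
Proof.
(* A hitting index is positive, so index 0 is free for the trajectories that never hit D; on them
   [xget] returns its default 0 and tau equals [clock 0]. *)
pose E n : set (mrp_space Z) :=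
  if n is 0%N then ~` (\bigcup_n [set w : mrp_space Z | is_nu D w n]) else [set w : mrp_space Z | is_nu D w n].
have mE n : measurable (E n).
  case: n => [|n]; last exact: measurable_nu.
  by apply: measurableC; apply: bigcupT_measurable => n; exact: measurable_nu.
have -> : [set: mrp_space Z] = \bigcup_n E n.
  apply/esym; rewrite -subTset => w _.
  have [[n nu]|H] := pselect (exists n, is_nu D w n).
    by exists n => //; case: n nu => [[]|].
  by exists 0%N => // -[n _ nu]; apply: H; exists n.
apply/measurable_fun_bigcup => // n.
apply: (eq_measurable_fun (clock n)); last exact/measurable_funTS/measurable_clock.
move=> w; rewrite inE; case: n => [/= H|n]; last by move=> /= nu; rewrite (tauE nu).
rewrite /tau; case: xgetP => [m _ nu|//].
by exfalso; apply: H; exists m.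
Qed.

Lemma probability_setI_full i (A : set (mrp_space Z)) : measurable A ->
  P i A = P i (A `&` [set w | eta 0 w = i]).
Proof.
move=> mA; have mH := @mrp_eta_measurable _ _ Z 0 i.
rewrite -[in LHS](setUIDK A [set w | eta 0 w = i]) measureU//; last 3 first.
- exact: measurableI.
- exact: measurableD.
- by rewrite setDE setIACA setICr setI0.
rewrite [X in (_ + X)%E](_ : _ = 0%E) ?adde0//.
apply/eqP; rewrite eq_le measure_ge0 andbT.
apply: (@le_trans _ _ (P i (~` [set w | eta 0 w = i]))).
  apply: le_measure; rewrite ?inE; [exact: measurableD|exact: measurableC|].
  by move=> w [].
by rewrite probability_setC// [X in (_ - X)%E](mrp_init Z i) subee.
Qed.

Lemma exitset_nu i j d w : j \in D -> exitset D j (fun=> i) 0 d w ->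
  is_nu D w d.+1 /\ eta d.+1 w = j.
Proof.
by move=> jD [_ [H1 H2]]; rewrite !add0n in H1 H2; split => //; split => //; rewrite H2.
Qed.

(** With m = 0 only the value at 0 of the constant path counts: the trajectory starts at i. *)
Definition hitset i j : set (mrp_space Z) := \bigcup_d exitset D j (fun=> i) 0 d.

Lemma measurable_hitset i j : measurable (hitset i j).
Proof. by apply: bigcupT_measurable => d; exact: measurable_exitset. Qed.

(** The event in [hittingG] does not fix the initial state. It agrees with [hitset] where eta_0 = i,
    which has probability 1; its measurability comes from the union over all initial states. *)
Lemma hittingE i j : j \in D -> hittingG Z D i j =
  fun t => 1 * fine (P i (hitset i j `&` [set w | tau w <= t])).
Proof.
move=> jD; apply/funext => t; rewrite mul1r /hittingG; congr fine.
set A := [set w | _].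
have AE i' : A `&` [set w | eta 0 w = i'] = hitset i' j `&` [set w | tau w <= t].
  apply/seteqP; split => [w [[n [nu wt wj]] w0]|w [[d _ H] /= wt]].
    split; last by rewrite /= (tauE nu).
    case: n nu wt wj => [[]//|d] [_ _ nu] wt wj; exists d => //; split.
      by move=> l; rewrite leqn0 => /eqP ->.
    by rewrite add0n; split.
  have [nu wj] := exitset_nu jD H; split.
    by exists d.+1; split => //; rewrite -/(clock d.+1 w) -(tauE nu).
  by have [H1 _] := H; exact: (H1 0%N (leqnn _)).
rewrite probability_setI_full ?AE//.
have -> : A = \big[setU/set0]_(i' <- enum 'I_M) (hitset i' j `&` [set w | tau w <= t]).
  rewrite -bigcup_seq; apply/seteqP; split => [w Aw|w [i' _ H]].
    exists (eta 0 w); first by rewrite /= mem_enum.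
    by have : (A `&` [set w' | eta 0 w' = eta 0 w]) w by []; rewrite AE.
  by have [] : (A `&` [set w' | eta 0 w' = i']) w by rewrite AE.
apply: bigsetU_measurable => i' _; apply: measurableI.
  exact: measurable_hitset.
exact: measurable_le_set measurable_tau _.
Qed.

Lemma hitting_subdf i j : j \in D -> subdf (hittingG Z D i j).
Proof.
move=> jD; rewrite hittingE//; apply: variable_subdf => //.
- exact: measurable_hitset.
- exact: measurable_tau.
- by move=> w _; exact: tau_ge0.
rewrite mul1r -[leRHS]/(fine 1%E) fine_le ?fin_num_measure//.
- exact: measurable_hitset.
- by apply: probability_le1; exact: measurable_hitset.
Qed.

Lemma escape_ge0 j s d i : 0 <= escape Z D j s d i.
Proof.
elim: d i => [|d IH] i /=; first exact: trL_ge0.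
by apply: sumr_ge0 => r _; rewrite mulr_ge0 ?trL_ge0.
Qed.

Lemma hitting_laplace_cvg i j s : j \in D -> 0 <= s ->
  \sum_(0 <= d < n) escape Z D j s d i @[n --> \oo] --> laplace (hittingG Z D i j) s.
Proof.
move=> jD s0; have mt := measurable_tau; have mh := measurable_hitset i j.
rewrite hittingE// variable_laplace//; last by move=> w _; exact: tau_ge0.
have fin := variable_laplace_fin (P i) mh mt s0 (fun w _ => tau_ge0 w).
rewrite mul1r; set I := (\int[_]_(_ in _) _)%E in fin *.
have IE : I = (\sum_(d <oo) (escape Z D j s d i)%:E)%E.
  rewrite /I /hitset ge0_integral_bigcup//=.
  - apply: eq_eseriesr => d _.
    transitivity (\int[P i]_(w in exitset D j (fun=> i) 0 d)
        (expR (- (s * clock (0 + d.+1) w)))%:E)%E.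
      apply: eq_integral => w; rewrite inE => H.
      by have [nu _] := exitset_nu jD H; rewrite (tauE nu).
    by rewrite exit_integral// big_geq// mul1r.
  - by move=> d; exact: measurable_exitset.
  - exact/measurable_funTS/measurable_EFinP/measurable_expRM.
  - apply/trivIsetP => a b _ _ ab; rewrite -subset0 => w [H1 H2].
    have [n1 _] := exitset_nu jD H1; have [n2 _] := exitset_nu jD H2.
    by have [] := is_nu_unique n1 n2 => e; rewrite e eqxx in ab.
have c : (\sum_(0 <= d < n) (escape Z D j s d i)%:E)%E @[n --> \oo] --> I.
  rewrite IE; apply: is_cvg_nneseries => d _ _.
  by rewrite lee_fin escape_ge0.
rewrite -(fineK fin) in c; move/fine_cvg: c.
by under eq_fun do rewrite /= sumEFin.
Qed.

Lemma cvg_sumn (I : Type) (r : seq I) (Q : pred I) (f : I -> nat -> R) (l : I -> R) :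
  (forall a, f a n @[n --> \oo] --> l a) ->
  \sum_(a <- r | Q a) f a n @[n --> \oo] --> \sum_(a <- r | Q a) l a.
Proof.
move=> fl; elim: r => [|a r IH].
  by rewrite big_nil; under eq_fun do rewrite big_nil; exact: cvg_cst.
rewrite big_cons; under eq_fun do rewrite big_cons.
by case: (Q a) => //; exact: cvgD.
Qed.

(** First-step analysis on partial sums: the sum up to n+1 satisfies the recursion of [escape] with
    the sums up to n, and both sides pass to the limit. *)
Lemma hitting_system i j s : j \in D -> 0 <= s ->
  laplace (hittingG Z D i j) s = trL Z s i j +
    \sum_(r in ~: D) trL Z s i r * laplace (hittingG Z D r j) s.
Proof.
move=> jD s0; have c1 := hitting_laplace_cvg (i := i) jD s0.
have c2 : trL Z s i j + \sum_(r in ~: D) trL Z s i r *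
    (\sum_(0 <= d < n) escape Z D j s d r) @[n --> \oo] -->
    trL Z s i j + \sum_(r in ~: D) trL Z s i r * laplace (hittingG Z D r j) s.
  apply: cvgD; first exact: cvg_cst.
  apply: cvg_sumn => r; apply: cvgM; first exact: cvg_cst.
  exact: hitting_laplace_cvg.
apply: (cvg_unique _ _ c2); first exact: Rhausdorff.
have : \sum_(0 <= d < n.+1) escape Z D j s d i @[n --> \oo] --> laplace (hittingG Z D i j) s.
  by rewrite (cvg_shiftS (fun n => \sum_(0 <= d < n) escape Z D j s d i)).
apply: cvg_trans; apply: near_eq_cvg; apply: nearW => n /=.
rewrite big_nat_recl//=; congr (_ + _); rewrite exchange_big/=.
by apply: eq_bigr => r _; rewrite mulr_sumr.
Qed.

End HittingSystem.

(** * Change of time scale and normalisation of the mass *)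

Section ScaledDf.
Context {R : realType}.
Local Notation ls h := (lebesgue_stieltjes_measure (cumulative_pack h)).
Local Notation half_line := (`[0%R, +oo[%classic : set (measurableTypeR R)).

Lemma scale_at_right (a v : R) : 0 < v -> x * v @[x --> a^'+] --> (a * v)^'+.
Proof.
move=> v0 P [e /= e0 H]; exists (e / v) => /=; first by rewrite divr_gt0.
move=> x /= + ax; rewrite ltr_pdivlMr// => xa.
apply: H => /=; last by rewrite ltr_pM2r.
by rewrite -mulrBl normrM (gtr0_norm v0).
Qed.

Lemma cumulative_scale (F : R -> R) (c v : R) : is_cumulative F -> 0 <= c ->
  0 < v -> is_cumulative (fun t => c * F (t * v)).
Proof.
move=> [nd rc] c0 v0; split.
  by move=> t u tu; rewrite ler_wpM2l// nd// ler_pM2r.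
move=> a; apply: cvgM; first exact: cvg_cst.
exact: (cvg_comp _ _ (scale_at_right v0) (rc (a * v))).
Qed.

(** The scaled function is the distribution function of x / v with weight c under the Stieltjes
    measure of F. *)
Lemma subdf_scale (F : R -> R) (c v : R) : subdf F -> 0 <= c -> 0 < v ->
  c * total_mass F <= 1 ->
  subdf (fun t => c * F (t * v)) /\
  forall s, 0 <= s -> laplace (fun t => c * F (t * v)) s = c * laplace F (s / v).
Proof.
move=> sF c0 v0 c1; have [h F0 F1] := sF.
have hc := cumulative_scale h c0 v0.
have H0 t : t < 0 -> c * F (t * v) = 0.
  by move=> t0; rewrite F0 ?mulr0// pmulr_llt0.
split.
  split => // t; apply: le_trans c1; rewrite ler_wpM2l//.
  exact: subdf_le_mass.
move=> s s0.
have mX : measurable_fun [set: measurableTypeR R] (fun x : measurableTypeR R => (x : R) / v).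
  by apply: measurable_funM => //; exact: measurable_id.
have := @stieltjes_laplace_repr _ _ _ (measurableTypeR R) (ls h) half_line
  (fun=> c) (fun x => x / v) hc H0 (@measurable_half_line R) (measurable_cst _)
  (fun=> c0) mX.
move=> H; rewrite {1}/laplace H//.
  under eq_integral do rewrite EFinM.
  rewrite ge0_integralZl_EFin//; last first.
    exact/measurable_funTS/measurable_EFinP/measurable_expRM.
  have sv : 0 <= s / v by rewrite divr_ge0// ltW.
  have E : (\int[ls h]_(x in half_line) (expR (- (s * (x / v))))%:E =
    \int[ls h]_(x in half_line) (expR (- (s / v * x)))%:E)%E.
    by apply: eq_integral => x _; rewrite mulrA mulrAC.
  rewrite [X in (_ * X)%E]E fineM//; first by rewrite (laplaceE h).
  apply: integrable_fin_num; first exact: measurable_half_line.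
  exact: laplace_integrable.
move=> u.
have -> : half_line `&` [set w | w / v <= u] = half_line `&` [set w | w <= u * v].
  by congr (_ `&` _); apply/seteqP; split => x /=; rewrite ler_pdivrMr.
rewrite integral_cst; last first.
  apply: measurableI; first exact: measurable_half_line.
  exact: (@measurable_le_set _ _ (measurableTypeR R) id (@measurable_id _ _ _)).
by rewrite [X in (_ * X)%E](ls_le_set h (u * v) F0) -EFinM.
Qed.

Lemma proper_of_mass (F : R -> R) : subdf F -> total_mass F = 1 -> proper_df F.
Proof.
by move=> sF m1; have [h F0 _] := sF; split => //; rewrite -m1; exact: subdf_cvg.
Qed.

End ScaledDf.

Section RenewalTransitions.
Context {R : realType} {M : nat} (Z : markov_renewal R M).
Implicit Types (i j : 'I_M).

Lemma trp_ge0 i j : 0 <= trp Z i j.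
Proof. by rewrite trpE trL_ge0. Qed.

Lemma total_mass_trQ i j : total_mass (trQ Z i j) = trp Z i j.
Proof. by []. Qed.

Lemma trF_scaled i j (v : R) : 0 < trp Z i j -> 0 < v ->
  proper_df (fun t => trF Z i j (t * v)) /\
  forall s, 0 <= s ->
    laplace (fun t => trF Z i j (t * v)) s = trL Z (s / v) i j / trp Z i j.
Proof.
move=> p0 v0; have sQ := trQ_subdf Z i j.
have -> : (fun t => trF Z i j (t * v)) = (fun t => (trp Z i j)^-1 * trQ Z i j (t * v)).
  by apply/funext => t; rewrite /trF mulrC.
have [||sF lF] := @subdf_scale _ (trQ Z i j) (trp Z i j)^-1 v sQ _ v0.
- by rewrite invr_ge0 ltW.
- by rewrite total_mass_trQ mulVf ?gt_eqF.
have lE s : 0 <= s -> laplace (fun t => (trp Z i j)^-1 * trQ Z i j (t * v)) s =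
    trL Z (s / v) i j / trp Z i j.
  by move=> s0; rewrite lF// trQ_laplace ?divr_ge0 ?(ltW v0)// mulrC.
split => //; apply: proper_of_mass => //.
by rewrite -laplace0// lE// mul0r -trpE divff// gt_eqF.
Qed.

Lemma laplace_trF_decay i j : 0 < trp Z i j -> (tre Z i j < +oo)%E ->
  decay (fun s => trL Z s i j / trp Z i j) (fine (tre Z i j)).
Proof.
move=> p0 te; have [pF lF] := trF_scaled p0 (@ltr01 R).
have E : (fun t => trF Z i j (t * 1)) = trF Z i j by apply/funext => t; rewrite mulr1.
rewrite E in pF lF; apply: decay_eq (laplace_decay pF te) => s s0.
by rewrite lF// divr1.
Qed.

(** A set A outside D is left by the chain that leads to D: at the least index l with c l outside A,
    the preceding state is in A, and the transition between them has positive probability. *)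
Lemma trp_escaping (Z1 : markov_renewal R M) (D : {set 'I_M}) :
  (forall i j, i \notin D -> (0 < trp Z i j) = (0 < trp Z1 i j)) ->
  (forall i, i \notin D -> exists (n : nat) (c : nat -> 'I_M),
     [/\ (0 < n)%N, c 0%N = i,
         (forall l, (0 < l < n)%N -> c l \notin D), c n \in D &
         0 < \prod_(1 <= l < n.+1) trp Z1 (c l.-1) (c l)]) ->
  escaping (~: D) [set: 'I_M]%SET (trp Z).
Proof.
move=> pE hB2; split.
- by move=> i j _ _; exact: trp_ge0.
- move=> i _; rewrite (eq_bigl xpredT); last by move=> j; rewrite inE.
  by rewrite trp_sum1.
move=> A /finset.set0Pn[i iA] /fintype.subsetP AD.
have iD : i \notin D by have := AD _ iA; rewrite inE.
have [n [c [n0 c0 _ cn cp]]] := hB2 _ iD.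
have ex : exists l, (c l \notin A) && (l <= n)%N.
  exists n; rewrite leqnn andbT; apply/negP => /AD; by rewrite inE cn.
case: (ex_minnP ex) => l /andP[lA ln] lmin.
case: l lA ln lmin => [|l] lA ln lmin; first by rewrite c0 iA in lA.
have lA' : c l \in A.
  apply/negP => /negP h; have := lmin l; rewrite h (ltnW ln) => /(_ isT).
  by rewrite ltnn.
exists (c l), (c l.+1); split => //.
rewrite pE; last by have := AD _ lA'; rewrite inE.
rewrite lt0r; apply/andP; split; last by rewrite trpE trL_ge0.
apply: contraTneq cp => h; rewrite -leNgt.
rewrite (@big_cat_nat _ _ _ l.+1)//=; last exact: leqW.
by rewrite [X in _ * X]big_ltn ?ltnS//= h mul0r mulr0.
Qed.

End RenewalTransitions.

(** * Asymptotics of the levels *)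

Section LevelAsymptotics.
Context {R : realType} {M : nat}.
Variables (D : {set 'I_M}) (k : nat -> 'I_M) (m : nat).
Hypothesis hk : perm_eq [seq k n | n <- iota 1 m] (enum (~: D)).
Variables (p : R -> 'I_M -> 'I_M -> R) (q : R -> R -> 'I_M -> 'I_M -> R).
Variables (v : R -> 'I_M -> R) (p0 : 'I_M -> 'I_M -> R).
Variables (F0 : 'I_M -> 'I_M -> R -> R).
Variables (pt0 qh0 : nat -> 'I_M -> 'I_M -> R) (w0 : nat -> 'I_M -> 'I_M -> \bar R).
Hypothesis v_gt0 : forall e i, 0 < e <= 1 -> i \notin D -> 0 < v e i.
Hypothesis p_esc : forall e, 0 < e <= 1 -> escaping (~: D) [set: 'I_M]%SET (p e).
Hypothesis p_pos : forall e i j, 0 < e <= 1 -> i \notin D ->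
  (0 < p e i j) = (0 < p 1 i j).
Hypothesis q_le : forall e s i j, 0 < e <= 1 -> 0 <= s -> i \notin D ->
  0 <= q e s i j <= p e i j.
Hypothesis p_cvg : forall i j, i \notin D -> p e i j @[e --> 0^'+] --> p0 i j.
Hypothesis base : forall i j, i \notin D -> 0 < p 1 i j -> exists mu,
  decay_cvg (fun e s => q e (s / v e i) i j / p e i j) mu
    (laplace (F0 i j)) (fine (expectation_df (F0 i j))).
Hypothesis hi : forall n i j, (n <= m.-1)%N -> i \in Dbarlev D k n ->
  j \in Xlev k n -> ptlev (p e) k n i j @[e --> 0^'+] --> pt0 n i j.
Hypothesis hii : forall n i j, (1 <= n <= m.-1)%N -> i \in Dbarlev D k n ->
  j \in Ylev (p 1) k n i ->
  qhat (p e) k n i j @[e --> 0^'+] --> qh0 n i j /\ 0 <= qh0 n i j <= 1.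
Hypothesis hiii : forall n i j, (1 <= n <= m.-1)%N -> i \in Dbarlev D k n.-1 ->
  j \in Dbarlev D k n.-1 ->
  (vtlev (p e) (v e) k n.-1 j / vtlev (p e) (v e) k n.-1 i)%:E
    @[e --> 0^'+] --> w0 n.-1 j i /\ (0 <= w0 n.-1 j i)%E.
Hypothesis hiv : forall n i, (1 <= n <= m.-1)%N -> i \in Dbarlev D k n.-1 ->
  (w0 n.-1 (k n) i < +oo)%E.

Let phi n := phi0lev (p 1) p0 pt0 qh0 w0 F0 k n.
Let mean n := e0lev (p 1) p0 pt0 qh0 w0 F0 k n.
Let phit n := phit0lev (p 1) p0 pt0 qh0 w0 F0 k n.
Let meant n := etilde0 (p 1) p0 pt0 k n (mean n).

(** The quotient is the transform of the conditional law on the scale of state i. Its means before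
    the limit are left existential, as only their limit is prescribed. *)
Definition level_cvg n := forall i j, i \in Dbarlev D k n ->
  j \in Ylev (p 1) k n i -> exists mu,
  decay_cvg (fun e s => plev (q e (s / vlev (p e) (v e) k n i)) k n i j /
                        plev (p e) k n i j) mu (phi n i j) (mean n i j).

Definition level_tilde_cvg n := forall i j, i \in Dbarlev D k n ->
  j \in Ytlev (p 1) k n i -> exists mu,
  decay_cvg (fun e s => ptlev (q e (s / vtlev (p e) (v e) k n i)) k n i j /
                        ptlev (p e) k n i j) mu (phit n i j) (meant n i j).

Lemma one_itv01 : (0 : R) < (1 : R) <= 1. Proof. by rewrite ltr01 lexx. Qed.

Lemma Dbarlev_notin n i : i \in Dbarlev D k n -> i \notin D.
Proof. by rewrite !inE => /andP[]. Qed.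

Lemma vlev_gt0 n e i : (n < m)%N -> 0 < e <= 1 -> i \in Dbarlev D k n ->
  0 < vlev (p e) (v e) k n i.
Proof.
elim: n => [|n IH] nm e01 iS; first by apply: v_gt0 => //; exact: Dbarlev_notin iS.
move: iS; rewrite DbarlevS => /finset.setD1P[_ iS].
rewrite /= divr_gt0 ?IH ?(ltnW nm)// subr_gt0.
exact: (plev_diag_lt1 hk (p_esc e01) (ltnW nm)).
Qed.

Lemma vtlev_gt0 n e i : (n < m)%N -> 0 < e <= 1 -> i \in Dbarlev D k n ->
  0 < vtlev (p e) (v e) k n i.
Proof.
move=> nm e01 iS; rewrite divr_gt0 ?vlev_gt0// subr_gt0.
exact: (plev_diag_lt1 hk (p_esc e01)).
Qed.

Lemma plev_pos n e i j : (n < m)%N -> 0 < e <= 1 -> i \in Dbarlev D k n ->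
  j \in Xlev k n -> (0 < plev (p e) k n i j) = (0 < plev (p 1) k n i j).
Proof.
move=> nm e01; apply: (plev_gt0_eq hk) => //.
- exact: p_esc.
- exact: p_esc one_itv01.
- by move=> a b; exact: p_pos.
Qed.

Lemma ptlev_pos n e i j : (n < m)%N -> 0 < e <= 1 -> i \in Dbarlev D k n ->
  j \in Xlev k n -> (0 < ptlev (p e) k n i j) = (j \in Ytlev (p 1) k n i).
Proof.
move=> nm e01 iS jX; have [->|ji] := eqVneq j i.
  by rewrite /ptlev ptilde_diag ltxx !inE eqxx.
rewrite [RHS]finset.in_setD1 ji/= [RHS]finset.in_set jX/= -(plev_pos nm e01)//.
exact: (ptilde_gt0 (Dbarlev_sub_Xlev D k n) (escaping_lev hk (p_esc e01) nm)).
Qed.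

Lemma ptlev_ge0 n e i j : (n < m)%N -> 0 < e <= 1 -> i \in Dbarlev D k n ->
  j \in Xlev k n -> 0 <= ptlev (p e) k n i j.
Proof.
move=> nm e01.
exact: (ptilde_ge0 (Dbarlev_sub_Xlev D k n) (escaping_lev hk (p_esc e01) nm)).
Qed.

Lemma ptlev_eq0 n e i j : (n < m)%N -> 0 < e <= 1 -> i \in Dbarlev D k n ->
  j \in Xlev k n -> j \notin Ytlev (p 1) k n i -> ptlev (p e) k n i j = 0.
Proof.
move=> nm e01 iS jX; rewrite -(ptlev_pos nm e01)// -leNgt => h.
by apply/eqP; rewrite eq_le h ptlev_ge0.
Qed.

Lemma plev_cvg n i j : (n < m)%N -> i \in Dbarlev D k n -> j \in Xlev k n ->
  plev (p e) k n i j @[e --> 0^'+] --> p0lev p0 pt0 k n i j.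
Proof.
case: n => [|n] nm; first by move=> /Dbarlev_notin iD _; exact: p_cvg.
have cS := enum_in_Dbarlev hk (ltnW nm).
have SX := Dbarlev_sub_Xlev D k n; have cX := fintype.subsetP SX _ cS.
rewrite DbarlevS XlevS => /finset.setD1P[_ iS] /finset.setD1P[_ jX].
have nm' : (n <= m.-1)%N by rewrite -ltnS (ltn_predK nm) ltnW.
by apply: cvgD; [exact: hi|apply: cvgM; exact: hi].
Qed.

(** If i is not in its own set Y, the diagonal vanishes for all parameters and nothing changes;
    otherwise this is the removal of geometrically many loops. *)
Lemma level_to_tilde n : (n < m)%N -> level_cvg n -> level_tilde_cvg n.
Proof.
move=> nm lc i j iS; rewrite finset.in_setD1 => /andP[ji jY].
have jX : j \in Xlev k n by move: jY; rewrite inE => /andP[].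
have iX := fintype.subsetP (Dbarlev_sub_Xlev D k n) _ iS.
have [mu dc] := lc _ _ iS jY.
have P1 e : 0 < e <= 1 -> 0 < 1 - plev (p e) k n i i.
  by move=> e01; rewrite subr_gt0; exact: (plev_diag_lt1 hk (p_esc e01)).
have Pij e : 0 < e <= 1 -> 0 < plev (p e) k n i j.
  by move=> e01; rewrite plev_pos//; move: jY; rewrite inE => /andP[].
have qn e s : 0 < e <= 1 -> 0 <= s ->
    0 <= plev (q e s) k n i i <= plev (p e) k n i i.
  move=> e01 s0; apply: (plev_le hk (p_esc e01)) => // a b aD; exact: q_le.
have [iY|iY] := boolP (i \in Ylev (p 1) k n i); last first.
  have Pii e : 0 < e <= 1 -> plev (p e) k n i i = 0.
    move=> e01; move: iY; rewrite finset.in_set iX/= -(plev_pos nm e01)// -leNgt => h.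
    apply/eqP; rewrite eq_le h/=.
    by have /andP[+ +] := qn e 0 e01 (lexx 0) => /le_trans; exact.
  exists mu; apply: decay_cvg_eq dc => //.
  - move=> e s e01 s0; rewrite /vtlev Pii// subr0 divr1 /ptlev.
    rewrite !ptilde_offdiag// Pii// subr0 divr1.
    set x := s / _; have x0 : 0 <= x by rewrite divr_ge0// ltW// vlev_gt0.
    have := qn _ _ e01 x0; rewrite Pii// -eq_le => /eqP <-.
    by rewrite subr0 divr1.
  - by move=> s s0; rewrite /phit /phit0lev /phitilde0 iY.
  - by rewrite /meant /etilde0 (negbTE iY).
have [mu' dc'] := lc _ _ iS iY.
have Pii e : 0 < e <= 1 -> 0 < plev (p e) k n i i.
  by move=> e01; rewrite plev_pos//; move: iY; rewrite inE => /andP[].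
have pp e : 0 < e <= 1 -> 0 <= plev (p e) k n i i < 1.
  by move=> e01; rewrite ltW ?Pii//= -subr_gt0 P1.
have := decay_cvg_geom pp (plev_cvg nm iS iX) dc dc'.
move=> dg; eexists; apply: decay_cvg_eq dg => //.
- move=> e s e01 s0 /=; rewrite /vtlev /ptlev !ptilde_offdiag//.
  set P := plev (p e) k n i i; set V := vlev _ _ _ _ _.
  (* Dividing the time scale by 1 - P multiplies the argument by 1 - P, as in [decay_cvg_geom]. *)
  have -> : s / (V / (1 - P)) = (1 - P) * s / V.
    by rewrite invfM invrK mulrA mulrAC [_ * s]mulrC.
  set Q := plev (q e _) k n.
  have x0 : 0 <= (1 - P) * s / V.
    rewrite divr_ge0 ?mulr_ge0 ?(ltW (P1 _ e01))// ltW//.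
    exact: vlev_gt0.
  have /andP[h1 h2] := qn _ _ e01 x0.
  have /lt0r_neq0 hP := P1 _ e01; have /lt0r_neq0 hj := Pij _ e01.
  have /lt0r_neq0 hii' := Pii _ e01.
  have /lt0r_neq0 hQ : 0 < 1 - Q i i.
    by apply: lt_le_trans (P1 _ e01) _; rewrite lerD2l lerN2.
  rewrite -/P [P * _]mulrC divfK// !invfM invrK; ring.
- by move=> s s0; rewrite /phit /phit0lev /phitilde0 iY.
- by rewrite /meant /etilde0 iY.
Qed.

(** A passage from i to j is direct or goes through c. If both routes exist, the new quotient is the
    mixture of the two with weight [qhat]; otherwise it is the quotient of the only route. *)
Lemma tilde_to_level n : (n.+1 < m)%N -> level_tilde_cvg n -> level_cvg n.+1.
Proof.
move=> nm lt i j iS1 jY1.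
have nm' := ltnW nm.
have jX1 : j \in Xlev k n.+1 by move: jY1; rewrite inE => /andP[].
have cS := enum_in_Dbarlev hk nm'.
have SX := Dbarlev_sub_Xlev D k n; have cX := fintype.subsetP SX _ cS.
have iS : i \in Dbarlev D k n by move: iS1; rewrite DbarlevS => /finset.setD1P[].
have jX : j \in Xlev k n by move: jX1; rewrite XlevS => /finset.setD1P[].
have nm1 : (1 <= n.+1 <= m.-1)%N by rewrite /= -ltnS (ltn_predK nm).
set c := k n.+1 in cS cX.
have P e : 0 < e <= 1 -> 0 < plev (p e) k n.+1 i j.
  by move=> e01; rewrite plev_pos//; move: jY1; rewrite inE => /andP[].
have tle e s a b : 0 < e <= 1 -> 0 <= s -> a \in Dbarlev D k n -> b \in Xlev k n ->
    0 <= ptlev (q e s) k n a b <= ptlev (p e) k n a b.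
  move=> e01 s0; apply: (ptlev_le hk (p_esc e01)) => // i' j' iD; exact: q_le.
have t0 e s a b : 0 < e <= 1 -> 0 <= s -> a \in Dbarlev D k n -> b \in Xlev k n ->
    b \notin Ytlev (p 1) k n a -> ptlev (q e s) k n a b = 0.
  move=> e01 s0 aS bX bY; have := tle _ _ _ _ e01 s0 aS bX.
  by rewrite (ptlev_eq0 nm' e01)// -eq_le => /eqP.
have tp e a b : 0 < e <= 1 -> a \in Dbarlev D k n -> b \in Xlev k n ->
    b \in Ytlev (p 1) k n a -> ptlev (p e) k n a b != 0.
  by move=> e01 aS bX bY; rewrite gt_eqF// ptlev_pos.
have PE e : plev (p e) k n.+1 i j = ptlev (p e) k n i j +
    ptlev (p e) k n i c * ptlev (p e) k n c j by [].
have QE e s : plev (q e s) k n.+1 i j = ptlev (q e s) k n i j +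
    ptlev (q e s) k n i c * ptlev (q e s) k n c j by [].
have VE e : vlev (p e) (v e) k n.+1 i = vtlev (p e) (v e) k n i by [].
have x0 e s : 0 < e <= 1 -> 0 <= s -> 0 <= s / vtlev (p e) (v e) k n i.
  by move=> e01 s0; rewrite divr_ge0// ltW// vtlev_gt0.
(* The route through c. The law from c to j converges on the scale of c; reading it on the scale of
   i multiplies the argument by the ratio of the scales, whose limit is finite by (iv). *)
have prod : c \in Ytlev (p 1) k n i -> j \in Ytlev (p 1) k n c -> exists mu,
    decay_cvg (fun e s =>
      ptlev (q e (s / vtlev (p e) (v e) k n i)) k n i c / ptlev (p e) k n i c *
     (ptlev (q e (s / vtlev (p e) (v e) k n i)) k n c j / ptlev (p e) k n c j))
      mu (fun s => phit n i c s * phit n c j (fine (w0 n c i) * s))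
      (meant n i c + fine (w0 n c i) * meant n c j).
  move=> cY jY; have [mu1 d1] := lt _ _ iS cY; have [mu2 d2] := lt _ _ cS jY.
  have [cw w0ge] := hiii nm1 iS cS; rewrite /= in cw w0ge.
  have wlt := hiv nm1 iS; rewrite /= -/c in wlt.
  have wE : w0 n c i = (fine (w0 n c i))%:E by rewrite fineK// ge0_fin_numE.
  have cw' : vtlev (p e) (v e) k n c / vtlev (p e) (v e) k n i
      @[e --> 0^'+] --> fine (w0 n c i).
    by move: cw; rewrite wE => /fine_cvgP[_].
  have wge e : 0 < e <= 1 ->
      0 <= vtlev (p e) (v e) k n c / vtlev (p e) (v e) k n i.
    by move=> e01; rewrite divr_ge0// ltW// vtlev_gt0.
  have dd := decay_cvg_mul d1 (decay_cvg_scale wge (fine_ge0 w0ge) cw' d2).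
  eexists; apply: decay_cvg_eq dd => // e s e01 s0 /=.
  have /lt0r_neq0 vc : 0 < vtlev (p e) (v e) k n c by exact: vtlev_gt0.
  have /lt0r_neq0 vi : 0 < vtlev (p e) (v e) k n i by exact: vtlev_gt0.
  have -> // : vtlev (p e) (v e) k n c / vtlev (p e) (v e) k n i * s /
    vtlev (p e) (v e) k n c = s / vtlev (p e) (v e) k n i.
  by field; rewrite vc vi.
have [jY|jY] := boolP (j \in Ytlev (p 1) k n i).
  have [mu1 d1] := lt _ _ iS jY.
  have [/andP[cY jY']|ncY] :=
      boolP ((c \in Ytlev (p 1) k n i) && (j \in Ytlev (p 1) k n c)).
    have [mu2 d2] := prod cY jY'.
    have [cq q01] := hii nm1 iS1 jY1.
    have qe e : 0 < e <= 1 -> 0 <= qhat (p e) k n.+1 i j <= 1.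
      move=> e01; rewrite /qhat [n.+1.-1]/=; have PP := P _ e01.
      rewrite divr_ge0 ?(ltW PP) ?ptlev_ge0// andTb ler_pdivrMr// mul1r PE.
      by rewrite lerDl mulr_ge0// ptlev_ge0.
    have dd := decay_cvg_mix qe q01 cq d1 d2.
    eexists; apply: decay_cvg_eq dd => //.
    - move=> e s e01 s0; rewrite VE QE /qhat [n.+1.-1]/=.
      have PP := P _ e01; have /lt0r_neq0 PN := PP.
      have n1 := tp _ _ _ e01 iS jX jY; have n2 := tp _ _ _ e01 iS cX cY.
      have n3 := tp _ _ _ e01 cS jX jY'; rewrite PE in PN *.
      by field; rewrite n1 n2 n3 PN.
    - by move=> s s0; rewrite /phi /= /phistep0 jY -/c cY jY'.
    - by rewrite /mean /= /estep0 jY -/c cY jY'.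
  exists mu1; apply: decay_cvg_eq d1 => //.
  - move=> e s e01 s0; rewrite VE QE PE.
    rewrite negb_and in ncY; case/orP: ncY => ncY.
      rewrite [ptlev (q _ _) _ _ _ c]t0 ?x0// mul0r addr0.
      by rewrite [ptlev (p _) _ _ _ c]ptlev_eq0// mul0r addr0.
    rewrite [ptlev (q _ _) _ _ c _]t0 ?x0// mulr0 addr0.
    by rewrite [ptlev (p _) _ _ c _]ptlev_eq0// mulr0 addr0.
  - by move=> s s0; rewrite /phi /= /phistep0 jY -/c (negbTE ncY).
  - by rewrite /mean /= /estep0 jY -/c (negbTE ncY).
(* Without a direct passage, positivity at level n+1 can only come from the route through c. *)
have [cY jY'] : c \in Ytlev (p 1) k n i /\ j \in Ytlev (p 1) k n c.
  have := P _ one_itv01; rewrite (plev_gt0 hk)//; last exact: p_esc one_itv01.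
  by rewrite !(ptlev_pos nm' one_itv01)// (negbTE jY) => /andP.
have [mu2 d2] := prod cY jY'.
exists mu2; apply: decay_cvg_eq d2 => //.
- move=> e s e01 s0; rewrite VE QE PE (t0 _ _ _ _ e01 (x0 _ _ e01 s0) iS jX jY).
  rewrite (ptlev_eq0 nm' e01 iS jX jY) !add0r.
  by rewrite mulf_div.
- by move=> s s0; rewrite /phi /= /phistep0 (negbTE jY).
- by rewrite /mean /= /estep0 (negbTE jY).
Qed.

Theorem levels_cvg n : (n < m)%N -> level_tilde_cvg n.
Proof.
elim: n => [|n IH] nm; apply: level_to_tilde => //.
  move=> i j iS; rewrite inE => /andP[_ pij].
  by have [mu d] := base (Dbarlev_notin iS) pij; exists mu.
by apply: tilde_to_level => //; apply: IH; exact: ltnW.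
Qed.

End LevelAsymptotics.

(** * Convergence of the hitting distributions *)

Theorem theorem4 (R : realType) (M : nat) (hM : (2 <= M)%N)
    (D : {set 'I_M}) (hD0 : D != finset.set0) (hDT : D != [set: 'I_M]%SET)
    (Z : R -> markov_renewal R M)
    (v : R -> 'I_M -> R)
    (hv : forall e i, 0 < e <= 1 -> i \notin D -> 1 <= v e i)
    (p0 : 'I_M -> 'I_M -> R) (F0 : 'I_M -> 'I_M -> R -> R)
    (v0 : 'I_M -> \bar R)
    (* (A) *)
    (hA : forall e i, 0 < e <= 1 -> sojourn_df (Z e) i 0 < 1)
    (* (B) *)
    (hB1 : forall i j, i \notin D ->
       (forall e, 0 < e <= 1 -> 0 < trp (Z e) i j) \/
       (forall e, 0 < e <= 1 -> trp (Z e) i j = 0))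
    (hB2 : forall i, i \notin D ->
       exists (n : nat) (c : nat -> 'I_M),
         [/\ (0 < n)%N, c 0%N = i,
             (forall l, (0 < l < n)%N -> c l \notin D), c n \in D &
             0 < \prod_(1 <= l < n.+1) trp (Z 1) (c l.-1) (c l)])
    (* (C) *)
    (hC : forall i j, i \notin D -> trp (Z e) i j @[e --> 0^'+] --> p0 i j)
    (* (D) *)
    (hD1 : forall i j, i \notin D -> 0 < trp (Z 1) i j ->
       [/\ weak_cvg (fun e t => trF (Z e) i j (t * v e i)) (F0 i j),
           proper_df (F0 i j) & F0 i j 0 < 1])
    (hD2 : forall i, i \notin D ->
       (v e i)%:E @[e --> 0^'+] --> v0 i /\ (1%:E <= v0 i)%E)
    (* (E) *)
    (hE : forall i j, i \notin D -> 0 < trp (Z 1) i j ->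
       [/\ (forall e, 0 < e <= 1 -> (tre (Z e) i j < +oo)%E),
           (expectation_df (F0 i j) < +oo)%E &
           fine (tre (Z e) i j) / v e i @[e --> 0^'+]
             --> fine (expectation_df (F0 i j))])
    (* the enumeration k_1, ..., k_mbar of the complement of D *)
    (mbar : nat) (hmbar : mbar = #|~: D|)
    (k : nat -> 'I_M)
    (hk : perm_eq [seq k n | n <- iota 1 mbar] (enum (~: D)))
    (pt0 qh0 : nat -> 'I_M -> 'I_M -> R) (w0 : nat -> 'I_M -> 'I_M -> \bar R)
    (* (i) *)
    (hi : forall n i j, (n <= mbar.-1)%N -> i \in Dbarlev D k n ->
       j \in Xlev k n ->
       ptlev (trp (Z e)) k n i j @[e --> 0^'+] --> pt0 n i j /\
       0 <= pt0 n i j <= 1)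
    (* (ii) *)
    (hii : forall n i j, (1 <= n <= mbar.-1)%N -> i \in Dbarlev D k n ->
       j \in Ylev (trp (Z 1)) k n i ->
       qhat (trp (Z e)) k n i j @[e --> 0^'+] --> qh0 n i j /\
       0 <= qh0 n i j <= 1)
    (* (iii) *)
    (hiii : forall n i j, (1 <= n <= mbar.-1)%N -> i \in Dbarlev D k n.-1 ->
       j \in Dbarlev D k n.-1 ->
       (vtlev (trp (Z e)) (v e) k n.-1 j / vtlev (trp (Z e)) (v e) k n.-1 i)%:E
         @[e --> 0^'+] --> w0 n.-1 j i /\
       (0 <= w0 n.-1 j i)%E)
    (* (iv) *)
    (hiv : forall n i, (1 <= n <= mbar.-1)%N -> i \in Dbarlev D k n.-1 ->
       (w0 n.-1 (k n) i < +oo)%E) :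
  forall j, j \in D ->
    let G := fun e t =>
      hittingG (Z e) D (k mbar) j
        (t * vtlev (trp (Z e)) (v e) k mbar.-1 (k mbar)) in
    let is_Ft := fun F : R -> R =>
      proper_df F /\
      forall s, 0 <= s ->
        laplace F s =
        phit0lev (trp (Z 1)) p0 pt0 qh0 w0 F0 k mbar.-1 (k mbar) j s in
    if j \in Ytlev (trp (Z 1)) k mbar.-1 (k mbar) then
      (exists Ft, is_Ft Ft) /\
      (forall Ft, is_Ft Ft ->
         weak_cvg G (fun t => Ft t * pt0 mbar.-1 (k mbar) j))
    else weak_cvg G (fun _ => 0).
Proof.
move=> j jD G is_Ft.
have lt01 : 0 < (1 : R) <= 1 by rewrite ltr01 lexx.
have m0 : (0 < mbar)%N.
  rewrite hmbar card_gt0; apply: contra hDT => /eqP D0.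
  by rewrite -(finset.setCK D) D0 finset.setC0.
have mm : (mbar.-1 < mbar)%N by rewrite prednK.
pose p e := trp (Z e); pose q e s := trL (Z e) s.
have v_gt0 e i : 0 < e <= 1 -> i \notin D -> 0 < v e i.
  by move=> e01 iD; apply: lt_le_trans (hv _ _ e01 iD).
have p_pos e i l : 0 < e <= 1 -> i \notin D -> (0 < p e i l) = (0 < p 1 i l).
  move=> e01 iD; have [h|h] := hB1 i l iD; first by rewrite /p !h.
  by rewrite /p !h// ltxx.
have p_esc e : 0 < e <= 1 -> escaping (~: D) [set: 'I_M]%SET (p e).
  move=> e01; apply: (trp_escaping (Z1 := Z 1)) => // i l iD; exact: p_pos.
have q_le e s i l : 0 < e <= 1 -> 0 <= s -> i \notin D -> 0 <= q e s i l <= p e i l.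
  by move=> _ s0 _; rewrite trL_ge0 trL_le.
have base i l : i \notin D -> 0 < p 1 i l -> exists mu,
    decay_cvg (fun e s => q e (s / v e i) i l / p e i l) mu
      (laplace (F0 i l)) (fine (expectation_df (F0 i l))).
  move=> iD pil; have [wc pF _] := hD1 i l iD pil; have [te ef ce] := hE i l iD pil.
  exists (fun e => fine (tre (Z e) i l) / v e i); split => //.
  - move=> e e01; have ve := v_gt0 _ _ e01 iD; have pe : 0 < p e i l by rewrite p_pos.
    have ve' : 0 <= (v e i)^-1 by rewrite invr_ge0 ltW.
    have := decay_scale ve' (laplace_trF_decay pe (te _ e01)).
    by rewrite mulrC; apply: decay_eq => s s0; rewrite [_ * s]mulrC.
  - move=> s s0.
    have sF e : 0 < e <= 1 -> subdf (fun t => trF (Z e) i l (t * v e i)).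
      move=> e01; have pe : 0 < p e i l by rewrite p_pos.
      by have [/proper_subdf] := trF_scaled pe (v_gt0 _ _ e01 iD).
    apply: cvg_eq_itv01 (weak_cvg_laplace sF (proper_subdf pF) wc s0) => e e01.
    have pe : 0 < p e i l by rewrite p_pos.
    by have [_ ->] := trF_scaled pe (v_gt0 _ _ e01 iD).
  - exact: laplace_decay.
have hi' n i l : (n <= mbar.-1)%N -> i \in Dbarlev D k n -> l \in Xlev k n ->
    ptlev (p e) k n i l @[e --> 0^'+] --> pt0 n i l.
  by move=> nm iS lX; have [] := hi n i l nm iS lX.
have kS : k mbar \in Dbarlev D k mbar.-1.
  by rewrite -{1}(prednK m0); exact: (enum_in_Dbarlev hk).
have jX : j \in Xlev k mbar.-1 by apply: (mem_D_Xlev hk) => //; exact: leq_pred.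
pose vt e := vtlev (p e) (v e) k mbar.-1 (k mbar).
have vt_gt0 e : 0 < e <= 1 -> 0 < vt e by move=> e01; exact: (vtlev_gt0 hk).
pose pt e := ptlev (p e) k mbar.-1 (k mbar) j.
have pt_cvg : pt e @[e --> 0^'+] --> pt0 mbar.-1 (k mbar) j by exact: hi'.
have hit_laplace e s : 0 < e <= 1 -> 0 <= s ->
    laplace (hittingG (Z e) D (k mbar) j) s = ptlev (q e s) k mbar.-1 (k mbar) j.
  move=> e01 s0.
  apply: (elimination hk (g := fun i => laplace (hittingG (Z e) D i j) s)) => //.
    (* The pivots for q(s) do not vanish: its diagonal is dominated by that of p, which is below
       1. *)
    move=> n i nm iS; rewrite lt_eqF//.
    apply: le_lt_trans (plev_diag_lt1 hk (p_esc _ e01) nm iS).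
    have iX := fintype.subsetP (Dbarlev_sub_Xlev D k n) _ iS.
    have qp a b : a \notin D -> 0 <= q e s a b <= p e a b by exact: q_le.
    by have /andP[_] := plev_le hk (p_esc _ e01) qp nm iS iX.
  by move=> i iD; exact: hitting_system.
have hit_mass e : 0 < e <= 1 -> total_mass (hittingG (Z e) D (k mbar) j) = pt e.
  move=> e01; rewrite -laplace0; last exact: hitting_subdf.
  rewrite hit_laplace// /pt; congr (ptlev _ _ _ _ _).
  by apply/funext => a; apply/funext => b; rewrite /p trpE.
have pt_ge0 e : 0 < e <= 1 -> 0 <= pt e by move=> e01; exact: (ptlev_ge0 hk).
have G_le e t : 0 < e <= 1 -> 0 <= G e t <= pt e.
  move=> e01; have sh := hitting_subdf (Z e) (k mbar) jD.
  by rewrite /G subdf_ge0//= -hit_mass//; exact: subdf_le_mass.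
have G_mass e : 0 < e <= 1 -> total_mass (G e) = pt e.
  move=> e01; have sh := hitting_subdf (Z e) (k mbar) jD.
  have GE : G e = fun t => 1 * hittingG (Z e) D (k mbar) j (t * vt e).
    by apply/funext => t; rewrite mul1r.
  have [|sG lG] := subdf_scale sh ler01 (vt_gt0 _ e01).
    by rewrite mul1r subdf_mass_le1.
  rewrite GE -laplace0// lG// mul1r mul0r laplace0//; exact: hit_mass.
have [jY|jY] := boolP (j \in Ytlev (trp (Z 1)) k mbar.-1 (k mbar)); last first.
  have pt_eq0 e : 0 < e <= 1 -> pt e = 0 by move=> e01; exact: (ptlev_eq0 hk).
  have mass0 : total_mass (fun _ : R => 0 : R) = 0 by apply: cvg_lim => //; exact: cvg_cst.
  split => [t _|].
    apply: (@cvg_eq_itv01 _ _ (fun=> 0)); last exact: cvg_cst.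
    by move=> e e01; apply/eqP; have := G_le e t e01; rewrite pt_eq0// -eq_le eq_sym.
  rewrite mass0; apply: (@cvg_eq_itv01 _ _ (fun=> 0)); last exact: cvg_cst.
  by move=> e e01; rewrite G_mass// pt_eq0.
have pt_gt0 e : 0 < e <= 1 -> 0 < pt e by move=> e01; rewrite /pt (ptlev_pos hk).
have [mu dc] := levels_cvg hk v_gt0 p_esc p_pos q_le hC base hi' hii hiii hiv mm kS jY.
have [_ cphi _ dphi] := dc.
(* Dividing by the mass gives proper distribution functions, to which the continuity theorem applies
   even if the mass tends to 0. *)
pose F e t := (pt e)^-1 * hittingG (Z e) D (k mbar) j (t * vt e).
have FP e : 0 < e <= 1 -> subdf (F e) /\ forall s, 0 <= s ->
    laplace (F e) s = ptlev (q e (s / vt e)) k mbar.-1 (k mbar) j / pt e.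
  move=> e01; have sh := hitting_subdf (Z e) (k mbar) jD.
  have pte := pt_gt0 _ e01; have vte := vt_gt0 _ e01.
  have [||sF lF] := @subdf_scale _ _ (pt e)^-1 (vt e) sh _ vte.
  - by rewrite invr_ge0 ltW.
  - by rewrite hit_mass// mulVf// gt_eqF.
  split => // s s0; have sv : 0 <= s / vt e by rewrite divr_ge0// ltW.
  by rewrite lF// (hit_laplace _ _ e01 sv) mulrC.
have sF e : 0 < e <= 1 -> subdf (F e) by move=> /FP[].
have pF e : 0 < e <= 1 -> proper_df (F e).
  move=> e01; have [sFe lFe] := FP _ e01; apply: proper_of_mass => //.
  rewrite -laplace0// lFe// mul0r -hit_laplace// laplace0; last exact: hitting_subdf.
  by rewrite hit_mass// divff// gt_eqF// pt_gt0.
have cF s : 0 <= s -> laplace (F e) s @[e --> 0^'+] -->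
    phit0lev (trp (Z 1)) p0 pt0 qh0 w0 F0 k mbar.-1 (k mbar) j s.
  move=> s0; apply: cvg_eq_itv01 (cphi s s0) => e e01.
  by have [_ ->] := FP _ e01.
split; first exact: (laplace_limit_df sF dphi cF pF).
move=> Ft [pFt lFt].
have wF : weak_cvg F Ft.
  apply: laplace_cvg_weak => //; first exact: proper_subdf.
  by move=> s s0; rewrite lFt//; exact: cF.
have GE e t : 0 < e <= 1 -> G e t = F e t * pt e.
  by move=> e01; rewrite /F mulrC mulrA divff ?mul1r// gt_eqF// pt_gt0.
have [cFt _] := wF; split => [t ct|].
  (* If the limit mass is 0, every t is a continuity point of the product but perhaps not of Ft, so
     G e t is squeezed between 0 and its mass. Otherwise division by the limit mass returns
     continuity to Ft. *)
  have [z|nz] := eqVneq (pt0 mbar.-1 (k mbar) j) 0.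
    rewrite z mulr0; rewrite z in pt_cvg.
    apply: (squeeze_cvgr _ (cvg_cst 0) pt_cvg).
    by near=> e; apply: G_le; near: e; exact: near0_itv01.
  apply: (@cvg_eq_itv01 _ _ (fun e => F e t * pt e)); first by move=> e; exact: GE.
  apply: cvgM => //; apply: cFt.
  have -> : Ft = fun t => Ft t * pt0 mbar.-1 (k mbar) j / pt0 mbar.-1 (k mbar) j.
    by apply/funext => x; rewrite mulfK.
  by apply: cvgM; [exact: ct|exact: cvg_cst].
have -> : total_mass (fun t => Ft t * pt0 mbar.-1 (k mbar) j) = pt0 mbar.-1 (k mbar) j.
  apply: cvg_lim => //; rewrite -[X in _ --> X]mul1r.
  by apply: cvgM; [have [] := pFt|exact: cvg_cst].
by apply: cvg_eq_itv01 pt_cvg => e e01; rewrite G_mass.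
Unshelve. all: by end_near. Qed.
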